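(* Let $\mathcal{A}$ be a unital simple separable C*-algebra with real rank zero, stable rank one, and strict comparison of projections. Let $a \in \mathcal{A}$ be an element such that $\tau(a)=0$ for all $\tau\in T(\mathcal{A})$. Then $a$ is the sum of two commutators; i.e., there exist $y_1,y_2,y_3,y_4\in\mathcal{A}$ such that $$a=[y_1,y_2]+[y_3,y_4].$$ If, in addition, $a$ is self-adjoint, then $a$ can be expressed as the sum of four self-commutators; i.e., there exist $x_1,x_2,x_3,x_4\in\mathcal{A}$ such that $$a=\sum_{i=1}^4[x_i,x_i^*].$$
   Context: $[x,y]:=xy-yx$. For a unital C*-algebra $\mathcal{A}$, $T(\mathcal{A})$ denotes the set of tracial states of $\mathcal{A}$. For projections $p,q\in\mathcal{A}$, $p\prec q$ means that $[p]<[q]$ in the strict ordering induced by Murray-von Neumann equivalence, i.e., $p$ is Murray-von Neumann equivalent to a proper subprojection of $q$. $\mathcal{A}$ has strict comparison of projections if $T(\mathcal{A})\neq\emptyset$ and, for any projections $p,q\in\mathcal{A}$, the strict inequalities $\tau(p)<\tau(q)$ for all $\tau\in T(\mathcal{A})$ imply $p\prec q$. *)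

(* Defs.v *)
From HB Require Import structures.
From mathcomp Require Import all_boot all_order all_algebra complex.
From mathcomp Require Import boolp classical_sets functions cardinality reals.
From mathcomp Require Import topology normedtype.
Set Implicit Arguments.
Unset Strict Implicit.
Unset Printing Implicit Defensive.
Import Order.TTheory GRing.Theory Num.Theory.
Import numFieldNormedType.Exports.

Local Open Scope classical_set_scope.
Local Open Scope ring_scope.
Local Open Scope complex_scope.

(* The norm of a normed module over R[i] is R[i]-valued; on R[i] the order
   x <= y means that y - x is a nonnegative real, so norms are real.
   Hierarchy-Builder cannot join GRing.Algebra and CompleteNormedModule (their
   only common refinement in the library is Num.NumDomain), so the ring
   operations are part of the mixin, and the R[i]-algebra instance on top of the
   normed-module structure is declared below. *)
HB.mixin Record isUnitalCStarAlgebra (R : realType) A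
    & CompleteNormedModule R[i] A := {
  cstar_one : A;
  cstar_mul : A -> A -> A;
  cstar_mulA : associative cstar_mul;
  cstar_mul1r : left_id cstar_one cstar_mul;
  cstar_mulr1 : right_id cstar_one cstar_mul;
  cstar_mulDl : left_distributive cstar_mul +%R;
  cstar_mulDr : right_distributive cstar_mul +%R;
  cstar_one_neq0 : cstar_one != 0;
  cstar_scaleAl : forall (k : R[i]) (x y : A),
    k *: cstar_mul x y = cstar_mul (k *: x) y;
  cstar_scaleAr : forall (k : R[i]) (x y : A),
    k *: cstar_mul x y = cstar_mul x (k *: y);
  star : A -> A;
  starK : involutive star;
  starD : {morph star : x y / x + y};
  starZ : forall (k : R[i]) (x : A), star (k *: x) = Num.conj k *: star x;
  starM : forall x y : A, star (cstar_mul x y) = cstar_mul (star y) (star x);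
  cstar_normM : forall x y : A, `|cstar_mul x y| <= `|x| * `|y|;
  cstar_norm : forall x : A, `|cstar_mul (star x) x| = `|x| ^+ 2
}.

#[short(type="unitalCStarAlgType")]
HB.structure Definition UnitalCStarAlgebra (R : realType) :=
  {A of CompleteNormedModule R[i] A & isUnitalCStarAlgebra R A}.

Section CStarAlgebraInstance.
Variables (R : realType) (A : unitalCStarAlgType R).

HB.instance Definition _ :=
  GRing.Zmodule_isNzRing.Build (UnitalCStarAlgebra.sort A)
    (@cstar_mulA R A) (@cstar_mul1r R A) (@cstar_mulr1 R A)
    (@cstar_mulDl R A) (@cstar_mulDr R A) (@cstar_one_neq0 R A).

HB.instance Definition _ :=
  GRing.Lmodule_isLalgebra.Build R[i] (UnitalCStarAlgebra.sort A)
    (@cstar_scaleAl R A).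

HB.instance Definition _ :=
  GRing.Lalgebra_isAlgebra.Build R[i] (UnitalCStarAlgebra.sort A)
    (@cstar_scaleAr R A).

End CStarAlgebraInstance.

Section CStarNotions.
Context {R : realType}.
Implicit Type A : unitalCStarAlgType R.

Definition commutator A (x y : A) : A := x * y - y * x.

Definition selfadjoint A (x : A) : Prop := star x = x.

Definition invertible A (x : A) : Prop := exists y : A, x * y = 1 /\ y * x = 1.

(* Closure under scalars follows, since k *: x = k%:A * x. *)
Record two_sided_ideal A (I : set A) : Prop := TwoSidedIdeal {
  ideal0 : I 0;
  idealD : forall x y, I x -> I y -> I (x + y);
  idealMl : forall a x, I x -> I (a * x);
  idealMr : forall a x, I x -> I (x * a)
}.

Definition simple_cstar A : Prop :=
  forall I : set A, two_sided_ideal I -> closed I -> I = [set 0] \/ I = setT.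

Definition separable_cstar A : Prop :=
  exists D : set A, countable D /\ dense D.

(* Brown-Pedersen: the invertible selfadjoint elements are dense among the
   selfadjoint ones. *)
Definition real_rank_zero A : Prop :=
  [set x : A | selfadjoint x] `<=`
  closure [set x : A | selfadjoint x /\ invertible x].

(* Rieffel: the invertible elements are dense. *)
Definition stable_rank_one A : Prop := dense [set x : A | invertible x].

Record is_tracial_state A (tau : {scalar A}) : Prop := IsTracialState {
  tracial_state_ge0 : forall x : A, 0 <= tau (star x * x);
  tracial_state1 : tau 1 = 1;
  tracial_stateC : forall x y : A, tau (x * y) = tau (y * x)
}.

Definition tracial_states A : set {scalar A} := [set tau | is_tracial_state tau].

Definition projection A (p : A) : Prop := selfadjoint p /\ p * p = p.

Definition mvn_equiv A (p q : A) : Prop :=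
  exists v : A, star v * v = p /\ v * star v = q.

Definition subprojection A (r q : A) : Prop :=
  [/\ projection r, r * q = r & q * r = r].

Definition mvn_prec A (p q : A) : Prop :=
  exists r : A, [/\ subprojection r q, r <> q & mvn_equiv p r].

(* Values of a tracial state at projections are real, and < on R[i] restricts
   to the usual order on real numbers. *)
Definition strict_comparison_of_projections A : Prop :=
  @tracial_states A !=set0 /\
  forall p q : A, projection p -> projection q ->
    (forall tau, @tracial_states A tau -> tau p < tau q) -> mvn_prec p q.

End CStarNotions.

Arguments simple_cstar {R} A.
Arguments separable_cstar {R} A.
Arguments real_rank_zero {R} A.
Arguments stable_rank_one {R} A.
Arguments tracial_states {R} A.
Arguments strict_comparison_of_projections {R} A.

(* Main.v *)
(* Projections play the role of matrix units. In real rank zero a selfadjoint element d of norm at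
   most K is close to a sum of K differences P_i - (e - P_i) of projections. If d has trace zero, then
   by strict comparison the sum of the P_i and the sum of the e - P_i, placed on orthogonal copies of
   e, are equivalent after adding a bounded number of copies of e, so that d is, up to an error of
   relative size O(1/K), the "diagonal sum" of one commutator [v^*, v] living on these copies.

   If no projection is minimal, every projection can be halved, which yields a sequence of projections
   e_n, pairwise orthogonal blocks made of m + 1 copies of e_n, and partial isometries covering e_n by
   three pieces of e_{n+1}. In each block one commutator [y_n, z_n] replaces a trace-zero element of
   the corner of e_n by one of e_{n+1} that is 16 times smaller, up to an element with vanishing
   diagonal blocks. Such an element is a commutator [L, b] with any diagonal L having distinct
   eigenvalues. Summing over n, all [y_n, z_n] are absorbed by one commutator [Y, Z] and all errors by
   a second one.

   If there is a minimal projection, the algebra is a full matrix algebra and the same argument is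
   finite. The self-commutators come from the real and imaginary parts of the y_i. *)
Require Import Defs.
From HB Require Import structures.
From mathcomp Require Import all_boot all_order all_algebra complex.
From mathcomp Require Import boolp classical_sets functions cardinality reals.
From mathcomp Require Import topology normedtype.
From mathcomp Require Import ring lra.
Import Order.TTheory GRing.Theory Num.Theory.
Import numFieldNormedType.Exports.
Set Implicit Arguments.
Unset Strict Implicit.
Unset Printing Implicit Defensive.
Local Open Scope ring_scope.
Local Open Scope complex_scope.


(** Strict comparison compares projections only where there is room to spare in trace, so a
    trace-zero element is made smaller but never removed exactly, and the reduction cannot stop
    after finitely many steps. It gains because the room costs 9 copies whatever [K] is, while the
    element is first scaled to norm [K]. Infinitely many commutators merge into one only if the
    supports of the steps meet between neighbours alone and both series of factors converge. The
    products of neighbouring factors that then appear have vanishing diagonal blocks and join the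
    errors. A single diagonal element must serve all errors: its eigenvalues tend to 0 and yet stay
    apart on neighbouring blocks, which loses a factor 4^n; making the z_n summable loses another
    2^n. A reduction by 16 at each step pays for both. [A] need not contain spectral projections.
    Real rank zero supplies signs of nearby invertible elements instead, and positivity is expressed
    by norm inequalities. *)

Lemma star0 {R : realType} {A : unitalCStarAlgType R} : star (0 : A) = 0.
Proof. by apply: (addrI (star 0)); rewrite -starD !addr0. Qed.

Lemma starN {R : realType} {A : unitalCStarAlgType R} (x : A) : star (- x) = - star x.
Proof. by apply/eqP; rewrite -addr_eq0 -starD addNr star0. Qed.

Lemma starMr {R : realType} {A : unitalCStarAlgType R} (x y : A) : star (x * y) = star y * star x.
Proof. exact: starM. Qed.

Lemma star1 {R : realType} {A : unitalCStarAlgType R} : star (1 : A) = 1.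
Proof. by rewrite -[LHS]mulr1 -{2}[1]starK -starMr mulr1 starK. Qed.

Lemma starZr {R : realType} {A : unitalCStarAlgType R} (r : R) (x : A) :
  star (r%:C *: x) = r%:C *: star x.
Proof. by rewrite starZ; congr (_ *: _); exact: conjc_real. Qed.

Lemma starMz {R : realType} {A : unitalCStarAlgType R} (x : A) (c : int) : star (x *~ c) = star x *~ c.
Proof.
have H n : star (x *+ n) = star x *+ n.
  by elim: n => [|n IH]; rewrite ?mulr0n ?star0 // !mulrS starD IH.
by case: c => n; rewrite ?NegzE ?mulrNz ?starN -!pmulrn H.
Qed.

(** * Reflexive normalization of star-polynomials with real scalars *)

Module StarRing.
Section StarRing.
Context {R : realType} {A : unitalCStarAlgType R}.

Inductive expr :=
  | Var of nat | Zero | One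
  | Add of expr & expr | Opp of expr | Mul of expr & expr
  | Star of expr | Scale of nat & expr.

(* A monomial is an integer, a sorted list of real scalars and a word in the
   variables and their adjoints. *)
Definition monomial : Type := int * seq nat * seq (nat * bool).

Variables (ks : seq R) (vs : seq A).

Fixpoint eval (e : expr) : A :=
  match e with
  | Var n => nth 0 vs n
  | Zero => 0
  | One => 1
  | Add e1 e2 => eval e1 + eval e2
  | Opp e => - eval e
  | Mul e1 e2 => eval e1 * eval e2
  | Star e => star (eval e)
  | Scale k e => (nth 0 ks k)%:C *: eval e
  end.

Definition eval_letter (l : nat * bool) : A :=
  if l.2 then star (nth 0 vs l.1) else nth 0 vs l.1.
Definition eval_word (w : seq (nat * bool)) : A :=
  foldr (fun l acc => eval_letter l * acc) 1 w.
Definition scale_by (s : seq nat) (x : A) : A :=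
  foldr (fun k acc => (nth 0 ks k)%:C *: acc) x s.
Definition eval_mon (m : monomial) : A := scale_by m.1.2 (eval_word m.2) *~ m.1.1.
Definition eval_pol (p : seq monomial) : A := foldr (fun m acc => eval_mon m + acc) 0 p.

Fixpoint insert_scalar (k : nat) (s : seq nat) :=
  if s is k' :: s' then if (k <= k')%N then k :: s else k' :: insert_scalar k s'
  else [:: k].

Fixpoint insert_mon (m : monomial) (p : seq monomial) :=
  if p is m' :: p' then
    if (m.1.2 == m'.1.2) && (m.2 == m'.2) then (m.1.1 + m'.1.1, m.1.2, m.2) :: p'
    else m' :: insert_mon m p'
  else [:: m].

Definition mul_mon (m m' : monomial) : monomial :=
  (m.1.1 * m'.1.1, foldr insert_scalar m'.1.2 m.1.2, m.2 ++ m'.2).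
Definition mul_pol (p q : seq monomial) := flatten [seq [seq mul_mon m m' | m' <- q] | m <- p].
Definition star_mon (m : monomial) : monomial :=
  (m.1, rev [seq (l.1, ~~ l.2) | l <- m.2]).

Fixpoint expand (e : expr) : seq monomial :=
  match e with
  | Var n => [:: (1, [::], [:: (n, false)])]
  | Zero => [::]
  | One => [:: (1, [::], [::])]
  | Add e1 e2 => expand e1 ++ expand e2
  | Opp e => [seq (- m.1.1, m.1.2, m.2) | m <- expand e]
  | Mul e1 e2 => mul_pol (expand e1) (expand e2)
  | Star e => [seq star_mon m | m <- expand e]
  | Scale k e => [seq (m.1.1, insert_scalar k m.1.2, m.2) | m <- expand e]
  end.

Fixpoint split_at (w v : seq (nat * bool)) : option (seq (nat * bool) * seq (nat * bool)) :=
  if take (size w) v == w then Some ([::], drop (size w) v)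
  else if v is l :: v' then
    if split_at w v' is Some ab then Some (l :: ab.1, ab.2) else None
  else None.

Definition rule : Type := seq (nat * bool) * seq monomial.

Fixpoint rewrite_word (rs : seq rule) (w : seq (nat * bool)) : option (seq monomial) :=
  if rs is r :: rs' then
    if split_at r.1 w is Some ab then
      Some (mul_pol [:: (1, [::], ab.1)] (mul_pol r.2 [:: (1, [::], ab.2)]))
    else rewrite_word rs' w
  else None.

Fixpoint normalize (fuel : nat) (rs : seq rule) (p : seq monomial) : seq monomial :=
  if fuel is fuel'.+1 then
    foldr (fun m acc =>
      if m.1.1 == 0 then acc else
      if rewrite_word rs m.2 is Some q then
        foldr insert_mon acc (normalize fuel' rs (mul_pol [:: (m.1, [::])] q))
      else insert_mon m acc) [::] p
  else p.

(** An equation serves as a rule only if its left side expands to a single bare word; any other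
    equation is silently dropped. *)
Definition rule_of (lr : expr * expr) : seq rule :=
  if expand lr.1 is [:: (c, s, w)] then
    if (c == 1) && (s == [::]) then [:: (w, expand lr.2)] else [::]
  else [::].

Definition check (fuel : nat) (hs : seq (expr * expr)) (e1 e2 : expr) : bool :=
  all (fun m : monomial => m.1.1 == 0)
    (normalize fuel (flatten (map rule_of hs)) (expand (Add e1 (Opp e2)))).

Fixpoint hold (hs : seq (expr * expr)) : Prop :=
  if hs is h :: hs' then eval h.1 = eval h.2 /\ hold hs' else True.

Lemma scale_byMl s x y : scale_by s x * y = scale_by s (x * y).
Proof. by elim: s => //= k s <-; rewrite scalerAl. Qed.

Lemma scale_byMr s x y : x * scale_by s y = scale_by s (x * y).
Proof. by elim: s => //= k s <-; rewrite scalerAr. Qed.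

Lemma scale_by_insert k s x : scale_by (insert_scalar k s) x = (nth 0 ks k)%:C *: scale_by s x.
Proof.
elim: s => //= k' s IH; case: ifP => //= _.
by rewrite IH !scalerA mulrC.
Qed.

Lemma scale_by_foldr s s' x : scale_by (foldr insert_scalar s' s) x = scale_by s (scale_by s' x).
Proof. by elim: s => //= k s IH; rewrite scale_by_insert IH. Qed.

Lemma eval_word_cat w w' : eval_word (w ++ w') = eval_word w * eval_word w'.
Proof. by elim: w => [|l w IH] /=; rewrite ?mul1r // IH mulrA. Qed.

Lemma eval_pol_cat p q : eval_pol (p ++ q) = eval_pol p + eval_pol q.
Proof. by elim: p => [|m p IH] /=; rewrite ?add0r // IH addrA. Qed.

Lemma eval_mul_mon m m' : eval_mon (mul_mon m m') = eval_mon m * eval_mon m'.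
Proof.
rewrite /eval_mon /mul_mon /= scale_by_foldr eval_word_cat.
by rewrite mulrzAl mulrzAr -mulrzA mulrC scale_byMl scale_byMr mulrC.
Qed.

Lemma eval_mul_pol p q : eval_pol (mul_pol p q) = eval_pol p * eval_pol q.
Proof.
elim: p => [|m p IH]; rewrite /mul_pol /= ?mul0r // eval_pol_cat -/(mul_pol p q) IH mulrDl.
by congr (_ + _); elim: q {IH} => [|m' q IH] /=; rewrite ?mulr0 // IH eval_mul_mon mulrDr.
Qed.

Lemma eval_star_mon m : eval_mon (star_mon m) = star (eval_mon m).
Proof.
rewrite /eval_mon starMz /star_mon /=; congr (_ *~ _).
have -> x : star (scale_by m.1.2 x) = scale_by m.1.2 (star x).
  by elim: (m.1.2) => //= k s <-; rewrite starZr.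
congr scale_by; elim: (m.2) => [|l w IH] /=; first by rewrite star1.
rewrite rev_cons -cats1 eval_word_cat IH starMr /= mulr1; congr (_ * _).
by rewrite /eval_letter /=; case: (l.2) => /=; rewrite ?starK.
Qed.

Lemma eval_expand e : eval_pol (expand e) = eval e.
Proof.
elim: e => //=.
- by move=> n; rewrite addr0 /eval_mon /= mulr1.
- by rewrite addr0.
- by move=> e1 IH1 e2 IH2; rewrite eval_pol_cat IH1 IH2.
- move=> e <-; elim: (expand e) => [|m p IH] /=; first by rewrite oppr0.
  by rewrite IH opprD /eval_mon /= mulrNz.
- by move=> e1 IH1 e2 IH2; rewrite eval_mul_pol IH1 IH2.
- move=> e <-; elim: (expand e) => [|m p IH] /=; first by rewrite star0.
  by rewrite IH starD eval_star_mon.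
- move=> k e <-; elim: (expand e) => [|m p IH] /=; first by rewrite scaler0.
  by rewrite IH scalerDr {1}/eval_mon /= scale_by_insert -scalerMzr.
Qed.

Lemma eval_insert_mon m p : eval_pol (insert_mon m p) = eval_mon m + eval_pol p.
Proof.
elim: p => //= m' p IH; case: ifP => [/andP[/eqP e1 /eqP e2]|_] /=; last by rewrite IH addrCA.
by rewrite addrA /eval_mon /= e1 e2 mulrzDr.
Qed.

Lemma eval_insert_pol p q : eval_pol (foldr insert_mon q p) = eval_pol p + eval_pol q.
Proof. by elim: p => [|m p IH] /=; rewrite ?add0r // eval_insert_mon IH addrA. Qed.

Lemma split_atP w v a b : split_at w v = Some (a, b) -> v = a ++ w ++ b.
Proof.
elim: v a b => [|l v IH] a b /=.
  by case: w => [|l' w] //= [<- <-].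
case: ifP => [/eqP e [<- <-]|_]; first by rewrite /= -{1}e cat_take_drop.
by case: split_at IH => // -[a' b'] IH [<- <-] /=; rewrite (IH _ _ erefl).
Qed.

Lemma eval_word_pol w : eval_pol [:: (1, [::], w)] = eval_word w.
Proof. by rewrite /= addr0. Qed.

Lemma eval_rewrite_word rs w q :
  (forall r, r \in rs -> eval_word r.1 = eval_pol r.2) ->
  rewrite_word rs w = Some q -> eval_word w = eval_pol q.
Proof.
elim: rs => //= r rs IH H.
case E: split_at => [[a b]|]; last by apply: IH => r' hr; apply: H; rewrite inE hr orbT.
move=> [<-]; rewrite !eval_mul_pol !eval_word_pol (split_atP E) !eval_word_cat.
by rewrite H // mem_head.
Qed.

Lemma eval_normalize fuel rs p :
  (forall r, r \in rs -> eval_word r.1 = eval_pol r.2) ->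
  eval_pol (normalize fuel rs p) = eval_pol p.
Proof.
move=> H; elim: fuel p => //= fuel IH p.
elim: p => //= m p IHp; case: ifP => [/eqP m0|_].
  by rewrite IHp /eval_mon m0 mulr0z add0r.
case E: rewrite_word => [q|]; last by rewrite eval_insert_mon IHp.
rewrite eval_insert_pol IH IHp eval_mul_pol -(eval_rewrite_word H E); congr (_ + _).
by rewrite /= addr0 /eval_mon /= mulrzAl scale_byMl mul1r.
Qed.

Lemma rule_ofP hs r : hold hs -> r \in flatten (map rule_of hs) -> eval_word r.1 = eval_pol r.2.
Proof.
elim: hs => //= -[l e] hs IH [/= H Hs]; rewrite mem_cat => /orP[|]; last exact: IH.
rewrite /rule_of /=; case E: (expand l) => [|[[c s] w] [|? ?]] //.
case: ifP => // /andP[/eqP c1 /eqP s0]; rewrite inE => /eqP -> /=.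
by rewrite eval_expand -H -eval_expand E c1 s0 eval_word_pol.
Qed.

(** Only soundness is at stake: each rule replaces a word by a polynomial of the same value, so
    every amount of fuel and every order of the rules is safe. Termination and confluence are not
    claimed; where they fail, [check] may just return false. *)
Lemma check_correct fuel hs e1 e2 : hold hs -> check fuel hs e1 e2 -> eval e1 = eval e2.
Proof.
move=> Hs /allP ch; apply/eqP; rewrite -subr_eq0; apply/eqP.
rewrite -[LHS](eval_expand (Add e1 (Opp e2))).
rewrite -(eval_normalize fuel _ (fun r => @rule_ofP _ r Hs)).
set p := normalize _ _ _ in ch *; elim: p ch => //= m p IH ch.
rewrite IH; last by move=> x xp; apply: ch; rewrite inE xp orbT.
by rewrite addr0 /eval_mon (eqP (ch _ (mem_head _ _))) mulr0z.
Qed.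

End StarRing.

Ltac mem_list x l :=
  lazymatch l with
  | nil => false
  | x :: _ => true
  | _ :: ?l' => mem_list x l'
  end.
Ltac add_var x l :=
  let b := mem_list x l in
  lazymatch b with true => l | false => constr:(x :: l) end.
Ltac index x l :=
  lazymatch l with
  | x :: _ => constr:(0%N)
  | _ :: ?l' => let n := index x l' in constr:(S n)
  end.

Ltac vars t vs :=
  lazymatch t with
  | @GRing.zero _ => vs
  | @Algebra.zero _ => vs
  | @GRing.one _ => vs
  | @GRing.add _ ?x ?y => let vs := vars x vs in vars y vs
  | @GRing.opp _ ?x => vars x vs
  | @GRing.mul _ ?x ?y => let vs := vars x vs in vars y vs
  | @star _ _ ?x => vars x vs
  | @GRing.scale _ _ (_%:C) ?x => vars x vs
  | _ => add_var t vs
  end.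
Ltac scalars t ks :=
  lazymatch t with
  | @GRing.add _ ?x ?y => let ks := scalars x ks in scalars y ks
  | @GRing.opp _ ?x => scalars x ks
  | @GRing.mul _ ?x ?y => let ks := scalars x ks in scalars y ks
  | @star _ _ ?x => scalars x ks
  | @GRing.scale _ _ (?k%:C) ?x => let ks := scalars x ks in add_var k ks
  | _ => ks
  end.
Ltac reify t ks vs :=
  lazymatch t with
  | @GRing.zero _ => constr:(Zero)
  | @Algebra.zero _ => constr:(Zero)
  | @GRing.one _ => constr:(One)
  | @GRing.add _ ?x ?y =>
      let a := reify x ks vs in let b := reify y ks vs in constr:(Add a b)
  | @GRing.opp _ ?x => let a := reify x ks vs in constr:(Opp a)
  | @GRing.mul _ ?x ?y =>
      let a := reify x ks vs in let b := reify y ks vs in constr:(Mul a b)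
  | @star _ _ ?x => let a := reify x ks vs in constr:(Star a)
  | @GRing.scale _ _ (?k%:C) ?x =>
      let a := reify x ks vs in let n := index k ks in constr:(Scale n a)
  | _ => let n := index t vs in constr:(Var n)
  end.

(** Head normalization of the type unfolds [selfadjoint], so its proofs can be passed as
    equations. *)
Ltac hyp_vars hs vs :=
  lazymatch hs with
  | tt => vs
  | (?hs', ?h) => let vs := hyp_vars hs' vs in hyp_vars h vs
  | ?h =>
      let T := type of h in
      lazymatch (eval hnf in T) with
      | ?l = ?r => let vs := vars l vs in vars r vs
      end
  end.
Ltac hyp_scalars hs ks :=
  lazymatch hs with
  | tt => ks
  | (?hs', ?h) => let ks := hyp_scalars hs' ks in hyp_scalars h ks
  | ?h =>
      let T := type of h in
      lazymatch (eval hnf in T) with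
      | ?l = ?r => let ks := scalars l ks in scalars r ks
      end
  end.
Ltac hyp_reify hs ks vs acc :=
  lazymatch hs with
  | tt => acc
  | (?hs', ?h) => let acc := hyp_reify h ks vs acc in hyp_reify hs' ks vs acc
  | ?h =>
      let T := type of h in
      lazymatch (eval hnf in T) with
      | ?l = ?r =>
          let a := reify l ks vs in let b := reify r ks vs in constr:((a, b) :: acc)
      end
  end.
Ltac hyp_proof hs acc :=
  lazymatch hs with
  | tt => acc
  | (?hs', ?h) => let acc := hyp_proof h acc in hyp_proof hs' acc
  | ?h => constr:(conj h acc)
  end.

Ltac solve_with hs :=
  lazymatch goal with
  | |- @eq ?T ?l ?r =>
      let R := lazymatch goal with A : @UnitalCStarAlgebra.type ?R |- _ => R end in
      let vs := hyp_vars hs (@nil T) in let vs := vars l vs in let vs := vars r vs in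
      let ks := hyp_scalars hs (@nil (Real.sort R)) in
      let ks := scalars l ks in let ks := scalars r ks in
      let a := reify l ks vs in let b := reify r ks vs in
      let q := hyp_reify hs ks vs (@nil (expr * expr)) in let pf := hyp_proof hs I in
      refine (@check_correct R _ ks vs 40 q a b pf _); vm_compute; reflexivity
  end.
End StarRing.

(* Equality in a C*-algebra from the ring, star and real-scalar axioms, using the given equations
   as left-to-right rewrite rules on words. *)
Tactic Notation "cstar" := StarRing.solve_with tt.
Tactic Notation "cstar" "with" constr(hs) := StarRing.solve_with hs.


(** * The norm *)

Section Norm.
Context {R : realType} {A : unitalCStarAlgType R}.
Implicit Types (x y : A) (r : R).

Definition nrm (x : A) : R := complex.Re `|x|.

Lemma nrmE x : `|x| = (nrm x)%:C.
Proof. by rewrite /nrm RRe_real // ger0_real. Qed.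

Lemma nrm_ge0 x : 0 <= nrm x.
Proof. by rewrite -ler0c -nrmE. Qed.

Lemma nrm_eq0 x : nrm x = 0 -> x = 0.
Proof. by move=> h; apply/normr0_eq0; rewrite nrmE h. Qed.

Lemma nrm0 : nrm (0 : A) = 0.
Proof. by apply: complexI; rewrite -nrmE normr0. Qed.

Lemma nrmN x : nrm (- x) = nrm x.
Proof. by rewrite /nrm normrN. Qed.

Lemma nrmBC x y : nrm (x - y) = nrm (y - x).
Proof. by rewrite -nrmN opprB. Qed.

Lemma nrmD x y : nrm (x + y) <= nrm x + nrm y.
Proof. by rewrite -lecR raddfD /= -!nrmE ler_normD. Qed.

Lemma nrmB x y : nrm (x - y) <= nrm x + nrm y.
Proof. by rewrite -[nrm y]nrmN nrmD. Qed.

Lemma nrm_trans y x z : nrm (x - z) <= nrm (x - y) + nrm (y - z).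
Proof. by apply: le_trans (nrmD _ _); rewrite addrA subrK. Qed.

Lemma nrmM x y : nrm (x * y) <= nrm x * nrm y.
Proof. by rewrite -lecR rmorphM /= -!nrmE cstar_normM. Qed.

Lemma nrm_starM x : nrm (star x * x) = nrm x ^+ 2.
Proof. by apply: complexI; rewrite rmorphXn /= -!nrmE cstar_norm. Qed.

Lemma nrm_star x : nrm (star x) = nrm x.
Proof.
have H y : nrm y <= nrm (star y).
  have [->|h] := eqVneq (nrm y) 0; first exact: nrm_ge0.
  have y0 : 0 < nrm y by rewrite lt_def h nrm_ge0.
  by rewrite -(ler_pM2r y0) -expr2 -nrm_starM nrmM.
by apply/le_anti; rewrite H -{2}[x]starK H.
Qed.

Lemma nrm1 : nrm (1 : A) = 1.
Proof.
have := nrm_starM (1 : A); rewrite star1 mulr1 expr2 => h.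
have n0 : nrm (1 : A) != 0.
  by apply/eqP => /nrm_eq0 /eqP; rewrite oner_eq0.
by apply: (mulfI n0); rewrite -h mulr1.
Qed.

Lemma nrmZc (k : R[i]) x : nrm (k *: x) = complex.Re `|k| * nrm x.
Proof.
by apply: complexI; rewrite -nrmE normrZ nrmE rmorphM /= RRe_real // ger0_real.
Qed.

Lemma nrmZ r x : nrm (r%:C *: x) = `|r| * nrm x.
Proof. by rewrite nrmZc normc_def /= expr0n addr0 sqrtr_sqr. Qed.

Lemma nrmZi x : nrm ('i *: x) = nrm x.
Proof. by rewrite nrmZc normc_def /= expr0n expr1n add0r sqrtr1 mul1r. Qed.

Lemma nrm_sum (I : Type) (s : seq I) (P : pred I) (F : I -> A) :
  nrm (\sum_(i <- s | P i) F i) <= \sum_(i <- s | P i) nrm (F i).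
Proof.
elim/big_rec2: _ => [|i y x _ h]; first by rewrite nrm0.
by apply: le_trans (nrmD _ _) _; rewrite lerD2l.
Qed.

Lemma nrmM_le x y a b : nrm x <= a -> nrm y <= b -> nrm (x * y) <= a * b.
Proof. by move=> h h'; apply: le_trans (nrmM _ _) _; apply: ler_pM => //; exact: nrm_ge0. Qed.

Definition tends (u : nat -> A) (l : A) :=
  forall e : R, 0 < e -> exists N, forall n, (N <= n)%N -> nrm (u n - l) < e.

Lemma cauchy_tends (u : nat -> A) :
  (forall e : R, 0 < e -> exists N, forall n, (N <= n)%N -> nrm (u n - u N) < e) ->
  exists l, tends u l.
Proof.
move=> uC.
have /cauchy_cvg uc : cauchy (u @ \oo)%classic.
  apply: cauchy_exP => e e0.
  have er : (complex.Re e)%:C = e by rewrite RRe_real // gtr0_real.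
  have [|N hN] := uC (complex.Re e); first by rewrite -ltcR er.
  exists (u N); exists N => // n /= Nn.
  by rewrite -ball_normE /= distrC nrmE -er ltcR hN.
exists (lim (u @ \oo))%classic => e e0.
have e0' : 0 < e%:C by rewrite ltcR.
move/cvgrPdist_lt: uc => /(_ _ e0') [N _ hN].
by exists N => n Nn; rewrite nrmBC -ltcR -nrmE; apply: hN.
Qed.

Lemma tends_le u l c : (forall n, nrm (u n) <= c) -> tends u l -> nrm l <= c.
Proof.
move=> uc ul; rewrite leNgt; apply/negP => h.
have [|N hN] := ul (nrm l - c); first by rewrite subr_gt0.
have := hN N (leqnn _); have := uc N; have := nrm_trans (u N) l 0.
by rewrite !subr0 nrmBC; lra.
Qed.

(** Convergence by a real majorant: [eta] is nondecreasing and bounded, so from some [N] on it is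
    within [e] of its supremum, and this bounds all later increments of [u]. *)
Lemma monotone_tends (u : nat -> A) (eta : nat -> R) (M : R) :
  (forall n, nrm (u n.+1 - u n) <= eta n.+1 - eta n) -> (forall n, eta n <= M) ->
  exists l, tends u l.
Proof.
move=> ue eM.
have mono m n : nrm (u (m + n)%N - u m) <= eta (m + n)%N - eta m.
  elim: n => [|n IH]; first by rewrite addn0 !subrr nrm0.
  rewrite addnS; apply: le_trans (nrm_trans (u (m + n)%N) _ _) _.
  by have := ue (m + n)%N; lra.
have hs : has_sup [set x | exists n, x = eta n]%classic.
  by split; [exists (eta 0%N), 0%N | exists M => x [n ->]].
apply: cauchy_tends => e e0; have [_ [N ->] hN] := sup_adherent e0 hs.
exists N => n Nn; rewrite -(subnKC Nn); apply: le_lt_trans (mono _ _) _.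
have /(sup_upper_bound hs) : [set x | exists n, x = eta n]%classic (eta (N + (n - N))%N).
  by exists (N + (n - N))%N.
by move: hN; lra.
Qed.

Lemma tends_unique u l l' : tends u l -> tends u l' -> l = l'.
Proof.
move=> ul ul'; apply/eqP; rewrite -subr_eq0; apply/eqP/nrm_eq0/eqP.
rewrite eq_le nrm_ge0 andbT leNgt; apply/negP => h.
have e0 : 0 < nrm (l - l') / 2 by lra.
have [N hN] := ul _ e0; have [N' hN'] := ul' _ e0.
have := hN (maxn N N') (leq_maxl _ _); have := hN' (maxn N N') (leq_maxr _ _).
by have := nrm_trans (u (maxn N N')) l l'; rewrite (nrmBC l (u _)); lra.
Qed.

Lemma tends_cst x : tends (fun=> x) x.
Proof. by move=> e e0; exists 0%N => n _; rewrite subrr nrm0. Qed.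

Lemma tendsD u v l m : tends u l -> tends v m -> tends (fun n => u n + v n) (l + m).
Proof.
move=> ul vm e e0; have e2 : 0 < e / 2 by lra.
have [N hN] := ul _ e2; have [N' hN'] := vm _ e2.
exists (maxn N N') => n; rewrite geq_max => /andP[h h'].
rewrite opprD addrACA; apply: le_lt_trans (nrmD _ _) _.
by have := hN _ h; have := hN' _ h'; lra.
Qed.

Lemma tendsN u l : tends u l -> tends (fun n => - u n) (- l).
Proof.
by move=> ul e e0; have [N hN] := ul _ e0; exists N => n h; rewrite -opprD nrmN hN.
Qed.

Lemma tendsB u v l m : tends u l -> tends v m -> tends (fun n => u n - v n) (l - m).
Proof. by move=> ul vm; apply: tendsD => //; apply: tendsN. Qed.

Lemma tendsM u v l m : tends u l -> tends v m -> tends (fun n => u n * v n) (l * m).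
Proof.
move=> ul vm e e0.
pose k := nrm l + nrm m + 1.
have k0 : 0 < k by rewrite /k; have := nrm_ge0 l; have := nrm_ge0 m; lra.
have e1 : 0 < Num.min 1 (e / (2 * k)).
  by rewrite lt_min ltr01 divr_gt0 // mulr_gt0.
have [N hN] := ul _ e1; have [N' hN'] := vm _ e1.
exists (maxn N N') => n; rewrite geq_max => /andP[h h'].
have := hN _ h; have := hN' _ h'; rewrite !lt_min => /andP[b1 b2] /andP[a1 a2].
have -> : u n * v n - l * m = (u n - l) * v n + l * (v n - m) by cstar.
apply: le_lt_trans (nrmD _ _) _.
have vn : nrm (v n) <= nrm m + 1.
  by have := nrm_trans m (v n) 0; rewrite !subr0; lra.
have t1 := nrmM (u n - l) (v n); have t2 := nrmM l (v n - m).
have s1 : nrm (u n - l) * nrm (v n) <= nrm (u n - l) * k.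
  by rewrite ler_wpM2l ?nrm_ge0 // /k; have := nrm_ge0 l; lra.
have s2 : nrm l * nrm (v n - m) <= k * nrm (v n - m).
  by rewrite ler_wpM2r ?nrm_ge0 // /k; have := nrm_ge0 m; lra.
have r1 : nrm (u n - l) * k < e / 2.
  by rewrite -ltr_pdivlMr // -mulrA -invfM.
have r2 : k * nrm (v n - m) < e / 2.
  by rewrite mulrC -ltr_pdivlMr // -mulrA -invfM.
lra.
Qed.

Lemma tends_star u l : tends u l -> tends (fun n => star (u n)) (star l).
Proof.
by move=> ul e e0; have [N hN] := ul _ e0; exists N => n h; rewrite -starN -starD nrm_star hN.
Qed.

Lemma tendsZ k u l : tends u l -> tends (fun n => k *: u n) (k *: l).
Proof.
move=> ul; rewrite -[l]mul1r scalerAl.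
have -> : (fun n => k *: u n) = (fun n => (k *: 1) * u n).
  by apply/funext => n; rewrite -scalerAl mul1r.
by apply: tendsM => //; exact: tends_cst.
Qed.

Lemma tends_shift u l : tends u l -> tends (fun n => u n.+1) l.
Proof. by move=> ul e e0; have [N hN] := ul _ e0; exists N => n h; apply/hN/leqW. Qed.

Lemma tends_ext u v l : (forall n, u n = v n) -> tends u l -> tends v l.
Proof. by move=> /funext ->. Qed.

Lemma closure_approx (S : set A) x : closure S x ->
  forall e : R, 0 < e -> exists2 y, S y & nrm (x - y) < e.
Proof.
move=> cx e e0; have e0' : 0 < e%:C by rewrite ltcR.
have [y [Sy]] := cx _ (nbhsx_ballx x e%:C e0').
by rewrite -ball_normE /= nrmE ltcR => h; exists y.
Qed.

Lemma approx_closure (S : set A) x :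
  (forall e : R, 0 < e -> exists2 y, S y & nrm (x - y) < e) -> closure S x.
Proof.
move=> H B /nbhs_ballP[e /= e0 eB].
have er : (complex.Re e)%:C = e by rewrite RRe_real // gtr0_real.
have [|y Sy xy] := H (complex.Re e); first by rewrite -ltcR er.
by exists y; split=> //; apply: eB; rewrite -ball_normE /= nrmE -er ltcR.
Qed.

End Norm.


(** * Square roots and inverses *)

Section FunctionalCalculus.
Context {R : realType} {A : unitalCStarAlgType R}.
Implicit Types (x y z h k m e : A) (r M : R).

Lemma scaleCD r r' x : r%:C *: x + r'%:C *: x = (r + r')%:C *: x.
Proof. by rewrite -scalerDl -raddfD. Qed.

Lemma scaleCA r r' x : r%:C *: (r'%:C *: x) = (r * r')%:C *: x.
Proof. by rewrite scalerA -rmorphM. Qed.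

Lemma scaleC1 x : (1 : R)%:C *: x = x.
Proof. by rewrite scale1r. Qed.

Lemma scaleCN r x : (- r)%:C *: x = - (r%:C *: x).
Proof. by rewrite raddfN scaleNr. Qed.

Lemma scale_half x : (2^-1)%:C *: (x + x) = x.
Proof. by rewrite scalerDr scaleCD (_ : 2^-1 + 2^-1 = 1) ?scaleC1 //; lra. Qed.

Lemma nrmZ_le r x a : 0 <= r -> nrm x <= a -> nrm (r%:C *: x) <= r * a.
Proof. by move=> r0 xa; rewrite nrmZ ger0_norm // ler_wpM2l. Qed.

Lemma star_i x : star ('i *: x) = - ('i *: star x).
Proof.
rewrite starZ -scaleNr; congr (_ *: _).
by apply/eqP; rewrite eq_complex /= oppr0 !eqxx.
Qed.

Lemma mul_i x y : ('i *: x) * ('i *: y) = - (x * y).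
Proof.
by rewrite -scalerAl -scalerAr scalerA -expr2 sqr_i scaleN1r.
Qed.

(* [y] is the limit of the iteration [y := (x + y^2) / 2], which is dominated by the same iteration
   in the reals. *)
Lemma sqrt_one_minus x : nrm x <= 1 -> exists y,
  [/\ nrm y <= 1, (1 - y) * (1 - y) = 1 - x, (star x = x -> star y = y)
    & forall z, z * x = x * z -> z * y = y * z].
Proof.
move=> x1; pose s : R := 2^-1.
pose u n := iter n (fun y => s%:C *: (x + y * y)) 0.
pose eta n := iter n (fun t : R => s * (1 + t * t)) 0.
have uS n : u n.+1 = s%:C *: (x + u n * u n) by [].
have eS n : eta n.+1 = s * (1 + eta n * eta n) by [].
have eta01 n : 0 <= eta n <= 1.
  elim: n => [|n /andP[h h']]; first by rewrite lexx ler01.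
  by rewrite eS /s; apply/andP; split; nra.
have s0 : 0 <= s by rewrite /s invr_ge0.
have u_le n : nrm (u n) <= eta n.
  elim: n => [|n IH]; first by rewrite nrm0.
  rewrite uS eS; apply: nrmZ_le => //; apply: le_trans (nrmD _ _) _.
  by apply: lerD => //; exact: nrmM_le.
have du n : nrm (u n.+1 - u n) <= eta n.+1 - eta n.
  elim: n => [|n IH].
    rewrite uS eS /= mul0r mulr0 !addr0 subr0.
    by apply: le_trans (nrmZ_le s0 x1) _; rewrite subr0.
  have -> : u n.+2 - u n.+1 =
      s%:C *: (u n.+1 * (u n.+1 - u n) + (u n.+1 - u n) * u n).
    by rewrite (uS n.+1) (uS n); cstar with (esym (uS n)).
  have -> : eta n.+2 - eta n.+1 =
      s * (eta n.+1 * (eta n.+1 - eta n) + (eta n.+1 - eta n) * eta n).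
    by rewrite (eS n.+1) [X in _ - X = _](eS n); ring.
  by apply: nrmZ_le => //; apply: le_trans (nrmD _ _) _; apply: lerD; exact: nrmM_le.
have [y uy] := monotone_tends du (fun n => proj2 (andP (eta01 n))).
have yE : y = s%:C *: (x + y * y).
  apply: tends_unique (tends_shift uy) _.
  by apply: tendsZ; apply: tendsD (tends_cst x) _; exact: tendsM.
have yyE : y + y = x + y * y by rewrite {1 2}yE -scalerDr scale_half.
exists y; split.
- by apply: tends_le uy => n; apply: le_trans (u_le n) _; case/andP: (eta01 n).
- have -> : (1 - y) * (1 - y) = 1 - (y + y) + y * y by cstar.
  by rewrite yyE; cstar.
- move=> xs; apply: tends_unique (tends_star uy) _; apply: tends_ext uy => n.
  by elim: n => [|n IH]; rewrite ?star0 // !uS starZr starD starMr xs -IH.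
- move=> z zx; apply: tends_unique (tendsM (tends_cst z) uy) _.
  apply: tends_ext (tendsM uy (tends_cst z)) => n.
  elim: n => [|n IH]; first by rewrite mulr0 mul0r.
  by rewrite !uS; cstar with (zx, IH).
Qed.

(** The Neumann series, as a limit of [y := 1 + x * y]. The clause on commuting elements, here and
    for square roots, records that the result is a function of [x], as functional calculus would. *)
Lemma neumann x : nrm x < 1 -> exists y,
  [/\ y * (1 - x) = 1, (1 - x) * y = 1 & forall z, z * x = x * z -> z * y = y * z].
Proof.
move=> x1; pose u n := iter n (fun y => 1 + x * y) 0.
have uS n : u n.+1 = 1 + x * u n by [].
have x0 := nrm_ge0 x.
have d0 : 0 < 1 - nrm x by lra.
pose eta n := (1 - nrm x ^+ n) / (1 - nrm x).
have eE n : eta n.+1 - eta n = nrm x ^+ n.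
  by rewrite /eta exprS; field; rewrite lt0r_neq0.
have du n : nrm (u n.+1 - u n) <= nrm x ^+ n.
  elim: n => [|n IH]; first by rewrite uS /= mulr0 addr0 subr0 nrm1 expr0.
  rewrite uS {2}uS exprS (_ : _ - _ = x * (u n.+1 - u n)); last by cstar.
  by apply: nrmM_le.
have [|n|y uy] := @monotone_tends _ _ u eta (1 - nrm x)^-1.
- by move=> n; rewrite eE.
- by rewrite /eta ler_piMl //; [rewrite invr_ge0 ltW | rewrite gerBl exprn_ge0].
have yE : y = 1 + x * y.
  apply: tends_unique (tends_shift uy) _.
  by apply: tendsD (tends_cst 1) _; apply: tendsM uy; exact: tends_cst.
have comm z : z * x = x * z -> z * y = y * z.
  move=> zx; apply: tends_unique (tendsM (tends_cst z) uy) _.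
  apply: tends_ext (tendsM uy (tends_cst z)) => n.
  elim: n => [|n IH]; first by rewrite mulr0 mul0r.
  by rewrite !uS; cstar with (zx, IH).
have e1 : (1 - x) * y = 1 by rewrite mulrBl mul1r {1}yE addrK.
exists y; split=> //.
by rewrite -[RHS]e1; cstar with (comm x erefl).
Qed.

Lemma nrm_le_of_sqr x a : 0 <= a -> nrm (star x * x) <= a ^+ 2 -> nrm x <= a.
Proof. by move=> a0; rewrite nrm_starM ler_pXn2r ?nnegrE ?nrm_ge0. Qed.

(* Half the real part of the square of the unitary [m + i sqrt (1 - m^2)]. *)
Lemma nrm_chebyshev m : star m = m -> nrm m <= 1 -> nrm (1 - (m * m + m * m)) <= 1.
Proof.
move=> ms m1.
have [|y [_ yy ys yc]] := @sqrt_one_minus (m * m).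
  by have := nrmM_le m1 m1; rewrite mulr1.
have {}ys : star y = y by apply: ys; cstar with ms.
have my : m * y = y * m by apply: yc; cstar.
pose j := 'i *: (1 - y).
have js : star j = - j by rewrite star_i starD starN star1 ys.
have jj : j * j = - (1 - m * m) by rewrite mul_i yy.
have jm : j * m = m * j by rewrite -scalerAl -scalerAr; congr (_ *: _); cstar with my.
have w1 : nrm (m + j) <= 1.
  apply: nrm_le_of_sqr => //; rewrite (_ : star _ * _ = 1) ?nrm1 ?expr1n //.
  by cstar with (ms, js, jj, jm).
have w2 : nrm (m - j) <= 1.
  by rewrite -nrm_star (_ : star _ = m + j) //; cstar with (ms, js).
have -> : 1 - (m * m + m * m) = (2^-1)%:C *: - ((m + j) * (m + j) + (m - j) * (m - j)).
  rewrite -[LHS]scale_half; congr (_ *: _); cstar with (jj, jm).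
rewrite nrmZ nrmN ger0_norm ?invr_ge0 //.
by have := nrmD ((m + j) * (m + j)) ((m - j) * (m - j)); have := nrmM_le w1 w1;
  have := nrmM_le w2 w2; lra.
Qed.

(** Positivity without spectra: for selfadjoint [h] the inequality says that the spectrum lies in
    the interval from 0 to 2M. *)
Definition pos h := star h = h /\ exists M, nrm (M%:C *: 1 - h) <= M.

Lemma pos_sqrt h : pos h -> exists m,
  [/\ pos m, m * m = h & forall z, z * h = h * z -> z * m = m * z].
Proof.
move=> [hs [M0 hM0]].
(* The added 1 makes [M] invertible, also when [h] is 0 and [M0] is 0. *)
pose M := M0 + 1.
have M0_ge0 : 0 <= M0 by apply: le_trans hM0; exact: nrm_ge0.
have M0' : 0 < M by rewrite /M; lra.
have hM : nrm (M%:C *: 1 - h) <= M.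
  rewrite /M -scaleCD addrAC; apply: le_trans (nrmD _ _) _.
  by rewrite scaleC1 nrm1; lra.
pose x := (M^-1)%:C *: (M%:C *: 1 - h).
have x1 : nrm x <= 1.
  apply: le_trans (nrmZ_le _ hM) _; first by rewrite invr_ge0 ltW.
  by rewrite mulVf // lt0r_neq0.
have [y [y1 yy ys yc]] := sqrt_one_minus x1.
have {}ys : star y = y by apply: ys; rewrite /x; cstar with hs.
pose s := Num.sqrt M.
have ss : s * s = M by rewrite -expr2 sqr_sqrtr // ltW.
exists (s%:C *: (1 - y)); split.
- split; first by cstar with ys.
  exists s; rewrite (_ : _ - _ = s%:C *: y); last by cstar.
  by apply: le_trans (nrmZ_le (sqrtr_ge0 _) y1) _; rewrite mulr1.
- rewrite -scalerAl -scalerAr scaleCA yy ss scalerBr /x scaleCA divff ?lt0r_neq0 //.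
  by rewrite scaleC1 opprB addrCA subrr addr0.
- move=> z zh; have zy : z * y = y * z by apply: yc; rewrite /x; cstar with zh.
  by cstar with zy.
Qed.

(** The bound of [nrm_chebyshev] at m/|m|, multiplied by |m|^2/2, is exactly the inequality in
    [pos]. *)
Lemma pos_sqr m : star m = m -> pos (m * m).
Proof.
move=> ms; split; first by cstar with ms.
have [m0|m0] := eqVneq (nrm m) 0.
  by exists 0; rewrite (nrm_eq0 m0) mulr0 scale0r subr0 nrm0.
have n0 : 0 < nrm m by rewrite lt_def m0 nrm_ge0.
pose t := (nrm m)^-1.
have h : nrm (1 - ((t%:C *: m) * (t%:C *: m) + (t%:C *: m) * (t%:C *: m))) <= 1.
  apply: nrm_chebyshev; first by cstar with ms.
  by rewrite nrmZ ger0_norm ?invr_ge0 ?nrm_ge0 // mulVf.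
exists (nrm m ^+ 2 / 2).
have -> : (nrm m ^+ 2 / 2)%:C *: 1 - m * m =
   (nrm m ^+ 2 / 2)%:C *: (1 - ((t%:C *: m) * (t%:C *: m) + (t%:C *: m) * (t%:C *: m))).
  set c := nrm m ^+ 2 / 2; rewrite -!scalerAl -!scalerAr !scaleCA scaleCD scalerBr scaleCA.
  by rewrite (_ : c * _ = 1) ?scaleC1 // /c /t; field; exact: lt0r_neq0.
apply: le_trans (nrmZ_le _ h) _; rewrite ?mulr1 //.
by rewrite divr_ge0 // exprn_ge0 // nrm_ge0.
Qed.

(** The constant in [pos] is arbitrary; this is the sharp form, with the spectrum in the interval
    from 0 to [M] and its midpoint as centre. It comes from [nrm_chebyshev] for the square root of
    [h] divided by that of [M]. *)
Lemma pos_half h M : pos h -> nrm h <= M -> nrm ((M / 2)%:C *: 1 - h) <= M / 2.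
Proof.
move=> ph hM; have [m [[ms _] mm _]] := pos_sqrt ph.
have mE : nrm m ^+ 2 = nrm h by rewrite -nrm_starM ms mm.
have [M0|M0] := eqVneq M 0.
  have h0 : h = 0 by apply: nrm_eq0; apply/le_anti; rewrite nrm_ge0 -M0 hM.
  by rewrite M0 h0 mul0r scale0r subr0 nrm0.
have Mp : 0 < M by rewrite lt_def M0; apply: le_trans hM; exact: nrm_ge0.
pose t := (Num.sqrt M)^-1.
have tt : t * t = M^-1 by rewrite -invfM -expr2 sqr_sqrtr // ltW.
have H : nrm (1 - ((t%:C *: m) * (t%:C *: m) + (t%:C *: m) * (t%:C *: m))) <= 1.
  apply: nrm_chebyshev; first by cstar with ms.
  have t0 : 0 <= t by rewrite invr_ge0 sqrtr_ge0.
  rewrite -(ler_pXn2r (n := 2)) ?nnegrE ?nrm_ge0 // nrmZ ger0_norm // exprMn mE expr2 tt expr1n.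
  by rewrite mulrC ler_pdivrMr // mul1r.
have -> : (M / 2)%:C *: 1 - h =
   (M / 2)%:C *: (1 - ((t%:C *: m) * (t%:C *: m) + (t%:C *: m) * (t%:C *: m))).
  set c := M / 2; rewrite -!scalerAl -!scalerAr !scaleCA scaleCD scalerBr scaleCA mm tt.
  by rewrite (_ : c * _ = 1) ?scaleC1 // /c; field.
by apply: le_trans (nrmZ_le _ H) _; rewrite ?mulr1 // divr_ge0 // ltW.
Qed.

Lemma pos_shift h M : pos h -> nrm h <= M -> nrm (M%:C *: 1 - h) <= M.
Proof.
move=> ph hM; have H := pos_half ph hM.
have M0 : 0 <= M by apply: le_trans hM; exact: nrm_ge0.
have -> : M%:C *: 1 - h = (M / 2)%:C *: 1 + ((M / 2)%:C *: 1 - h).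
  by rewrite addrA scaleCD; congr (_%:C *: _ - _); field.
apply: le_trans (nrmD _ _) _; have : nrm ((M / 2)%:C *: (1 : A)) <= M / 2.
  by rewrite nrmZ nrm1 mulr1 ger0_norm // divr_ge0.
by move: H; lra.
Qed.

End FunctionalCalculus.


(** * Real rank zero *)

Section Projections.
Context {R : realType} {A : unitalCStarAlgType R}.
Implicit Types (x y z h k m e p : A) (r M eps : R).

Lemma nrm_projection p : projection p -> nrm p <= 1.
Proof.
move=> [ps pp]; have [->|n0] := eqVneq (nrm p) 0; first exact: ler01.
have p0 : 0 < nrm p by rewrite lt_def n0 nrm_ge0.
by rewrite -(ler_pM2r p0) mul1r -expr2 -nrm_starM ps pp.
Qed.

Lemma projectionC p : projection p -> projection (1 - p).
Proof. by move=> [ps pp]; split; [rewrite /selfadjoint; cstar with ps | cstar with pp]. Qed.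

Lemma real_rank_zero_approx (rr0 : real_rank_zero A) h eps : star h = h -> 0 < eps ->
  exists g gi, [/\ star g = g, g * gi = 1, gi * g = 1 & nrm (h - g) < eps].
Proof.
move=> hs e0; have [g [gs [gi [g1 g2]]] hg] := closure_approx (rr0 h hs) e0.
by exists g, gi.
Qed.

(* Invertibility passes to the corner through the Schur complement of the complementary block. *)
Lemma corner_invertible_approx (rr0 : real_rank_zero A) e h eps :
  projection e -> star h = h -> e * h = h -> 0 < eps ->
  exists g gi, [/\ star g = g, e * g = g /\ e * gi = gi, g * gi = e, gi * g = e
                 & nrm (h - g) <= eps].
Proof.
move=> pe hs eh eps0; have [es ee] := pe.
have he : h * e = h by rewrite -hs -{2}eh starMr es hs.
have f1 : nrm (1 - e) <= 1 by apply/nrm_projection/projectionC.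
have e1 := nrm_projection pe.
(* The bound 1/2 makes the complementary block of [y] invertible with inverse [d] of norm at most 2;
   the bound eps/2 gives the final estimate eta + 2 eta^2 <= eps. *)
pose eta := Num.min 2^-1 (eps / 2).
have eta0 : 0 < eta by rewrite lt_min; apply/andP; split; lra.
have [eta_half eta_eps] : eta <= 2^-1 /\ eta <= eps / 2.
  by rewrite /eta; split; rewrite ge_min lexx ?orbT.
(* Adding [1 - e] makes the complementary block of the perturbed element close to a unit. *)
have [|y [z [ys yz zy]]] := real_rank_zero_approx rr0 (_ : star (h + (1 - e)) = h + (1 - e)) eta0.
  by cstar with (hs, es).
set D := _ - y => hD; have {}hD : nrm D <= eta by exact: ltW.
have eDe (a b : A) : nrm a <= 1 -> nrm b <= 1 -> nrm (a * D * b) <= eta.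
  by move=> a1 b1; rewrite -[eta]mulr1; apply: nrmM_le => //; rewrite -[eta]mul1r; apply: nrmM_le.
have [|q [q1 q2 _]] := @neumann _ _ ((1 - e) * D * (1 - e)).
  by apply: le_lt_trans (eDe _ _ f1 f1) _; lra.
have dE : 1 - (1 - e) * D * (1 - e) = e + (1 - e) * y * (1 - e).
  by rewrite /D; cstar with (ee, eh).
rewrite dE in q1 q2.
pose d := (1 - e) * q * (1 - e).
have ed : e * d = 0 by rewrite /d; cstar with ee.
have de : d * e = 0 by rewrite /d; cstar with ee.
have eq2 : e * q = e.
  by rewrite -[RHS]mulr1 -q2; cstar with ee.
have qe : q * e = e.
  by rewrite -[RHS]mul1r -q1; cstar with ee.
have dq : d = q - e by rewrite /d; cstar with (eq2, qe, ee).
have dy : d * y * (1 - e) = 1 - e.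
  rewrite (_ : d * y * (1 - e) = d * (e + (1 - e) * y * (1 - e))); last by cstar with de.
  by rewrite dq mulrBl q1; cstar with ee.
have yd : (1 - e) * y * d = 1 - e.
  rewrite (_ : (1 - e) * y * d = (e + (1 - e) * y * (1 - e)) * d); last by cstar with ed.
  by rewrite dq mulrBr q2; cstar with ee.
have dye : d * y * e = d * y - (1 - e) by rewrite -dy; cstar.
have eyd : e * y * d = y * d - (1 - e) by rewrite -yd; cstar.
have ds : star d = d.
  have sde : star d * e = 0 by rewrite -{1}es -starMr ed star0.
  have sdy : star d * y * (1 - e) = 1 - e.
    rewrite (_ : _ * _ = star ((1 - e) * y * d)); last by cstar with (es, ys).
    by rewrite yd; cstar with es.
  have -> : star d = star d * ((1 - e) * y * d) by rewrite yd; cstar with sde.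
  rewrite (_ : _ * _ = star d * y * (1 - e) * d); last by cstar with (sde, ed).
  by rewrite sdy; cstar with ed.
have d2 : nrm d <= 2.
  suff : nrm d <= 1 + eta * nrm d by have := nrm_ge0 d; nra.
  rewrite {1}(_ : d = (1 - e) + ((1 - e) * D * (1 - e)) * d).
    apply: le_trans (nrmD _ _) _; apply: lerD => //.
    exact: nrmM_le (eDe _ _ f1 f1) (lexx _).
  rewrite (_ : (1 - e) * D * (1 - e) * d = d - (1 - e) * y * d); first by rewrite yd; cstar.
  by rewrite /D; cstar with (ee, eh, ed).
(* The Schur complement of [y]; its inverse in the corner is the compression of the inverse [z] of
   [y]. *)
pose g := e * y * e - e * y * d * y * e.
exists g, (e * z * e); split.
- by rewrite /g; cstar with (es, ys, ds).
- by split; rewrite ?/g; cstar with ee.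
- by rewrite /g; cstar with (dye, ed, de, yz, zy, ee).
- by rewrite /g; cstar with (eyd, ed, de, yz, zy, ee).
- have hd : h * d = 0 by rewrite -he -mulrA ed mulr0.
  have dh : d * h = 0 by rewrite -eh mulrA de mul0r.
  have -> : h - g = e * D * e + (e * D * d) * (D * e).
    by rewrite /g /D; cstar with (eh, he, ed, de, hd, dh, ee).
  apply: le_trans (nrmD _ _) _.
  have t1 := eDe _ _ e1 e1.
  have t2 : nrm (e * D * d) <= eta * 2.
    by apply: nrmM_le d2; apply: le_trans (nrmM_le e1 hD) _; rewrite mul1r.
  by have := nrmM_le t2 (nrmM_le hD e1); nra.
Qed.

Lemma abs_selfadjoint g : star g = g -> exists k,
  [/\ pos k, k * k = g * g & forall z, z * g = g * z -> z * k = k * z].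
Proof.
move=> gs; have [k [kp kk kc]] := pos_sqrt (pos_sqr gs).
by exists k; split=> // z zg; apply: kc; cstar with zg.
Qed.

(* [P] is approximately the spectral projection of [h] for the positive half-line. *)
Lemma sign_approx (rr0 : real_rank_zero A) e h eps :
  projection e -> star h = h -> e * h = h -> 0 < eps ->
  exists P k, [/\ projection P, e * P = P, pos k, e * k = k /\ P * k = k * P
                & nrm (h - (P * k - (e - P) * k)) <= eps].
Proof.
move=> pe hs eh eps0; have [es ee] := pe.
have [g [gi [gs [eg ei] gg ig hg]]] := corner_invertible_approx rr0 pe hs eh eps0.
have ge : g * e = g by rewrite -[RHS]gs -[in RHS]eg; cstar with (gs, es).
have ie : gi * e = gi by rewrite -gg mulrA ig ei.
pose b := g + (1 - e); pose c := gi + (1 - e).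
have bs : star b = b by rewrite /b; cstar with (gs, es).
have bc : b * c = 1 by rewrite /b /c; cstar with (ee, eg, ei, ge, ie, gg).
have cb : c * b = 1 by rewrite /b /c; cstar with (ee, eg, ei, ge, ie, ig).
have [k0 [kp kk kc]] := abs_selfadjoint bs.
have ks : star k0 = k0 by case: kp.
have eb : e * b = b * e by rewrite /b; cstar with (ee, eg, ge).
have ek : e * k0 = k0 * e := kc _ eb.
have bk : b * k0 = k0 * b := kc _ erefl.
have ck : c * k0 = k0 * c.
  by rewrite -[LHS]mulr1 -bc; cstar with (esym bk, cb).
have ec : e * c = c * e by rewrite /c; cstar with (ee, ei, ie).
have cs : star c = c.
  rewrite -[LHS]mulr1 -bc mulrA (_ : star c * b = 1) ?mul1r //.
  by rewrite -{1}bs -starMr bc star1.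
(* With [k0] the absolute value of [b] and [c] its inverse, [u] is the sign of [b], a selfadjoint
   unitary. *)
pose u := k0 * c.
have us : star u = u by rewrite /u; cstar with (ks, cs, ck).
have uu : u * u = 1.
  rewrite /u (_ : _ * _ = (k0 * k0) * c * c); last by cstar with ck.
  by rewrite kk; cstar with bc.
have eu : e * u = u * e by rewrite /u; cstar with (ek, ec).
have uk : u * k0 = b by rewrite /u -mulrA ck mulrA kk; cstar with bc.
have ku : k0 * u = b by rewrite /u mulrA kk; cstar with bc.
pose P := (2^-1)%:C *: (e + e * u).
have PP : P + P = e + e * u by rewrite /P -scalerDr scale_half.
exists P, (e * k0); split.
- split; first by rewrite /selfadjoint /P; cstar with (es, us, esym eu).
  rewrite {1}/P -scalerAl (_ : (e + e * u) * P = P + P) ?scale_half //.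
  rewrite PP /P -scalerAr (_ : (e + e * u) * (e + e * u) = (e + e * u) + (e + e * u)) ?scale_half //.
  by cstar with (ee, esym eu, uu).
- by rewrite /P; cstar with ee.
- have [m [[ms _] mm mc]] := pos_sqrt kp.
  have em : e * m = m * e by apply: mc.
  rewrite (_ : e * k0 = (e * m) * (e * m)); last by rewrite -mm; cstar with (ee, esym em).
  by apply: pos_sqr; cstar with (es, ms, em).
- split; first by cstar with ee.
  by rewrite /P; cstar with (ee, esym ek, esym eu, uk, ku).
- rewrite (_ : P * (e * k0) - _ = (P + P) * (e * k0) - e * k0); last by cstar with ee.
  rewrite PP (_ : (e + e * u) * (e * k0) - _ = e * (u * k0)); last by cstar with (ee, esym eu, esym ek).
  by rewrite uk /b (_ : e * _ = g) //; cstar with (ee, eg).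
Qed.
End Projections.


(** * Sums of symmetries, polar decomposition and subequivalence *)

Section Comparison.
Context {R : realType} {A : unitalCStarAlgType R}.
Implicit Types (x y z h k m e p q s v w : A) (r M eps : R).

(** Up to a small error [c] is [u * k] with [u] the symmetry P - (e - P) and [k] positive, so c - u
    is close to u * (k - 1). As [k] lies between 0 and about [N], the norm of k - 1 is at most about
    max(1, N - 1), and [2 <= N] makes this N - 1. *)
Lemma symmetry_step (rr0 : real_rank_zero A) e c (N eps : R) :
  projection e -> star c = c -> e * c = c -> nrm c <= N -> 2 <= N -> 0 < eps ->
  exists P, [/\ projection P, e * P = P & nrm (c - (P - (e - P))) <= N - 1 + eps].
Proof.
move=> pe cs ec cN N2 eps0; have [es ee] := pe.
have [|P [k [pP eP pk [ek Pk] hc]]] := @sign_approx _ _ rr0 e c (eps / 2) pe cs ec; first by lra.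
have [Ps PP] := pP.
have Pe : P * e = P by rewrite -[RHS]Ps -[in RHS]eP; cstar with (Ps, es).
exists P; split=> //.
pose u := P - (e - P).
have u1 : nrm u <= 1.
  apply: nrm_le_of_sqr => //; rewrite expr1n (_ : _ * _ = e); first exact: nrm_projection.
  by rewrite /u; cstar with (es, Ps, PP, ee, eP, Pe).
have hE : P * k - (e - P) * k = u * k by rewrite /u; cstar.
have uuk : u * (u * k) = k by rewrite /u; cstar with (PP, ee, eP, Pe, ek).
pose N' := N + eps / 2.
have hN : nrm (u * k) <= N'.
  rewrite -hE (_ : _ - _ = c - (c - (P * k - (e - P) * k))); last by cstar.
  by apply: le_trans (nrmB _ _) _; rewrite /N'; lra.
have kN : nrm k <= N' by rewrite -uuk -[N']mul1r; apply: nrmM_le.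
have kh := pos_half pk kN.
rewrite (_ : c - _ = (c - u * k) + u * (k - 1)); last first.
  by rewrite /u; cstar with (eP, ee, Pe, PP).
apply: le_trans (nrmD _ _) _.
have t1 : nrm (k - 1) <= N' - 1.
  apply: le_trans (nrm_trans ((N' / 2)%:C *: 1) _ _) _; rewrite nrmBC.
  have -> : (N' / 2)%:C *: 1 - 1 = (N' / 2 - 1)%:C *: 1 :> A.
    by rewrite -scaleCD scaleCN scaleC1.
  by rewrite [nrm (_ *: 1)]nrmZ nrm1 mulr1 ger0_norm; move: kh; rewrite /N'; lra.
by have := nrmM_le u1 t1; move: hc; rewrite hE /N' mul1r; lra.
Qed.

(* As long as the norm exceeds 1, subtracting the sign of [c] lowers it by almost 1. *)
Lemma symmetries_approx (rr0 : real_rank_zero A) e c (K : nat) :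
  projection e -> star c = c -> e * c = c -> nrm c <= K%:R ->
  exists P : nat -> A, (forall i, projection (P i) /\ e * P i = P i) /\
    nrm (c - \sum_(i < K) (P i - (e - P i))) <= 2.
Proof.
move=> pe cs ec cK.
(* [d] is the error accumulated so far and [d'] what may still be spent; each step spends half of
   [d']. *)
suff H n x (d d' : R) : star x = x -> e * x = x -> nrm x <= n%:R + 1 + d -> 0 <= d -> 0 < d' ->
    exists P : nat -> A, (forall i, projection (P i) /\ e * P i = P i) /\
    nrm (x - \sum_(i < n) (P i - (e - P i))) <= 1 + d + d'.
  have cK1 : nrm c <= K%:R + 1 + 0 by lra.
  have [P [hP hc]] := H K c 0 1 cs ec cK1 (lexx _) ltr01.
  by exists P; split=> //; lra.
have [es ee] := pe.
elim: n x d d' => [|n IH] x d d' xs ex xd d0 d'0.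
  exists (fun=> e); split=> //; rewrite big_ord0 subr0; move: xd; rewrite mulr0n; lra.
have [||P0 [pP eP hP]] := @symmetry_step rr0 e x (n.+1%:R + 1 + d) (d' / 2) pe xs ex xd.
- by have := ler0n R n; rewrite -natr1; lra.
- by lra.
have [Ps PP] := pP.
have d1 : 0 <= d + d' / 2 by lra.
have d2 : 0 < d' / 2 by lra.
have [|||P [hP' hx]] := IH (x - (P0 - (e - P0))) _ _ _ _ _ d1 d2.
- by cstar with (xs, Ps, es).
- by cstar with (ex, eP, ee).
- by move: hP; rewrite -natr1; lra.
exists (fun i => if i is i'.+1 then P i' else P0); split; first by case.
by rewrite big_ord_recl /= opprD addrA; apply: le_trans hx _; lra.
Qed.

Lemma star_mul_eq0 x : star x * x = 0 -> x = 0.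
Proof.
move=> h; apply: nrm_eq0; apply/eqP.
by rewrite -[_ == _](expf_eq0 _ 2) -nrm_starM h nrm0.
Qed.

Lemma partial_isometry_src v p : projection p -> star v * v = p -> v * p = v.
Proof.
move=> [ps pp] vp; apply/eqP; rewrite -subr_eq0; apply/eqP/star_mul_eq0.
by cstar with (ps, vp, pp).
Qed.

Lemma partial_isometry_range v p : projection p -> star v * v = p -> projection (v * star v).
Proof.
move=> pp vp; have vpv := partial_isometry_src pp vp.
by split; [rewrite /selfadjoint; cstar | cstar with (vp, vpv)].
Qed.

(** The inequality makes [star w * w] invertible in the corner of [s], and [j] is its inverse square
    root there: with 1 - x equal to [star w * w] over [M] on [s], the product of the root 1 - y and
    the inverse [q] of 1 - x is the power -1/2. *)
Lemma polar s w M : projection s -> w * s = w -> nrm (M%:C *: s - star w * w) < M ->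
  exists j, star (w * j) * (w * j) = s.
Proof.
move=> [ss sE] ws hM.
have M0 : 0 < M by apply: le_lt_trans hM; exact: nrm_ge0.
pose t := (Num.sqrt M)^-1.
have tt : t * t = M^-1 by rewrite -invfM -expr2 sqr_sqrtr // ltW.
pose b := (M^-1)%:C *: (star w * w).
pose x := s - b.
have x1 : nrm x < 1.
  have -> : x = (M^-1)%:C *: (M%:C *: s - star w * w).
    by rewrite scalerBr scaleCA mulVf ?lt0r_neq0 // scaleC1.
  by rewrite nrmZ ger0_norm ?invr_ge0 ?ltW // mulrC ltr_pdivrMr // mul1r.
have sw : s * star w = star w by rewrite -{2}ws starMr ss.
have sx : s * x = x by rewrite /x /b; cstar with (sE, sw).
have xs : x * s = x by rewrite /x /b; cstar with (sE, ws).
have xstar : star x = x by rewrite /x /b; cstar with ss.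
have [q [q1 q2 qc]] := neumann x1.
have [y [_ yy ys yc]] := sqrt_one_minus (ltW x1).
have {}ys := ys xstar.
have qs : q * s = s * q by rewrite -qc // sx xs.
have ysc : y * s = s * y by rewrite -yc // sx xs.
have yx : y * x = x * y by rewrite -yc.
have qy : q * y = y * q by rewrite -qc.
have qstar : star q = q.
  rewrite -[LHS]mulr1 -q2 mulrA (_ : star q * (1 - x) = 1) ?mul1r //.
  by rewrite -[RHS]star1 -[in RHS]q2; cstar with xstar.
exists (t%:C *: ((1 - y) * q)).
have -> : star (w * (t%:C *: ((1 - y) * q))) * (w * (t%:C *: ((1 - y) * q))) =
   q * (1 - y) * b * (1 - y) * q.
  rewrite /b -tt -scaleCA; cstar with (ys, qstar).
have -> : b = (1 - x) * s by rewrite mulrBl mul1r xs /x; cstar.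
rewrite (_ : _ * q = (q * (1 - x)) * ((1 - y) * (1 - y)) * q * s); last by cstar with (yx, qy, qs, ysc).
by rewrite yy q1 mul1r q2 mul1r.
Qed.

(** Unlike in [mvn_prec], the range of [v] may be all of [q]. *)
Definition subequiv p q := exists v, star v * v = p /\ q * v = v.

Lemma subequiv_of_compression s w M q : projection s -> w * s = w -> q * w = w ->
  nrm (M%:C *: s - star w * w) < M -> subequiv s q.
Proof.
move=> ps ws qw hM; have [j hj] := polar ps ws hM.
by exists (w * j); split=> //; rewrite mulrA qw.
Qed.

End Comparison.


(** * Traces *)

Section Trace.
Context {R : realType} {A : unitalCStarAlgType R}.
Implicit Types (x y z h k m e p q s v w : A) (r M eps : R) (tau : {scalar A}).

Definition trR (tau : {scalar A}) (x : A) : R := complex.Re (tau x).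

Lemma trRD tau x y : trR tau (x + y) = trR tau x + trR tau y.
Proof. by rewrite /trR linearD; case: (tau x); case: (tau y). Qed.

Lemma trRN tau x : trR tau (- x) = - trR tau x.
Proof. by rewrite /trR linearN; case: (tau x). Qed.

Lemma trRB tau x y : trR tau (x - y) = trR tau x - trR tau y.
Proof. by rewrite trRD trRN. Qed.

Lemma trR0 tau : trR tau 0 = 0.
Proof. by rewrite /trR linear0. Qed.

Lemma trRZ tau r x : trR tau (r%:C *: x) = r * trR tau x.
Proof. by rewrite /trR linearZ /=; case: (tau x) => a b /=; rewrite mul0r subr0. Qed.

Lemma trR_sum tau (I : Type) (s : seq I) (P : pred I) (F : I -> A) :
  trR tau (\sum_(i <- s | P i) F i) = \sum_(i <- s | P i) trR tau (F i).
Proof. by elim/big_rec2: _ => [|i x y _ <-]; rewrite ?trR0 // trRD. Qed.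

Lemma trRi tau x : trR tau ('i *: x) = - complex.Im (tau x).
Proof. by rewrite /trR linearZ /=; case: (tau x) => a b /=; rewrite mul0r mul1r add0r. Qed.

Context (tau : {scalar A}) (tr : is_tracial_state tau).
Local Notation T := (trR tau).

Lemma trRC x y : T (x * y) = T (y * x).
Proof. by rewrite /trR (tracial_stateC tr). Qed.

Lemma trR1 : T 1 = 1.
Proof. by rewrite /trR (tracial_state1 tr). Qed.

Lemma trR_sqr_ge0 x : 0 <= T (star x * x).
Proof.
have := tracial_state_ge0 tr x; rewrite /trR lecE /= => /andP[_].
by [].
Qed.

Lemma trace_pos_real h : pos h -> tau h = (T h)%:C.
Proof.
move=> /pos_sqrt[m [[ms _] <- _]].
have h0 : 0 <= tau (m * m) by have := tracial_state_ge0 tr m; rewrite ms.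
by rewrite /trR RRe_real // ger0_real.
Qed.

Lemma trR_compress_ge0 e h : star e = e -> pos h -> 0 <= T (e * h * e).
Proof.
move=> es /pos_sqrt[m [[ms _] <- _]].
rewrite (_ : _ * e = star (m * e) * (m * e)) ?trR_sqr_ge0 //.
by cstar with (es, ms).
Qed.

Lemma pos_sub_selfadjoint x M : star x = x -> nrm x <= M -> pos (M%:C *: 1 - x).
Proof.
move=> xs xM; split; first by cstar with xs.
by exists M; rewrite (_ : _ - _ = x) //; cstar.
Qed.

(** |x| - x is positive, hence a square, and squares have real trace. *)
Lemma trace_selfadjoint_real x : star x = x -> tau x = (T x)%:C.
Proof.
move=> xs; have := trace_pos_real (pos_sub_selfadjoint xs (lexx _)).
rewrite trRB trRZ trR1 mulr1 linearB linearZ /= (tracial_state1 tr) mulr1 raddfB /=.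
by move/addrI/oppr_inj.
Qed.

Lemma trace_star x : tau (star x) = Num.conj (tau x).
Proof.
pose a := x + star x; pose b := 'i *: (x - star x).
have aR : tau a = (T a)%:C by apply: trace_selfadjoint_real; rewrite /a; cstar.
have bR : tau b = (T b)%:C.
  by apply: trace_selfadjoint_real; rewrite /b star_i -scalerN; congr (_ *: _); cstar.
move: aR bR; rewrite /a /b /trR linearZ /= linearB linearD /=.
case: (tau x) => x1 x2; case: (tau (star x)) => y1 y2 /= [h1] [h2].
apply/eqP; rewrite eq_complex /=; apply/andP; split; apply/eqP; lra.
Qed.

Lemma trR_star x : T (star x) = T x.
Proof. by rewrite /trR trace_star; case: (tau x). Qed.

Lemma trR_le e x M : projection e -> star x = x -> e * x = x -> nrm x <= M -> T x <= M * T e.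
Proof.
move=> [es ee] xs ex xM.
have xe : x * e = x by rewrite -[RHS]xs -[in RHS]ex; cstar with (xs, es).
have := trR_compress_ge0 es (pos_sub_selfadjoint xs xM).
rewrite (_ : _ * e = M%:C *: e - x); last by cstar with (ee, ex, xe).
by rewrite trRB trRZ subr_ge0.
Qed.

Lemma trR_norm_le e x M : projection e -> e * x * e = x -> nrm x <= M -> `|T x| <= M * T e.
Proof.
move=> pe exe xM; have [es ee] := pe.
pose y := (2^-1)%:C *: (x + star x).
have Ty : T y = T x by rewrite trRZ trRD trR_star; lra.
have ys : star y = y by rewrite /y; cstar.
have ex : e * x = x by rewrite -exe; cstar with ee.
have exs : e * star x = star x by rewrite -exe; cstar with (es, ee).
have ey : e * y = y by rewrite /y; cstar with (ex, exs).
have yM : nrm y <= M.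
  rewrite /y nrmZ ger0_norm ?invr_ge0 //.
  by have := nrmD x (star x); rewrite nrm_star; lra.
rewrite -Ty ler_norml lerNl -trRN; apply/andP; split; last exact: trR_le.
by apply: trR_le; rewrite ?starN ?ys ?mulrN ?ey ?nrmN.
Qed.

Lemma trR_le_nrm x : `|T x| <= nrm x.
Proof.
have p1 : projection (1 : A) by split; rewrite /selfadjoint ?star1 ?mulr1.
have x1 : 1 * x * 1 = x by rewrite mul1r mulr1.
by have := trR_norm_le p1 x1 (lexx _); rewrite trR1 mulr1.
Qed.

(** Cauchy-Schwarz with a free parameter instead of square roots: expand the trace of the square of
    r x - y. *)
Lemma trR_amgm x y r : 0 < r ->
  2 * T (star x * y) <= r * T (star x * x) + r^-1 * T (star y * y).
Proof.
move=> r0; have := trR_sqr_ge0 (r%:C *: x - y).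
rewrite (_ : star _ * _ = r%:C *: (r%:C *: (star x * x) - star x * y - star y * x) + star y * y);
  last by cstar.
have E : T (star y * x) = T (star x * y) by rewrite -trR_star; congr (trR _ _); cstar.
rewrite trRD trRZ !trRB trRZ E => h.
rewrite -(ler_pM2l r0) mulrDr (mulrA r r^-1) mulfV ?lt0r_neq0 // mul1r.
by move: h; nra.
Qed.

Lemma trR_projection_ge0 p : projection p -> 0 <= T p.
Proof. by move=> [ps pp]; rewrite -pp -{1}ps trR_sqr_ge0. Qed.

Lemma trR_projection_le1 p : projection p -> T p <= 1.
Proof.
move=> pp; have := trR_projection_ge0 (projectionC pp).
by rewrite trRB trR1 subr_ge0.
Qed.

Lemma trR_projection_le p q : projection p -> projection q -> q * p = p -> T p <= T q.
Proof.
move=> [ps pp] [qs qq] qp.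
have pq : p * q = p by rewrite -[RHS]ps -[in RHS]qp; cstar with (ps, qs).
have h : projection (q - p) by split; [rewrite /selfadjoint; cstar with (ps, qs) | cstar with (qq, pp, pq, qp)].
by have := trR_projection_ge0 h; rewrite trRB subr_ge0.
Qed.

Lemma trR_mvn v p q : star v * v = p -> v * star v = q -> T p = T q.
Proof. by move=> <- <-; rewrite trRC. Qed.

Lemma trR_subequiv p q : projection p -> projection q -> subequiv p q -> T p <= T q.
Proof.
move=> pp pq [v [vp qv]]; rewrite (trR_mvn vp erefl).
apply: trR_projection_le => //; first exact: partial_isometry_range vp.
by rewrite mulrA qv.
Qed.

Hypothesis simpleA : simple_cstar A.

(** These [x] form a closed two-sided ideal, which misses 1 because [T 1] is 1. *)
Lemma tracial_null_ideal_trivial x : (forall y, T (y * x) = 0) -> x = 0.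
Proof.
pose I := [set x : A | forall y, T (y * x) = 0]%classic.
have idI : two_sided_ideal I.
  split.
  - by move=> y; rewrite mulr0 trR0.
  - by move=> a b ha hb y; rewrite mulrDr trRD ha hb addr0.
  - by move=> a b hb y; rewrite mulrA hb.
  - by move=> a b hb y; rewrite mulrA trRC mulrA hb.
have clI : closed I.
  rewrite closure_id; apply/seteqP; split; first exact: subset_closure.
  move=> a ca y; apply/eqP; rewrite -normr_le0 leNgt; apply/negP => h.
  have d0 : 0 < nrm y + 1 by have := nrm_ge0 y; lra.
  have e0 : 0 < `|T (y * a)| / (nrm y + 1) by rewrite divr_gt0.
  have [b Ib ab] := closure_approx ca e0.
  have : `|T (y * a)| <= nrm y * nrm (a - b).
    rewrite -[T (y * a)]subr0 -(Ib y) -trRB -mulrBr.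
    exact: le_trans (trR_le_nrm _) (nrmM _ _).
  rewrite ltr_pdivlMr // in ab.
  by have := nrm_ge0 y; have := nrm_ge0 (a - b); nra.
move=> hx; have Ix : I x by [].
case: (simpleA idI clI) => IE; first by move: Ix; rewrite IE.
have : I 1 by rewrite IE.
by move/(_ 1); rewrite mulr1 trR1 => /eqP; rewrite oner_eq0.
Qed.

Lemma trace_faithful x : T (star x * x) = 0 -> x = 0.
Proof.
move=> x0.
have half y : T (y * x) <= 0.
  rewrite leNgt; apply/negP => h.
  pose c := T (y * star y).
  have c0 : 0 <= c by have := trR_sqr_ge0 (star y); rewrite starK.
  (* With this [r] the inequality [trR_amgm] reads 2 T(yx) <= r c, while r c is at most T(yx). *)
  have r0 : 0 < T (y * x) / (c + 1) by rewrite divr_gt0 //; lra.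
  have := trR_amgm (star y) x r0; rewrite starK x0 mulr0 addr0 -/c.
  have : T (y * x) / (c + 1) * c <= T (y * x).
    by rewrite mulrAC ler_pdivrMr; [nra | lra].
  lra.
apply: tracial_null_ideal_trivial => y; apply/le_anti; rewrite half /=.
by rewrite -oppr_le0 -trRN -mulNr half.
Qed.

Lemma trR_projection_gt0 p : projection p -> p != 0 -> 0 < T p.
Proof.
move=> pp p0; rewrite lt_def trR_projection_ge0 // andbT; apply/eqP => h.
case: pp => ps pp; move/eqP: p0; apply; apply: trace_faithful.
by rewrite ps pp.
Qed.

End Trace.


(** * Divisibility of projections *)

Section Divisibility.
Context {R : realType} {A : unitalCStarAlgType R}.
Implicit Types (x y z h k m e p q s t u v w : A) (r M eps : R).

(** The closure of the algebraic ideal generated by [s] is a nonzero closed ideal, hence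
    everything. *)
Lemma simple_unit_approx (simpleA : simple_cstar A) s eps : s != 0 -> 0 < eps ->
  exists l : seq (A * A), nrm (1 - \sum_(xy <- l) xy.1 * s * xy.2) < eps.
Proof.
move=> s0 eps0; pose J := [set a : A | exists l : seq (A * A), a = \sum_(xy <- l) xy.1 * s * xy.2]%classic.
have JD a b : J a -> J b -> J (a + b).
  by move=> [l ->] [l' ->]; exists (l ++ l'); rewrite big_cat.
have JM c d a : J a -> J (c * a * d).
  move=> [l ->]; exists [seq (c * xy.1, xy.2 * d) | xy <- l].
  by rewrite big_map mulr_sumr mulr_suml; apply: eq_bigr => xy _ /=; rewrite !mulrA.
have cJ c d a : closure J a -> closure J (c * a * d).
  move=> ca; apply: approx_closure => e e0.
  have n0 : 0 < nrm c * nrm d + 1 by have := mulr_ge0 (nrm_ge0 c) (nrm_ge0 d); lra.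
  have [b Jb ab] := closure_approx ca (divr_gt0 e0 n0).
  exists (c * b * d); first exact: JM.
  rewrite (_ : _ - _ = c * (a - b) * d); last by cstar.
  rewrite ltr_pdivlMr // in ab.
  have := nrmM_le (nrmM c (a - b)) (lexx (nrm d)).
  by have := nrm_ge0 (a - b); nra.
have idI : two_sided_ideal (closure J).
  split.
  - by apply: subset_closure; exists [::]; rewrite big_nil.
  - move=> a b ca cb; apply: approx_closure => e e0.
    have e2 : 0 < e / 2 by lra.
    have [a' Ja ha] := closure_approx ca e2; have [b' Jb hb] := closure_approx cb e2.
    exists (a' + b'); first exact: JD.
    rewrite opprD addrACA; apply: le_lt_trans (nrmD _ _) _; lra.
  - by move=> a b cb; rewrite -[a * b]mulr1; apply: cJ.
  - by move=> a b cb; rewrite -[b]mul1r; apply: cJ.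
have sI : closure J s.
  by apply: subset_closure; exists [:: (1, 1)]; rewrite big_seq1 /= mul1r mulr1.
have I1 : closure J 1.
  case: (simpleA _ idI (@closed_closure _ J)) => IE; last by rewrite IE.
  by move: sI; rewrite IE => /= /eqP; rewrite (negPf s0).
by have [_ [l ->] h] := closure_approx I1 eps0; exists l.
Qed.

Lemma projection0 : projection (0 : A).
Proof. by split; rewrite /selfadjoint ?star0 ?mulr0. Qed.

Lemma projectionD p q : projection p -> projection q -> p * q = 0 -> projection (p + q).
Proof.
move=> [ps pp] [qs qq] pq; have qp : q * p = 0 by rewrite -[RHS]star0 -pq; cstar with (ps, qs).
by split; [rewrite /selfadjoint; cstar with (ps, qs) | cstar with (pp, qq, pq, qp)].
Qed.

Lemma projection_le_comm p q : projection p -> projection q -> q * p = p -> p * q = p.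
Proof. by move=> [ps pp] [qs qq] qp; rewrite -[RHS]ps -[in RHS]qp; cstar with (ps, qs). Qed.

Lemma projection_orthC p q : projection p -> projection q -> p * q = 0 -> q * p = 0.
Proof. by move=> [ps pp] [qs qq] pq; rewrite -[RHS]star0 -pq; cstar with (ps, qs). Qed.

Lemma projectionB p q : projection p -> projection q -> q * p = p -> projection (q - p).
Proof.
move=> pp' qq' qp; have pq := projection_le_comm pp' qq' qp.
case: pp' qq' => [ps pp] [qs qq].
by split; [rewrite /selfadjoint; cstar with (ps, qs) | cstar with (qq, pp, pq, qp)].
Qed.

(** [star w * w] is bounded below on [s] by c - |d|, so polar decomposition applies, with the
    constant c + |k|. *)
Lemma bounded_below_subequiv s q w k d (c : R) : projection s -> w * s = w -> q * w = w ->
  pos k -> star w * w = c%:C *: s + s * k * s + d -> nrm d < c -> subequiv s q.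
Proof.
move=> ps ws qw pk wE dc; have [ss sE] := ps.
apply: (subequiv_of_compression ps ws qw (M := c + nrm k)).
rewrite wE (_ : _ - _ = s * ((nrm k)%:C *: 1 - k) * s - d); last first.
  by rewrite -scaleCD; cstar with sE.
apply: le_lt_trans (nrmB _ _) _; rewrite addrC; apply: ltr_leD => //.
have := nrmM_le (nrmM_le (nrm_projection ps) (pos_shift pk (lexx _))) (nrm_projection ps).
by rewrite mul1r mulr1.
Qed.

Context (tau : {scalar A}) (tr : is_tracial_state tau).
Local Notation T := (trR tau).
Hypotheses (simpleA : simple_cstar A) (rr0 : real_rank_zero A).

(** [P] is roughly the spectral projection of [star w * w] for values above eps/2. On [P] the
    element [w] is bounded below, so [P] embeds into [s]; on the rest of [t] it is small in
    trace. *)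
Lemma split_off_piece t s w eps : projection t -> w * t = w -> s * w = w -> 0 < eps ->
  exists P, [/\ projection P, t * P = P, subequiv P s &
    forall q, projection q -> (t - P) * q = q -> T (star (w * q) * (w * q)) <= eps * T q].
Proof.
move=> pt wt sw eps0; have [ts tt] := pt.
have tws : t * star w = star w by rewrite -{2}wt starMr ts.
pose h := star w * w - (eps / 2)%:C *: t.
have hs : star h = h by rewrite /h; cstar with ts.
have th : t * h = h by rewrite /h; cstar with (tws, tt).
have eps4 : 0 < eps / 4 by lra.
have [P [k [pP tP pk [tk Pk] hd]]] := sign_approx rr0 pt hs th eps4.
have [Ps PP] := pP.
have Pt := projection_le_comm pP pt tP.
set d := h - _ in hd.
have wwE : star w * w = (eps / 2)%:C *: t + (P * k - (t - P) * k) + d.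
  by rewrite /d /h; cstar.
exists P; split=> //.
- apply: (@bounded_below_subequiv P s (w * P) k (P * d * P) (eps / 2)) => //.
  + by rewrite -mulrA PP.
  + by rewrite mulrA sw.
  + rewrite (_ : star _ * _ = P * (star w * w) * P); last by cstar with Ps.
    by rewrite wwE; cstar with (PP, tP, Pt, esym Pk).
  have := nrmM_le (nrmM_le (nrm_projection pP) hd) (nrm_projection pP).
  by rewrite mul1r mulr1; lra.
- move=> q pq' Pq; have [qs qq] := pq'.
  have Pq0 : P * q = 0 by rewrite -Pq; cstar with (PP, Pt).
  have tq : t * q = q by rewrite -Pq; cstar with (tt, tP).
  have qP0 : q * P = 0 by apply: projection_orthC.
  have qt : q * t = q by apply: projection_le_comm.
  rewrite (_ : star _ * _ = (eps / 2)%:C *: q - q * k * q + q * d * q); last first.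
    rewrite (_ : star _ * _ = q * (star w * w) * q); last by cstar with qs.
    by rewrite wwE; cstar with (qt, qP0, qq, tq, Pq0).
  rewrite trRD trRB trRZ; have := trR_compress_ge0 tr qs pk.
  have : `|T (q * d * q)| <= eps / 4 * T q.
    apply: trR_norm_le => //; first by cstar with qq.
    have := nrmM_le (nrmM_le (nrm_projection pq') hd) (nrm_projection pq').
    by rewrite mul1r mulr1.
  have := mulr_ge0 (ltW eps0) (trR_projection_ge0 tr pq').
  by rewrite ler_norml => ? /andP[_ ?] ?; lra.
Qed.

Lemma split_off_piece_bilinear t s x y del : projection t -> projection s -> 0 < del ->
  exists P, [/\ projection P, t * P = P, subequiv P s &
    forall q, projection q -> (t - P) * q = q -> T (q * (x * s * y) * q) <= del * T q].
Proof.
move=> pt ps del0; have [ts tt] := pt; have [ss sE] := ps.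
pose c := nrm y ^+ 2.
have c0 : 0 <= c by rewrite exprn_ge0 ?nrm_ge0.
(* [split_off_piece] is used with del/r, so both terms of [trR_amgm] are at most del T(q): r (del/r)
   is del, and c/r is at most del. *)
pose r := (c + 1) / del.
have r0 : 0 < r by rewrite divr_gt0 //; lra.
have eps0 : 0 < del / r by rewrite divr_gt0.
have wt : s * star x * t * t = s * star x * t by cstar with tt.
have sw : s * (s * star x * t) = s * star x * t by cstar with sE.
have [P [pP tP Ps H]] := split_off_piece pt wt sw eps0.
exists P; split=> // q pq Pq; have [qs qq] := pq.
have tP' := projection_le_comm pP pt tP.
have tq : t * q = q by rewrite -Pq; cstar with (tt, tP).
have := H q pq Pq.
rewrite (_ : s * star x * t * q = s * star x * q); last by cstar with tq.
set a := s * star x * q => ha.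
have hb : T (star (s * y * q) * (s * y * q)) <= c * T q.
  have nb : nrm (s * y * q) <= nrm y.
    have := nrmM_le (nrmM_le (nrm_projection ps) (lexx (nrm y))) (nrm_projection pq).
    by rewrite mul1r mulr1.
  apply: (trR_le tr pq); [by cstar | by cstar with (qs, qq) |].
  by rewrite nrm_starM /c ler_pXn2r ?nnegrE ?nrm_ge0.
have := trR_amgm tr a (s * y * q) r0.
rewrite (_ : star a * (s * y * q) = q * (x * s * y) * q); last by rewrite /a; cstar with (qs, ss, sE).
have q0 := trR_projection_ge0 tr pq.
have : r * T (star a * a) <= del * T q.
  have rd : r * (del / r) = del by rewrite mulrC divfK ?lt0r_neq0.
  by rewrite -[X in X * T q]rd -mulrA ler_pM2l.
have : r^-1 * T (star (s * y * q) * (s * y * q)) <= del * T q.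
  have dr : del * r = c + 1 by rewrite mulrC divfK ?lt0r_neq0.
  rewrite mulrC ler_pdivrMr // mulrAC dr.
  by apply: le_trans hb _; nra.
lra.
Qed.

End Divisibility.


(** * Covering a projection by finitely many pieces of another one *)

Section Pieces.
Context {R : realType} {A : unitalCStarAlgType R}.
Implicit Types (x y z h k m e p q s t u v w c : A) (r M eps : R).

(** The relation that [t] is dominated by [n] times [s], with an explicit orthogonal decomposition.
    Pieces may be zero. *)
Fixpoint pieces (n : nat) (s t : A) : Prop :=
  if n is n'.+1 then
    exists p t', [/\ projection p, pieces n' s t', p * t' = 0, subequiv p s & t = p + t']
  else t = 0.

Lemma pieces_projection n s t : pieces n s t -> projection t.
Proof.
elim: n t => [|n IH] t; first by move=> ->; exact: projection0.
by move=> [p [t' [pp /IH pt' pt _ ->]]]; apply: projectionD.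
Qed.

(** Riesz refinement. The compressions of [p] and [q] by [v] add up to [t]; cutting [t] by the sign
    of the first one minus t/2 leaves one part where [p * v] is bounded below and one where [q * v]
    is. *)
Lemma subequiv_split t p q v (rr0 : real_rank_zero A) : projection t -> projection p -> projection q ->
  star v * v = t -> (p + q) * v = v -> p * q = 0 ->
  exists t1, [/\ projection t1, t * t1 = t1, subequiv t1 p & subequiv (t - t1) q].
Proof.
move=> pt pp pq vt pqv pq0; have [ts tE] := pt; have [ps pE] := pp; have [qs qE] := pq.
have vt' := partial_isometry_src pt vt.
have tv : t * star v = star v by rewrite -{2}vt' starMr ts.
pose a : R := 2^-1.
pose h := star v * p * v - a%:C *: t.
have hs : star h = h by rewrite /h; cstar with (ts, ps).
have th : t * h = h by rewrite /h; cstar with (tv, tE).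
have e4 : 0 < (4^-1 : R) by lra.
have [P [k [pP tP pk [tk Pk] hd]]] := sign_approx rr0 pt hs th e4.
have [Ps PP] := pP.
have Pt := projection_le_comm pP pt tP.
set d := h - _ in hd.
have hE : star v * p * v = a%:C *: t + (P * k - (t - P) * k) + d by rewrite /d /h; cstar.
have qE' : star v * q * v = t - star v * p * v.
  rewrite (_ : _ * v = star v * ((p + q) * v) - star v * p * v); last by cstar.
  by rewrite pqv vt.
have half : a%:C *: t + a%:C *: t = t by rewrite scaleCD (_ : _ + _ = 1) ?scaleC1 // /a; lra.
have ptP := projectionB pP pt tP.
have dn s : projection s -> nrm (s * d * s) < a.
  move=> pj; have := nrmM_le (nrmM_le (nrm_projection pj) hd) (nrm_projection pj).
  by rewrite mul1r mulr1 /a; lra.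
have kt : k * t = k by case: pk => ks _; rewrite -[RHS]ks -[in RHS]tk; cstar with (ts, ks).
exists P; split=> //.
- apply: (@bounded_below_subequiv _ _ P p (p * v * P) k (P * d * P) a) => //; last exact: dn.
  + by cstar with PP.
  + by cstar with pE.
  + rewrite (_ : star _ * _ = P * (star v * p * v) * P); last by cstar with (Ps, ps, pE).
    by rewrite hE; cstar with (PP, tP, Pt, esym Pk).
- apply: (@bounded_below_subequiv _ _ (t - P) q (q * v * (t - P)) k (- ((t - P) * d * (t - P))) a) => //.
  + by cstar with (PP, tP, Pt, tE).
  + by cstar with qE.
  + rewrite (_ : star _ * _ = (t - P) * (star v * q * v) * (t - P)); last by cstar with (Ps, ts, qs, qE).
    rewrite qE' hE -{2}half; cstar with (PP, tP, Pt, tE, tk, kt, esym Pk).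
  + by rewrite nrmN; exact: dn.
Qed.

Lemma pieces_split (rr0 : real_rank_zero A) n p q t : projection p -> projection q -> p * q = 0 ->
  pieces n (p + q) t ->
  exists t1 t2, [/\ pieces n p t1, pieces n q t2, t1 * t2 = 0 & t = t1 + t2].
Proof.
move=> pp pq pq0; elim: n t => [|n IH] t.
  by move=> ->; exists 0, 0; rewrite mulr0 addr0.
move=> [c [t' [pc pt' ct [v [vc pqv]] ->]]].
have [t1 [t2 [h1 h2 t12 tE]]] := IH _ pt'.
have [c1 [pc1 cc1 c1p c2q]] := subequiv_split rr0 pc pp pq vc pqv pq0.
have pt1 := pieces_projection h1; have pt2 := pieces_projection h2.
have t21 := projection_orthC pt1 pt2 t12.
have pc2 := projectionB pc1 pc cc1.
have c1c := projection_le_comm pc1 pc cc1.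
have [[t1s t1E] [t2s t2E]] := (pt1, pt2); have [cs cE] := pc.
have ct1 : c * t1 = 0 by rewrite (_ : t1 = t' * t1) ?mulrA ?ct ?mul0r // tE; cstar with (t1E, t21).
have ct2 : c * t2 = 0 by rewrite (_ : t2 = t' * t2) ?mulrA ?ct ?mul0r // tE; cstar with (t2E, t12).
have t1c : t1 * c = 0 by apply: projection_orthC.
have t2c : t2 * c = 0 by apply: projection_orthC.
have c1t1 : c1 * t1 = 0 by rewrite -c1c -mulrA ct1 mulr0.
have c1t2 : c1 * t2 = 0 by rewrite -c1c -mulrA ct2 mulr0.
have t1c1 : t1 * c1 = 0 by rewrite -cc1 mulrA t1c mul0r.
exists (c1 + t1), (c - c1 + t2); split.
- by exists c1, t1; split.
- by exists (c - c1), t2; split=> //; rewrite mulrBl ct2 c1t2 subrr.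
- have [_ c1E] := pc1; by cstar with (c1c, c1E, c1t2, t1c, t1c1, t12).
- by rewrite tE; cstar.
Qed.

Context (tau : {scalar A}) (tr : is_tracial_state tau).
Local Notation T := (trR tau).
Hypotheses (simpleA : simple_cstar A) (rr0 : real_rank_zero A).

(** One piece is split off for each term of the sum. A projection under the final remainder lies
    under all earlier ones, so the trace estimates remain valid and add up. *)
Lemma split_off_pieces (l : seq (A * A)) t s del : projection t -> projection s -> 0 < del ->
  exists t', [/\ projection t', t * t' = t', pieces (size l) s (t - t') &
    forall q, projection q -> t' * q = q ->
      T (q * (\sum_(xy <- l) xy.1 * s * xy.2) * q) <= (size l)%:R * del * T q].
Proof.
move=> pt ps del0; elim: l t pt => [|xy l IH] t pt.
  exists t; split=> //=; first by case: pt.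
    by rewrite subrr.
  by move=> q _ _; rewrite big_nil mulr0 mul0r trR0 !mul0r.
have [P [pP tP Ps H]] := split_off_piece_bilinear tr rr0 xy.1 xy.2 pt ps del0.
have ptP := projectionB pP pt tP.
have Pt := projection_le_comm pP pt tP.
have [t' [pt' tt' pc H']] := IH _ ptP.
have [[PPs PP] [ts tE]] := (pP, pt); have [ts' tE'] := pt'.
have Pt'0 : P * t' = 0 by rewrite -tt'; cstar with (PP, Pt).
have tt0 : t * t' = t' by rewrite -{2}tt' mulrBl Pt'0 subr0.
exists t'; split=> //.
- exists P, (t - P - t'); split=> //; last by cstar.
  by cstar with (PP, Pt, Pt'0).
- move=> q pq t'q; have [qs qE] := pq.
  have q1 : (t - P) * q = q by rewrite -t'q; cstar with (tt0, Pt'0).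
  rewrite big_cons mulrDr mulrDl trRD -natr1 mulrDl mulrDl mul1r addrC.
  by apply: lerD; [exact: H' | exact: H].
Qed.

(** By simplicity 1 is within 1/2 of a sum of terms x s y. On the remainder t' left after splitting
    off a piece for each term, this sum contributes at most T(t')/4 and its distance from 1 at most
    T(t')/2. Hence T(t') = 0, and t' = 0 as the trace is faithful. *)
Lemma pieces_exists s t : projection s -> s != 0 -> projection t -> exists n, pieces n s t.
Proof.
move=> ps s0 pt; have h2 : 0 < 2^-1 :> R by lra.
have [l hl] := simple_unit_approx simpleA s0 h2.
(* Chosen so that [size l] times it is at most 1/4; the added 1 covers the empty list. *)
have d0 : 0 < (4 * ((size l)%:R + 1))^-1 :> R by rewrite invr_gt0 mulr_gt0 // ltr_wpDl // ler0n.
have [t' [pt' tt' pc H]] := split_off_pieces l pt ps d0.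
have [ts tE] := pt'.
set S := \sum_(xy <- l) _ in hl H.
suff T0 : T t' = 0.
  have t0 : t' = 0 by apply: (trace_faithful tr simpleA); rewrite ts tE.
  by exists (size l); move: pc; rewrite t0 subr0.
apply/le_anti; rewrite trR_projection_ge0 // andbT.
have := H t' pt' tE.
have : `|T (t' * (1 - S) * t')| <= 2^-1 * T t'.
  apply: trR_norm_le => //; first by cstar with tE.
  have := nrmM_le (nrmM_le (nrm_projection pt') (ltW hl)) (nrm_projection pt').
  by rewrite mul1r mulr1.
have -> : T (t' * (1 - S) * t') = T t' - T (t' * S * t').
  by rewrite -trRB; congr (trR _ _); cstar with tE.
have : (size l)%:R * (4 * ((size l)%:R + 1))^-1 <= 4^-1 :> R.
  by rewrite ler_pdivrMr ?mulr_gt0 ?ltr_wpDl ?ler0n // mulKf ?pnatr_eq0 // lerDl ler01.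
have := trR_projection_ge0 tr pt'.
move=> h0 h1; rewrite ler_norml => /andP[_ h2'] h3.
have := ler_wpM2r h0 h1; lra.
Qed.

End Pieces.


(** * Halving a sum of at least two equivalent projections *)

Section Halving.
Context {R : realType} {A : unitalCStarAlgType R}.
Implicit Types (x y z h k m e p q s t u v w c : A) (r M eps : R).

(* [x = f + f' + g] with [f = v^* v], [f' = v v^*] and [g = u^* u] orthogonal projections
   and [u u^* <= f]. *)
Definition halvable x := exists v u,
  [/\ v * star v * v = v /\ v * v = 0, u * star u * u = u, u * v = 0 /\ u * star v = 0,
      star v * v * u = u & x = star v * v + v * star v + star u * u].

Lemma corner_mul0 x y a b : x * y = 0 -> a * x = a -> y * b = b -> a * b = 0.
Proof. by move=> xy ax yb; rewrite -ax -yb mulrA -(mulrA a) xy mulr0 mul0r. Qed.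

Lemma halvableD x y : halvable x -> halvable y -> x * y = 0 -> halvable (x + y).
Proof.
move=> [v1 [u1 [[a1 b1] c1 [d1 e1] f1 x1]]] [v2 [u2 [[a2 b2] c2 [d2 e2] f2 x2]]] xy.
have H v u z : v * star v * v = v /\ v * v = 0 -> u * star u * u = u ->
    u * v = 0 /\ u * star v = 0 -> star v * v * u = u ->
    z = star v * v + v * star v + star u * u ->
    [/\ star z = z, v * z = v /\ star v * z = star v, z * v = v /\ z * star v = star v,
        u * z = u /\ star u * z = star u & z * u = u /\ z * star u = star u].
  move=> [a b] d [e f] g ->.
  have a' : star v * v * star v = star v by rewrite -[in RHS]a; cstar.
  have b' : star v * star v = 0 by rewrite -starMr b star0.
  have d' : star u * u * star u = star u by rewrite -[in RHS]d; cstar.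
  have e' : star v * star u = 0 by rewrite -starMr e star0.
  have f' : v * star u = 0 by rewrite -[v]starK -starMr f star0.
  have g' : star u * star v * v = star u by rewrite -[in RHS]g; cstar.
  have uu : u * u = 0 by rewrite -{2}g !mulrA f !mul0r.
  have vu : v * v * u = 0 by rewrite b mul0r.
  have vsu : star v * u = 0 by rewrite -g !mulrA b' !mul0r.
  have usu : star u * star u = 0 by rewrite -starMr uu star0.
  have usv : star u * v = 0 by rewrite -[v]starK -starMr vsu star0.
  by split; [cstar | split | split | split | split]; cstar with (a, b, d, e, f, g, a', b', d', e', f', g', uu, vsu, usu, usv).
have [s1 [p1 p2] [p3 p4] [p5 p6] [p7 p8]] := H _ _ _ (conj a1 b1) c1 (conj d1 e1) f1 x1.
have [s2 [q1 q2] [q3 q4] [q5 q6] [q7 q8]] := H _ _ _ (conj a2 b2) c2 (conj d2 e2) f2 x2.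
have yx : y * x = 0 by rewrite -[RHS]star0 -xy; cstar with (s1, s2).
exists (v1 + v2), (u1 + u2).
have O1 a b := @corner_mul0 x y a b xy; have O2 a b := @corner_mul0 y x a b yx.
have hs := (O1 _ _ p1 q3, O1 _ _ p1 q4, O1 _ _ p2 q3, O1 _ _ p5 q8, O1 _ _ p6 q7, O1 _ _ p5 q3,
  O1 _ _ p5 q4, O1 _ _ p1 q7).
have ks := (O2 _ _ q1 p3, O2 _ _ q1 p4, O2 _ _ q2 p3, O2 _ _ q5 p8, O2 _ _ q6 p7, O2 _ _ q5 p3,
  O2 _ _ q5 p4, O2 _ _ q1 p7).
case: hs => [[[[[[[h1 h2] h3] h4] h5] h6] h7] h8].
case: ks => [[[[[[[k1 k2] k3] k4] k5] k6] k7] k8].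
split.
- by split; cstar with (a1, a2, b1, b2, h1, h2, h3, k1, k2, k3).
- by cstar with (c1, c2, h4, h5, k4, k5).
- by split; cstar with (d1, d2, e1, e2, h6, h7, k6, k7).
- by cstar with (f1, f2, h1, h2, h3, k1, k2, k3, h8, k8).
- by rewrite x1 x2; cstar with (h1, h2, h3, k1, k2, k3, h5, k5).
Qed.

(** The counterpart of [pieces] with full copies: [c] is equivalent to [size vs] times [y]. *)
Fixpoint column (y : A) (vs : seq A) (c : A) : Prop :=
  if vs is v :: vs' then
    exists c', [/\ star v * v = y, column y vs' c', star v * c' = 0 & c = v * star v + c']
  else c = 0.

Lemma column_projection y vs c : projection y -> column y vs c -> projection c.
Proof.
move=> py; elim: vs c => [|v vs IH] c /=; first by move=> ->; exact: projection0.
move=> [c' [vy /IH pc' vc ->]]; apply: projectionD => //.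
  exact: partial_isometry_range vy.
by rewrite -mulrA vc mulr0.
Qed.

(* The copies of [y] are grouped by two, with one group of three if their number is odd. *)
Lemma column_halvable y vs c : projection y -> (1 < size vs)%N -> column y vs c -> halvable c.
Proof.
move=> py; have [n] := ubnP (size vs); elim: n vs c => // n IH.
move=> [//|v1 [//|v2 vs]] c.
rewrite ltnS => sz _ [_ [v1y [c' [v2y cc' v2c ->]] v1c ->]].
have v1y' := partial_isometry_src py v1y; have v2y' := partial_isometry_src py v2y.
have yv1 : y * star v1 = star v1 by rewrite -{2}v1y' starMr; case: py => ->.
have pc' := column_projection py cc'.
have [cs cE] := pc'.
have v12 : star v1 * v2 = 0.
  rewrite (_ : _ * v2 = star v1 * (v2 * star v2 + c') * (v2 * star v2) * v2).
    by rewrite v1c !mul0r.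
  have c'v2 : c' * v2 = 0 by rewrite -[RHS]star0 -v2c; cstar with cs.
  by cstar with (v2y, v2y', c'v2).
have v1c' : star v1 * c' = 0 by move: v1c; rewrite mulrDr !mulrA v12 mul0r add0r.
have v21 : star v2 * v1 = 0 by rewrite -[RHS]star0 -v12; cstar.
have two : halvable (v1 * star v1 + v2 * star v2).
  exists (v2 * star v1), 0; rewrite star0 !mulr0 !mul0r addr0; split=> //.
    by split; cstar with (v1y, v2y, v1y', v2y', v12).
  by cstar with (v1y, v2y, v1y', v2y').
have orth a : star v1 * a = 0 -> star v2 * a = 0 -> (v1 * star v1 + v2 * star v2) * a = 0.
  by move=> h1 h2; cstar with (h1, h2).
rewrite addrA.
case: vs sz cc' => [|v3 [|v4 vs]] sz; first by move=> /= ->; rewrite addr0.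
  move=> /= [_ [v3y -> _ c'E]]; rewrite addr0 in c'E.
  have v3y' := partial_isometry_src py v3y.
  have v13 : star v1 * v3 = 0.
    by rewrite -v3y' -v3y !mulrA -(mulrA (star v1)) -c'E v1c' mul0r.
  have v23 : star v2 * v3 = 0.
    by rewrite -v3y' -v3y !mulrA -(mulrA (star v2)) -c'E v2c mul0r.
  have v32 : star v3 * v2 = 0 by rewrite -[RHS]star0 -v23; cstar.
  have v31 : star v3 * v1 = 0 by rewrite -[RHS]star0 -v13; cstar.
  (* The first two copies are the halves; the third one is the remainder and is mapped onto the
     first. *)
  exists (v2 * star v1), (v1 * star v3); split.
  - by split; cstar with (v1y, v2y, v1y', v2y', v12).
  - by cstar with (v1y, v3y, v1y', v3y').
  - by split; cstar with (v32, v31).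
  - by cstar with (v2y, v1y, v1y').
  - by rewrite c'E; cstar with (v1y, v2y, v1y', v2y', v3y').
move=> cc'; apply: halvableD => //; first by apply: (IH (v3 :: v4 :: vs)) => //=; exact: ltnW.
exact: orth.
Qed.

End Halving.


(** * Halving in the absence of minimality; fitting orthogonal copies *)

Section Fitting.
Context {R : realType} {A : unitalCStarAlgType R}.
Implicit Types (x y z h k m e p q s t u v w c : A).

Lemma column_split y1 y2 vs c : projection y1 -> projection y2 -> y1 * y2 = 0 ->
  column (y1 + y2) vs c -> exists c1 c2,
  [/\ column y1 [seq v * y1 | v <- vs] c1, column y2 [seq v * y2 | v <- vs] c2,
      c1 * c2 = 0 & c = c1 + c2].
Proof.
move=> p1 p2 y12; have y21 := projection_orthC p1 p2 y12.
have [[s1 e1] [s2 e2]] := (p1, p2).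
elim: vs c => [|v vs IH] c /=; first by move=> ->; exists 0, 0; rewrite mulr0 addr0.
move=> [c' [vy /IH[c1 [c2 [h1 h2 c12 c'E]]] vc ->]].
have vyv := partial_isometry_src (projectionD p1 p2 y12) vy.
have q1 : projection c1 by apply: column_projection h1.
have q2 : projection c2 by apply: column_projection h2.
have c21 := projection_orthC q1 q2 c12.
have [[t1 f1] [t2 f2]] := (q1, q2).
have vc1 : star v * c1 = 0.
  by rewrite (_ : c1 = c' * c1) ?mulrA ?vc ?mul0r // c'E; cstar with (f1, c21).
have vc2 : star v * c2 = 0.
  by rewrite (_ : c2 = c' * c2) ?mulrA ?vc ?mul0r // c'E; cstar with (f2, c12).
have c1v : c1 * v = 0 by rewrite -[RHS]star0 -vc1; cstar with t1.
exists (v * y1 * star (v * y1) + c1), (v * y2 * star (v * y2) + c2); split.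
- by exists c1; split=> //; cstar with (s1, vy, e1, y12, vc1).
- by exists c2; split=> //; cstar with (s2, vy, e2, y21, vc2).
- by cstar with (s1, s2, vy, e1, e2, y12, y21, vc2, c1v, c12).
- rewrite c'E -{1}vyv; cstar with (s1, s2, e1, e2, y12, y21).
Qed.

(** The first piece [t] is equivalent to a part ww* of [y]. Splitting [y] along ww* splits the
    column and the other pieces too. On the part of ww* the projection [t] becomes one more full
    copy; on the other part it disappears. Both parts have one piece fewer, and halvable orthogonal
    summands add up. *)
Lemma column_pieces_halvable (rr0 : real_rank_zero A) n y vs c r : projection y ->
  (1 < size vs)%N -> column y vs c -> pieces n y r -> c * r = 0 -> halvable (c + r).
Proof.
elim: n y vs c r => [|n IH] y vs c r py sz cv.
  by move=> -> _; rewrite addr0; apply: column_halvable cv.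
move=> [t [r' [pt pr' tr' [w [wt yw]] rE]]] cr.
have pc := column_projection py cv.
have pr := pieces_projection pr'.
have wt' := partial_isometry_src pt wt.
have pw := partial_isometry_range pt wt.
have yw' : y * (w * star w) = w * star w by rewrite mulrA yw.
have py2 := projectionB pw py yw'.
have [ww_y yE] : w * star w * y = w * star w /\ y * y = y.
  by split; [exact: projection_le_comm | case: py].
have y12 : w * star w * (y - w * star w) = 0 by cstar with (ww_y, wt, wt').
have yE' : w * star w + (y - w * star w) = y by cstar.
rewrite -yE' in cv pr'.
have [c1 [c2 [h1 h2 c12 cE]]] := column_split pw py2 y12 cv.
have [r1 [r2 [k1 k2 r12 r'E]]] := pieces_split rr0 pw py2 y12 pr'.
have q1 := column_projection pw h1; have q2 := column_projection py2 h2.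
have o1 := pieces_projection k1; have o2 := pieces_projection k2.
have c21 := projection_orthC q1 q2 c12; have r21 := projection_orthC o1 o2 r12.
have rt' := projection_orthC pt pr tr'.
have [[a1 b1] [a2 b2]] := (q1, q2); have [[a3 b3] [a4 b4]] := (o1, o2).
have [[ts tE] [cs cE2]] := (pt, pc).
have tr1 : t * r1 = 0.
  rewrite (_ : t * r1 = t * r' * r1); first by rewrite tr' mul0r.
  by rewrite r'E; cstar with (b3, r21).
have tr2 : t * r2 = 0.
  rewrite (_ : t * r2 = t * r' * r2); first by rewrite tr' mul0r.
  by rewrite r'E; cstar with (b4, r12).
have z1 : c * t = 0.
  rewrite (_ : c * t = c * r * t); first by rewrite cr mul0r.
  by rewrite rE; cstar with (tE, rt').
have z2 : c * r1 = 0.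
  rewrite (_ : c * r1 = c * r * r1); first by rewrite cr mul0r.
  by rewrite rE r'E; cstar with (tr1, b3, r21).
have z3 : c * r2 = 0.
  rewrite (_ : c * r2 = c * r * r2); first by rewrite cr mul0r.
  by rewrite rE r'E; cstar with (tr2, b4, r12).
have L1 a : c * a = 0 -> c1 * a = 0.
  move=> ca; rewrite (_ : c1 * a = c1 * (c * a)); first by rewrite ca mulr0.
  by rewrite cE; cstar with (b1, c12).
have L2 a : c * a = 0 -> c2 * a = 0.
  move=> ca; rewrite (_ : c2 * a = c2 * (c * a)); first by rewrite ca mulr0.
  by rewrite cE; cstar with (b2, c21).
have r1t : r1 * t = 0 by apply: projection_orthC.
have tc1 : t * c1 = 0 by apply: projection_orthC => //; exact: L1.
have tc2 : t * c2 = 0 by apply: projection_orthC => //; exact: L2.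
have r1c2 : r1 * c2 = 0 by apply: projection_orthC => //; exact: L2.
have col1 : column (w * star w) (star w :: [seq v * (w * star w) | v <- vs]) (t + c1).
  by exists c1; rewrite starK; split=> //; rewrite ?wt // -wt' -mulrA tc1 mulr0.
have g1 : halvable (t + c1 + r1).
  apply: (IH _ _ _ _ pw _ col1 k1); first by rewrite /= size_map; exact: ltnW.
  by rewrite mulrDl tr1 L1 // addr0.
have g2 : halvable (c2 + r2).
  by apply: (IH _ _ _ _ py2 _ h2 k2); [rewrite size_map | exact: L2].
rewrite rE cE r'E (_ : _ + _ = t + c1 + r1 + (c2 + r2)); last by cstar.
apply: halvableD => //.
by cstar with (tc2, tr2, c12, L1 _ z3, r1c2, r12).
Qed.

Lemma pieces_nonzero n s x : pieces n s x -> x != 0 -> exists t w,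
  [/\ projection t, t != 0, star w * w = t, s * w = w & x * t = t].
Proof.
elim: n x => [|n IH] x /=; first by move=> -> /eqP.
move=> [t [x' [pt px' tx' [w [wt pw]] xE]]] x0.
have px := pieces_projection px'; have [[ts tE] [x's x'E]] := (pt, px).
have x't := projection_orthC pt px tx'.
have [t0|t0] := eqVneq t 0.
  rewrite xE t0 add0r in x0 *; exact: IH px' x0.
by exists t, w; split=> //; rewrite xE; cstar with (tE, x't).
Qed.

Definition strictly_between (p e : A) := [/\ projection p, e * p = p, p != 0 & p != e].

(** e - p consists of pieces of [p], and one of them, [t], is nonzero. With its image under [p] it
    forms a column of two copies inside [e], and the rest of [e] consists of pieces of [t]. *)
Lemma halvable_of_strictly_between (tau : {scalar A}) (tr : is_tracial_state tau)
  (simpleA : simple_cstar A) (rr0 : real_rank_zero A) p e :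
  projection e -> strictly_between p e -> halvable e.
Proof.
move=> pe [pp ep p0 pne]; have [[es eE] [ps pE]] := (pe, pp).
have peE := projection_le_comm pp pe ep.
have pq := projectionB pp pe ep.
have q0 : e - p != 0 by rewrite subr_eq0 eq_sym.
have [n pc] := pieces_exists tr simpleA rr0 pp p0 pq.
have [t [w [pt t0 wt pw qt]]] := pieces_nonzero pc q0.
have [ts tE] := pt.
have wt' := partial_isometry_src pt wt.
have pw' := partial_isometry_range pt wt.
have pt0 : p * t = 0 by rewrite -qt; cstar with (peE, pE).
have tp0 := projection_orthC pp pt pt0.
have tw : t * w = 0 by rewrite -pw mulrA tp0 mul0r.
have et : e * t = t by rewrite -qt; cstar with (eE, ep).
have ew : e * w = w by rewrite -pw mulrA ep.
have col : column t [:: t; w] (t + w * star w).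
  exists (w * star w); rewrite ts tE; split=> //; last by rewrite mulrA tw mul0r.
  by exists 0; rewrite mulr0 addr0 wt.
have pcol := column_projection pt col.
have ecol : e * (t + w * star w) = t + w * star w by cstar with (et, ew).
have [m pm] := pieces_exists tr simpleA rr0 pt t0 (projectionB pcol pe ecol).
rewrite -[e](subrKC (t + w * star w)).
apply: (column_pieces_halvable rr0 pt _ col pm) => //.
have := projection_le_comm pcol pe ecol; have [_ cE] := pcol.
by move=> ce; rewrite mulrBr ce cE subrr.
Qed.

Lemma halvable_halves e : projection e -> halvable e -> exists f v,
  [/\ projection f, star v * v = f, f * (v * star v) = 0,
      e * f = f /\ e * v = v & pieces 3 f e].
Proof.
move=> pe [v [u [[vv v2] uu [uv uvs] fu eE]]].
have vv' : star v * v * star v = star v by rewrite -[in RHS]vv; cstar.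
have uu' : star u * u * star u = star u by rewrite -[in RHS]uu; cstar.
have v2' : star v * star v = 0 by rewrite -starMr v2 star0.
have vsu : star v * star u = 0 by rewrite -starMr uv star0.
have vu : v * star u = 0 by rewrite -[v]starK -starMr uvs star0.
have pf : projection (star v * v).
  by split; [rewrite /selfadjoint; cstar | cstar with vv].
have pf' : projection (v * star v).
  by split; [rewrite /selfadjoint; cstar | cstar with vv].
have pg : projection (star u * u).
  by split; [rewrite /selfadjoint; cstar | cstar with uu].
exists (star v * v), v; split=> //.
- by cstar with v2.
- by rewrite eE; split; cstar with (vv, v2, v2', uv, uvs).
- exists (star v * v), (v * star v + star u * u); split=> //.
  + exists (v * star v), (star u * u); split=> //.
    * exists (star u * u), 0; split=> //; rewrite ?mulr0 ?addr0 //.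
      by exists u.
    * by cstar with vsu.
    * by exists (star v); rewrite starK vv'.
  + by cstar with (v2, vu).
  + by exists (star v * v); rewrite starMr starK; split; cstar with vv.
  + by rewrite eE addrA.
Qed.

Lemma trR_pieces (tau : {scalar A}) (tr : is_tracial_state tau) n s t :
  projection s -> pieces n s t -> trR tau t <= n%:R * trR tau s.
Proof.
move=> ps; elim: n t => [|n IH] t /=; first by move=> ->; rewrite trR0 mul0r.
move=> [p [t' [pp pt' _ sp ->]]].
have := IH _ pt'; have := trR_subequiv tr pp ps sp.
by rewrite trRD -natr1; lra.
Qed.

Lemma compare (compA : strict_comparison_of_projections A) p q : projection p -> projection q ->
  (forall tau, is_tracial_state tau -> trR tau p < trR tau q) -> subequiv p q.
Proof.
move=> pp pq H; have [_ /(_ p q pp pq) []] := compA.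
  move=> tau tr; rewrite (trace_selfadjoint_real tr (proj1 pp)).
  by rewrite (trace_selfadjoint_real tr (proj1 pq)) ltcR; exact: H.
move=> r [[pr rq qr] _ [v [vp vr]]].
have vp' := partial_isometry_src pp vp.
have rv : r * v = v by rewrite -vr -mulrA vp.
by exists v; split=> //; rewrite -rv mulrA qr.
Qed.

(** The first n copies use up n T(e) of the trace of [g], so what is left of [g] still exceeds [e]
    in every trace. *)
Lemma fit (compA : strict_comparison_of_projections A) (n : nat) e g :
  projection e -> projection g ->
  (forall tau, is_tracial_state tau -> n%:R * trR tau e < trR tau g) ->
  exists s : nat -> A, (forall i, (i < n)%N -> g * s i = s i) /\
    forall i j, (i < n)%N -> (j < n)%N -> star (s i) * s j = if i == j then e else 0.
Proof.
move=> pe pg; elim: n => [|n IH] H; first by exists (fun=> 0).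
have [|s [gs ss]] := IH.
  move=> tau tr; have := H tau tr; have := trR_projection_ge0 tr pe.
  by rewrite -natr1; lra.
have [es eE] := pe; have [gg gE] := pg.
pose q := \sum_(i < n) s i * star (s i).
have qs : star q = q.
  rewrite /q; elim/big_rec: _ => [|i x _ h]; first by rewrite star0.
  by rewrite starD h; cstar.
have se i : (i < n)%N -> s i * e = s i.
  by move=> hi; apply: partial_isometry_src => //; rewrite ss // eqxx.
have sq i : (i < n)%N -> q * s i = s i.
  move=> hi; rewrite /q mulr_suml (bigD1 (Ordinal hi)) //= -mulrA ss // eqxx se // big1 ?addr0 //.
  move=> j /eqP ji; rewrite -mulrA ss //; case: eqP => [h|]; last by rewrite mulr0.
  by case: ji; apply: val_inj.
have pq : projection q.
  split=> //; rewrite {2}/q mulr_sumr /q; apply: eq_bigr => i _.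
  by rewrite mulrA sq.
have gq : g * q = q.
  by rewrite /q mulr_sumr; apply: eq_bigr => i _; rewrite mulrA gs.
have [|w [we gw]] := compare compA pe (projectionB pq pg gq).
  move=> tau tr; rewrite trRB /q trR_sum (eq_bigr (fun=> trR tau e)).
    rewrite sumr_const card_ord; have := H tau tr.
    by rewrite -natr1 -mulr_natl; lra.
  by move=> i _; rewrite trRC // ss // eqxx.
have gw' : g * w = w by rewrite -gw; cstar with (gE, gq).
have qw : q * w = 0.
  have qg := projection_le_comm pq pg gq; case: pq => _ qE.
  by rewrite -gw; cstar with (qg, qE).
have sw i : (i < n)%N -> star (s i) * w = 0.
  by move=> hi; rewrite -(sq i hi) starMr qs -mulrA qw mulr0.
have ws i : (i < n)%N -> star w * s i = 0.
  by move=> hi; rewrite -[RHS]star0 -(sw i hi); cstar.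
exists (fun i => if (i < n)%N then s i else w); split.
  by move=> i _; case: ifP => // hi; exact: gs.
move=> i j; rewrite !ltnS => hi hj; case: (ltnP i n) => h1; case: (ltnP j n) => h2.
- exact: ss.
- by rewrite sw //; case: eqP => // ij; move: h1; rewrite ij ltnNge h2.
- by rewrite ws //; case: eqP => // ij; move: h2; rewrite -ij ltnNge h1.
- have -> : i = j by apply/eqP; rewrite eqn_leq (leq_trans hi h2) (leq_trans hj h1).
  by rewrite eqxx.
Qed.

End Fitting.


(** * Spreading a trace-zero element over many copies *)

Section Spread.
Context {R : realType} {A : unitalCStarAlgType R}.
Implicit Types (x y z h k m e p q t u v w c : A).

(** The first column of a system of matrix units: the units themselves are [s i * star (s j)]. *)
Definition copies (n : nat) (e : A) (s : nat -> A) := forall i j, (i < n)%N -> (j < n)%N ->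
  star (s i) * s j = if i == j then e else 0.

Lemma copies_src n e s i : projection e -> copies n e s -> (i < n)%N -> s i * e = s i.
Proof. by move=> pe ss hi; apply: partial_isometry_src => //; rewrite ss // eqxx. Qed.

Definition diag (n : nat) (s x : nat -> A) : A := \sum_(i < n) s i * x i * star (s i).

Lemma star_sum (I : Type) (l : seq I) (P : pred I) (F : I -> A) :
  star (\sum_(i <- l | P i) F i) = \sum_(i <- l | P i) star (F i).
Proof. by elim/big_rec2: _ => [|i x y _ <-]; rewrite ?star0 ?starD. Qed.

Lemma star_diag n (s x : nat -> A) : star (diag n s x) = diag n s (fun i => star (x i)).
Proof. by rewrite /diag star_sum; apply: eq_bigr => i _; cstar. Qed.

Section Copies.
Variables (n : nat) (e : A) (s : nat -> A).
Hypotheses (pe : projection e) (ss : copies n e s).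

Lemma diag_col (x : nat -> A) i : (i < n)%N -> x i * e = x i -> diag n s x * s i = s i * x i.
Proof.
move=> hi xe; rewrite /diag mulr_suml (bigD1 (Ordinal hi)) //= big1 ?addr0.
  by rewrite -!mulrA ss // eqxx xe.
move=> j /eqP ji; rewrite -mulrA ss //; case: eqP => [h|]; last by rewrite mulr0.
by case: ji; apply: val_inj.
Qed.

Lemma diag_entry (x : nat -> A) i : (i < n)%N -> e * x i = x i -> x i * e = x i ->
  star (s i) * diag n s x * s i = x i.
Proof. by move=> hi ex xe; rewrite -mulrA diag_col // mulrA ss // eqxx. Qed.

Lemma diagM (x y : nat -> A) : (forall i, (i < n)%N -> x i * e = x i) ->
  diag n s x * diag n s y = diag n s (fun i => x i * y i).
Proof.
move=> xe; rewrite {2}/diag mulr_sumr; apply: eq_bigr => i _.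
by rewrite !mulrA diag_col ?xe.
Qed.

Lemma diag_projection (x : nat -> A) : (forall i, (i < n)%N -> projection (x i) /\ e * x i = x i) ->
  projection (diag n s x).
Proof.
move=> px; split.
  rewrite /selfadjoint star_diag; apply: eq_bigr => i _.
  by have [[xs _] _] := px i (ltn_ord i); rewrite xs.
rewrite diagM; last by move=> i hi; have [pi ei] := px i hi; apply: projection_le_comm.
by apply: eq_bigr => i _; have [[_ ->] _] := px i (ltn_ord i).
Qed.

Lemma trR_diag (tau : {scalar A}) (tr : is_tracial_state tau) (x : nat -> A) :
  (forall i, (i < n)%N -> x i * e = x i) ->
  trR tau (diag n s x) = \sum_(i < n) trR tau (x i).
Proof.
move=> xe; rewrite /diag trR_sum; apply: eq_bigr => i _.
by rewrite trRC // mulrA ss // eqxx trRC // xe.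
Qed.

End Copies.

(* [p] contains a copy of [q]; by strict comparison what is left of [p] moves below [g]. *)
Lemma exchange (compA : strict_comparison_of_projections A) p q g :
  projection p -> projection q -> projection g -> q * g = 0 ->
  (forall tau, is_tracial_state tau -> trR tau q < trR tau p) ->
  (forall tau, is_tracial_state tau -> trR tau p - trR tau q < trR tau g) ->
  exists v f, [/\ star v * v = p, v * star v = q + f, projection f & g * f = f].
Proof.
move=> pp pq pg qg0 lt1 lt2.
have [v1 [v1q pv1]] := compare compA pq pp lt1.
have gq0 := projection_orthC pq pg qg0.
have v1q' := partial_isometry_src pq v1q.
have pr := partial_isometry_range pq v1q.
have pv1' : p * (v1 * star v1) = v1 * star v1 by rewrite mulrA pv1.
have px := projectionB pr pp pv1'.
have [|w [wx gw]] := compare compA px pg.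
  by move=> tau tr; rewrite trRB (trRC tr) v1q; exact: lt2.
have wx' := partial_isometry_src px wx.
have [[ps pE] [qs qE]] := (pp, pq); have [gs gE] := pg.
have v1p : star v1 * p = star v1 by rewrite -[in RHS]pv1; cstar with ps.
have v1x : star v1 * (p - v1 * star v1) = 0.
  by rewrite -v1q' in v1q *; rewrite -v1q'; cstar with (v1p, v1q, qs, qE, v1q').
have v1w : v1 * w = 0.
  by rewrite -v1q' -gw -!mulrA (mulrA q) qg0 mul0r mulr0.
have wv1 : w * v1 = 0.
  rewrite -wx' -mulrA (_ : (p - _) * v1 = 0) ?mulr0 //.
  by cstar with (pv1, v1q, v1q').
have sv1w : star v1 * star w = 0 by rewrite -starMr wv1 star0.
have swv1 : star w * star v1 = 0 by rewrite -starMr v1w star0.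
(* [star v1] takes the copy of [q] inside [p] back to [q]; [w] takes the rest of [p] below [g]. *)
exists (star v1 + w), (w * star w); split.
- rewrite (_ : _ * _ = v1 * star v1 + star w * w); last by cstar with (v1w, swv1).
  by rewrite wx; cstar.
- rewrite (_ : _ * star _ = star v1 * v1 + w * star w); last by cstar with (wv1, sv1w).
  by rewrite v1q.
- exact: partial_isometry_range wx.
- by rewrite mulrA gw.
Qed.

End Spread.


Section Spread.
Context {R : realType} {A : unitalCStarAlgType R}.
Implicit Types (x y z h k m e p q t u v w c d : A).

Lemma big_ord_add (V : zmodType) (m n : nat) (F : nat -> V) :
  \sum_(i < m + n) F i = \sum_(i < m) F i + \sum_(j < n) F (m + j)%N.
Proof. exact: big_split_ord. Qed.

(* Up to an error 2, [d] is a sum of [K] differences [P i - (e - P i)]. The two terms of the i-th one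
   are put into the i-th copy of [e], and 3 + 6 copies of [e] are added so that [exchange] applies;
   [v] is the partial isometry it gives, and each of the 9 extra copies costs an error 1. *)
Lemma spread_selfadjoint (compA : strict_comparison_of_projections A) (rr0 : real_rank_zero A)
  (simpleA : simple_cstar A) e (s : nat -> A) (K : nat) d :
  projection e -> e != 0 -> copies (K + 9) e s -> star d = d -> e * d = d ->
  (forall tau, is_tracial_state tau -> trR tau d = 0) -> nrm d <= K%:R ->
  exists v, [/\ diag (K + 9) s (fun=> e) * v = v, v * diag (K + 9) s (fun=> e) = v, nrm v <= 1 &
    nrm (d - \sum_(i < K + 9) star (s i) * (star v * v - v * star v) * s i) <= 11].
Proof.
move=> pe e0 ss ds ed dt dK; have [es eE] := pe.
have [P [hP dP]] := symmetries_approx rr0 pe ds ed dK.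
(* The trace of the sum of the differences [P i - (e - P i)] is at most 2 T(e) in absolute value, as
   [d] has trace zero. Three extra copies of [e] in [p] put T(p) - T(q) between T(e) and 5 T(e):
   positive, and below the trace of the six copies in [g], as [exchange] demands. *)
pose xP i := if (i < K)%N then P i else if (i < K + 3)%N then e else 0.
pose xQ i := if (i < K)%N then e - P i else 0.
pose xG i := if (i < K + 3)%N then 0 else e.
have hPe i : P i * e = P i by have [pPi ePi] := hP i; apply: projection_le_comm.
have qP i : projection (xP i) /\ e * xP i = xP i.
  rewrite /xP; do 2?case: ifP => _; first exact: hP; split=> //; rewrite ?mulr0 //.
  exact: projection0.
have qQ i : projection (xQ i) /\ e * xQ i = xQ i.
  rewrite /xQ; case: ifP => _; last by rewrite mulr0; split; first exact: projection0.
  have [pPi ePi] := hP i; split; last by cstar with (eE, ePi).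
  exact: projectionB.
have qG i : projection (xG i) /\ e * xG i = xG i.
  rewrite /xG; case: ifP => _; split=> //; rewrite ?mulr0 //; exact: projection0.
have eP i : xP i * e = xP i by have [? ?] := qP i; apply: projection_le_comm.
have eQ i : xQ i * e = xQ i by have [? ?] := qQ i; apply: projection_le_comm.
have eG i : xG i * e = xG i by have [? ?] := qG i; apply: projection_le_comm.
pose N := (K + 9)%N; pose p := diag N s xP; pose q := diag N s xQ; pose g := diag N s xG.
have pp : projection p by apply: (diag_projection pe ss) => i _; exact: qP.
have pq : projection q by apply: (diag_projection pe ss) => i _; exact: qQ.
have pg : projection g by apply: (diag_projection pe ss) => i _; exact: qG.
have qg0 : q * g = 0.
  rewrite /q /g (diagM ss _ (fun i _ => eQ i)) /diag big1 // => i _.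
  rewrite /xQ /xG; case: ifP => h; last by rewrite mul0r mulr0 mul0r.
  by rewrite (ltn_addr 3 h) !mulr0 mul0r.
have tail (F : A -> R) : F 0 = 0 -> [/\ \sum_(j < 9) F (xP (K + j)%N) = 3 * F e,
    \sum_(j < 9) F (xQ (K + j)%N) = 0 & \sum_(j < 9) F (xG (K + j)%N) = 6 * F e].
  move=> F0; split.
  - rewrite (eq_bigr (fun j : 'I_9 => F (if (j < 3)%N then e else 0))).
      by rewrite !big_ord_recl big_ord0 /= F0; ring.
    by move=> j _; rewrite /xP ltnNge leq_addr /= ltn_add2l.
  - by rewrite big1 // => j _; rewrite /xQ ltnNge leq_addr.
  - rewrite (eq_bigr (fun j : 'I_9 => F (if (j < 3)%N then 0 else e))).
      by rewrite !big_ord_recl big_ord0 /= F0; ring.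
    by move=> j _; rewrite /xG ltn_add2l.
have traces tau : is_tracial_state tau -> [/\ 0 < trR tau e,
    trR tau p - trR tau q <= 5 * trR tau e, trR tau e <= trR tau p - trR tau q
    & trR tau g = 6 * trR tau e].
  move=> tr; have [t1 t2 t3] := tail _ (trR0 tau).
  have Te := trR_projection_gt0 tr simpleA pe e0.
  have hpq : trR tau p - trR tau q = 3 * trR tau e + trR tau (\sum_(i < K) (P i - (e - P i))).
    rewrite /p /q (trR_diag ss tr (fun i _ => eP i)) (trR_diag ss tr (fun i _ => eQ i)) /N.
    rewrite (big_ord_add K 9 (fun i => trR tau (xP i))) (big_ord_add K 9 (fun i => trR tau (xQ i))).
    rewrite t1 t2 addr0 trR_sum.
    rewrite addrAC -sumrB [RHS]addrC; congr (_ + _).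
    by apply: eq_bigr => j _; rewrite /xP /xQ ltn_ord -trRB.
  have hg : trR tau g = 6 * trR tau e.
    rewrite /g (trR_diag ss tr (fun i _ => eG i)) /N (big_ord_add K 9 (fun i => trR tau (xG i))) t3.
    by rewrite big1 ?add0r // => j _; rewrite /xG ltn_addr // trR0.
  have de : d * e = d by rewrite -[RHS]ds -[in RHS]ed; cstar with (ds, es).
  have : `|trR tau (d - \sum_(i < K) (P i - (e - P i)))| <= 2 * trR tau e.
    apply: (trR_norm_le tr pe) => //.
    rewrite mulrBr mulrBl ed de mulr_sumr mulr_suml; congr (_ - _).
    by apply: eq_bigr => j _; have [_ ePj] := hP j; have hPj := hPe j; cstar with (eE, ePj, hPj).
  rewrite trRB (dt _ tr) sub0r normrN ler_norml => /andP[h1 h2].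
  by split=> //; rewrite hpq; lra.
have [||v [f [vp vq pf gf]]] := exchange compA pp pq pg qg0.
- by move=> tau /traces[h1 _ h2 _]; lra.
- by move=> tau /traces[h1 h2 _ h3]; lra.
have vp' := partial_isometry_src pp vp.
pose H := diag N s (fun=> e).
have He (x : nat -> A) : (forall i, e * x i = x i) -> H * diag N s x = diag N s x.
  by move=> ex; rewrite /H (diagM ss _ (fun i _ => eE)); apply: eq_bigr => i _; rewrite ex.
have Hs : star H = H by rewrite /H star_diag es.
have Hp : H * p = p by apply: He => i; case: (qP i).
have Hq : H * q = q by apply: He => i; case: (qQ i).
have Hg : H * g = g by apply: He => i; case: (qG i).
have pH : p * H = p by case: pp => ps _; rewrite -[RHS]ps -[in RHS]Hp; cstar with (ps, Hs).
have v1 : nrm v <= 1.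
  by apply: nrm_le_of_sqr => //; rewrite vp expr1n; exact: nrm_projection.
exists v; split=> //.
- have vE : v = (q + f) * v by rewrite -vq -mulrA vp vp'.
  have Hf : H * f = f by rewrite -gf mulrA Hg.
  by rewrite -/N -/H vE mulrA mulrDr Hq Hf.
- by rewrite -vp' -mulrA -/N -/H pH.
have gs i : (i < N)%N -> star (s i) * g = xG i * star (s i).
  move=> hi; have := diag_col ss hi (eG i); rewrite -/g => /(congr1 star).
  by rewrite !starMr; case: pg => -> _; have [[-> _] _] := qG i.
(* The unwanted projection [f] lies under [g], so its diagonal entries vanish on the first K + 3
   copies. *)
have fE : f = g * f * g.
  by rewrite gf; have := projection_le_comm pf pg gf => ->.
have entry i : (i < N)%N -> star (s i) * (star v * v - v * star v) * s i =
    xP i - xQ i - xG i * (star (s i) * f * s i) * xG i.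
  move=> hi; rewrite vp vq.
  have e1 : star (s i) * p * s i = xP i by apply: (diag_entry ss) => //; case: (qP i).
  have e2 : star (s i) * q * s i = xQ i by apply: (diag_entry ss) => //; case: (qQ i).
  have e3 : star (s i) * f * s i = xG i * (star (s i) * f * s i) * xG i.
    have gsi := gs i hi; have sg : g * s i = s i * xG i by apply: (diag_col ss).
    rewrite {1}fE; cstar with (gsi, sg).
  by rewrite -e3; cstar with (e1, e2).
have xGK i : (i < K)%N -> xG i = 0 by move=> hi; rewrite /xG ltn_addr.
rewrite -/N (eq_bigr (fun i : 'I_N => xP i - xQ i - xG i * (star (s i) * f * s i) * xG i)); last first.
  by move=> i _; exact: entry.
rewrite /N (big_ord_add K 9 (fun i => xP i - xQ i - xG i * (star (s i) * f * s i) * xG i)).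
rewrite opprD addrA.
rewrite (eq_bigr (fun i : 'I_K => P i - (e - P i))); last first.
  by move=> i _; rewrite (xGK i) // !mul0r subr0 /xP /xQ ltn_ord.
apply: le_trans (nrmB _ _) _; rewrite (_ : 11 = 2 + 9) //; last by ring.
apply: lerD => //; apply: le_trans (nrm_sum _ _ _) _.
apply: le_trans (_ : \sum_(j < 9) (1 : R) <= _); last by rewrite sumr_const card_ord.
apply: ler_sum => j _.
have hj : (K + j < N)%N by rewrite ltn_add2l.
have -> : xQ (K + j)%N = 0 by rewrite /xQ ltnNge leq_addr.
rewrite /xP /xG (ltnNge (K + j) K) leq_addr /= ltn_add2l subr0; case: ifP => _.
  by rewrite !mul0r subr0; exact: nrm_projection.
rewrite sub0r nrmN; have ne := nrm_projection pe.
have ns : nrm (s (K + j)%N) <= 1.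
  by apply: nrm_le_of_sqr => //; rewrite ss // eqxx expr1n.
have nss : nrm (star (s (K + j)%N)) <= 1 by rewrite nrm_star.
have := nrmM_le (nrmM_le ne (nrmM_le (nrmM_le nss (nrm_projection pf)) ns)) ne.
by rewrite !mul1r.
Qed.

End Spread.


(** * Trace-zero elements as approximate diagonal sums of one commutator *)

Section Stage.
Context {R : realType} {A : unitalCStarAlgType R}.
Implicit Types (x y z h k m e q t u v c d : A).

Lemma scale_comm (r l : R[i]) x : r *: (l *: x) = l *: (r *: x).
Proof. by rewrite !scalerA mulrC. Qed.

Lemma scale_ii x : 'i *: ('i *: x) = - x.
Proof. by rewrite scalerA -expr2 sqr_i scaleN1r. Qed.

Lemma copies_sub (m n l : nat) e (s : nat -> A) : copies n e s -> (l + m <= n)%N ->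
  copies m e (fun i => s (l + i)%N).
Proof.
move=> ss h i j hi hj; rewrite ss ?eqn_add2l // (leq_trans _ h) //.
  by rewrite ltn_add2l.
by rewrite ltn_add2l.
Qed.

Definition range_sum (n : nat) (s : nat -> A) : A := \sum_(i < n) s i * star (s i).

Lemma diag_range n e (s : nat -> A) : projection e -> copies n e s ->
  diag n s (fun=> e) = range_sum n s.
Proof. by move=> pe ss; apply: eq_bigr => i _; rewrite (copies_src pe ss). Qed.

Lemma star_range n (s : nat -> A) : star (range_sum n s) = range_sum n s.
Proof. by rewrite /range_sum star_sum; apply: eq_bigr => i _; cstar. Qed.

Lemma range_col n e (s : nat -> A) i : projection e -> copies n e s -> (i < n)%N ->
  range_sum n s * s i = s i.
Proof.
move=> pe ss hi; rewrite -(diag_range pe ss) (diag_col ss hi) ?(copies_src pe ss) //.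
by case: pe.
Qed.

Lemma range_col0 n (s : nat -> A) x : (forall i, (i < n)%N -> star (s i) * x = 0) ->
  range_sum n s * x = 0.
Proof. by move=> h; rewrite /range_sum mulr_suml big1 // => i _; rewrite -mulrA h ?mulr0. Qed.

Lemma range_row0 n (s : nat -> A) x : (forall i, (i < n)%N -> x * s i = 0) ->
  x * range_sum n s = 0.
Proof. by move=> h; rewrite /range_sum mulr_sumr big1 // => i _; rewrite mulrA h ?mul0r. Qed.

Lemma range_projection n e (s : nat -> A) : projection e -> copies n e s -> projection (range_sum n s).
Proof.
move=> pe ss; rewrite -(diag_range pe ss).
by apply: (diag_projection pe ss) => i _; split; case: pe.
Qed.

(** The real and imaginary parts of [d] are scaled to norm at most [K] and spread over two disjoint
    families of K + 9 copies. The families are orthogonal, so one commutator handles both. Scaling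
    back turns each error 11 into 11 |d|/K. *)
Lemma spread (compA : strict_comparison_of_projections A) (rr0 : real_rank_zero A)
  (simpleA : simple_cstar A) e (s : nat -> A) (K : nat) d : let m := ((K + 9) + (K + 9))%N in
  (0 < K)%N -> projection e -> e != 0 -> copies m e s -> e * d * e = d ->
  (forall tau, is_tracial_state tau -> tau d = 0) ->
  exists y z, [/\ range_sum m s * y = y /\ y * range_sum m s = y,
    range_sum m s * z = z /\ z * range_sum m s = z, nrm y <= 2 * nrm d, nrm z <= 2 &
    nrm (d - \sum_(i < m) star (s i) * (y * z - z * y) * s i) <= 22 / K%:R * nrm d].
Proof.
move=> m K0 pe e0 ss ede td; have [es eE] := pe.
have KR : 0 < K%:R :> R by rewrite ltr0n.
pose n := (K + 9)%N; pose s2 i := s (n + i)%N.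
have ss1 : copies n e s by apply: (@copies_sub n m 0 e s ss); rewrite leq_addr.
have ss2 : copies n e s2 by apply: (@copies_sub n m n e s ss).
(* If [d] is 0, then [c] and [c'] are both 0 by the convention for inverses, which is harmless since
   there is nothing to scale. *)
pose a : R := 2^-1; pose al := nrm d; pose c := al / K%:R; pose c' := K%:R / al.
have al0 : 0 <= al by exact: nrm_ge0.
have c0 : 0 <= c by rewrite divr_ge0 // ltW.
have c'0 : 0 <= c' by rewrite divr_ge0 // ltW.
have cc' x : nrm x <= al -> c%:C *: (c'%:C *: x) = x.
  move=> xal; rewrite scaleCA; have [z0|n0] := eqVneq al 0.
    have -> : x = 0 by apply: nrm_eq0; apply/le_anti; rewrite nrm_ge0 -z0 xal.
    by rewrite scaler0.
  rewrite (_ : c * c' = 1) ?scaleC1 // /c /c'.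
  by field; rewrite n0 lt0r_neq0.
have c'K x : nrm x <= al -> nrm (c'%:C *: x) <= K%:R.
  move=> xal; apply: le_trans (nrmZ_le c'0 xal) _; rewrite /c'.
  have [z0|n0] := eqVneq al 0; first by rewrite z0 mulr0 ltW.
  by rewrite divfK.
have ed : e * d = d by rewrite -ede; cstar with eE.
have eds : e * star d = star d by rewrite -ede; cstar with (es, eE).
pose d1 := a%:C *: (d + star d); pose d2 := - (a%:C *: ('i *: (d - star d))).
have d1s : star d1 = d1 by rewrite /d1; cstar.
have d2s : star d2 = d2.
  rewrite /d2 starN starZr star_i starD starN starK scalerN opprK -scalerN -scalerN opprB.
  by [].
have d1al : nrm d1 <= al.
  have := nrmD d (star d); rewrite nrm_star -/al => h.
  by rewrite nrmZ ger0_norm ?invr_ge0 // /a; lra.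
have d2al : nrm d2 <= al.
  have := nrmB d (star d); rewrite nrm_star -/al => h.
  by rewrite nrmN nrmZ nrmZi ger0_norm ?invr_ge0 // /a; lra.
have dE : d = d1 + 'i *: d2.
  rewrite /d1 /d2 scalerN [X in - X]scale_comm scale_ii scalerN opprK -scalerDr (_ : d + star d + (d - star d) = d + d); last by cstar.
  by rewrite scale_half.
have ed1 : e * d1 = d1 by rewrite /d1; cstar with (ed, eds).
have ed2 : e * d2 = d2 by rewrite /d2 mulrN -!scalerAr mulrBr ed eds.
have tds tau : is_tracial_state tau -> tau (star d) = 0.
  by move=> tr; rewrite (trace_star tr) td // conjC0.
have q1 : star (c'%:C *: d1) = c'%:C *: d1 by rewrite starZr d1s.
have q2 : star (c'%:C *: d2) = c'%:C *: d2 by rewrite starZr d2s.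
have q3 : e * (c'%:C *: d1) = c'%:C *: d1 by rewrite -scalerAr ed1.
have q4 : e * (c'%:C *: d2) = c'%:C *: d2 by rewrite -scalerAr ed2.
have q5 tau : is_tracial_state tau -> trR tau (c'%:C *: d1) = 0.
  by move=> tr; rewrite trRZ trRZ trRD (trR_star tr) /trR td // addr0 !mulr0.
have q6 tau : is_tracial_state tau -> trR tau (c'%:C *: d2) = 0.
  move=> tr; rewrite trRZ trRN trRZ trRi linearB /= (td _ tr) (tds _ tr) subr0.
  by rewrite oppr0 mulr0 oppr0 mulr0.
have [v1 [H1v vH1 n1 h1]] := spread_selfadjoint compA rr0 simpleA pe e0 ss1 q1 q3 q5 (c'K _ d1al).
have [v2 [H2v vH2 n2 h2]] := spread_selfadjoint compA rr0 simpleA pe e0 ss2 q2 q4 q6 (c'K _ d2al).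
rewrite (diag_range pe ss1) in H1v vH1; rewrite (diag_range pe ss2) in H2v vH2.
set H1 := range_sum n s in H1v vH1; set H2 := range_sum n s2 in H2v vH2.
have HE : range_sum m s = H1 + H2 by apply: (big_ord_add n n (fun i => s i * star (s i))).
have H1s : star H1 = H1 by exact: star_range.
have H2s : star H2 = H2 by exact: star_range.
have s12 i j : (i < n)%N -> (j < n)%N -> star (s i) * s2 j = 0.
  move=> hi hj; rewrite ss ?ltn_add2l // ?(ltn_addr n hi) //.
  by case: eqP => // ij; move: hi; rewrite ij ltnNge leq_addr.
have H1s2 j : (j < n)%N -> H1 * s2 j = 0 by move=> hj; apply: range_col0 => i hi; exact: s12.
have H2s1 j : (j < n)%N -> H2 * s j = 0.
  move=> hj; apply: range_col0 => i hi; rewrite -[RHS]star0 -(s12 j i hj hi); cstar.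
have H12 : H1 * H2 = 0 by apply: range_row0.
have H21 : H2 * H1 = 0 by apply: range_row0.
(* The scalar makes the commutator of [j] and [v2] contribute to the imaginary part. *)
pose j := 'i *: star v2.
have v12 : v1 * v2 = 0 by rewrite -vH1 -H2v mulrA -(mulrA v1) H12 mulr0 mul0r.
have v21 : v2 * v1 = 0 by rewrite -vH2 -H1v mulrA -(mulrA v2) H21 mulr0 mul0r.
have sv1H1 : star v1 * H1 = star v1 by rewrite -[in RHS]H1v; cstar with H1s.
have H1sv1 : H1 * star v1 = star v1 by rewrite -[in RHS]vH1; cstar with H1s.
have sv2H2 : star v2 * H2 = star v2 by rewrite -[in RHS]H2v; cstar with H2s.
have H2sv2 : H2 * star v2 = star v2 by rewrite -[in RHS]vH2; cstar with H2s.
have v1s2 : v1 * star v2 = 0 by rewrite -vH1 -H2sv2 mulrA -(mulrA v1) H12 mulr0 mul0r.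
have s1v2 : star v1 * v2 = 0 by rewrite -sv1H1 -H2v mulrA -(mulrA (star v1)) H12 mulr0 mul0r.
have v2s1 : v2 * star v1 = 0 by rewrite -[RHS]star0 -v1s2; cstar.
have s2v1 : star v2 * v1 = 0 by rewrite -[RHS]star0 -s1v2; cstar.
have H2v1 : H2 * v1 = 0 by rewrite -H1v mulrA H21 mul0r.
have v1H2 : v1 * H2 = 0 by rewrite -vH1 -mulrA H12 mulr0.
have H1v2 : H1 * v2 = 0 by rewrite -H2v mulrA H12 mul0r.
have v2H1 : v2 * H1 = 0 by rewrite -vH2 -mulrA H21 mulr0.
have sv1H2 : star v1 * H2 = 0 by rewrite -sv1H1 -mulrA H12 mulr0.
have H2sv1 : H2 * star v1 = 0 by rewrite -H1sv1 mulrA H21 mul0r.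
have jH2 : j * H2 = j by rewrite -scalerAl sv2H2.
have H2j : H2 * j = j by rewrite -scalerAr H2sv2.
have jH1 : j * H1 = 0 by rewrite -jH2 -mulrA H21 mulr0.
have H1j : H1 * j = 0 by rewrite -H2j mulrA H12 mul0r.
have jv1 : j * v1 = 0 by rewrite -scalerAl s2v1 scaler0.
have v1j : v1 * j = 0 by rewrite -scalerAr v1s2 scaler0.
pose y := c%:C *: (star v1 + j); pose z := v1 + v2.
have yzE : y * z - z * y = c%:C *: (star v1 * v1 - v1 * star v1) + c%:C *: (j * v2 - v2 * j).
  by rewrite /y /z; cstar with (jv1, v1j, v2s1, s1v2).
have jvE : j * v2 - v2 * j = 'i *: (star v2 * v2 - v2 * star v2).
  by rewrite -scalerAl -scalerAr scalerBr.
exists y, z; split.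
- by rewrite HE /y; split; cstar with (H1sv1, sv1H1, H2sv1, sv1H2, jH1, H1j, jH2, H2j).
- by rewrite HE /z; split; cstar with (H1v, vH1, H2v1, v1H2, H1v2, v2H1, H2v, vH2).
- have cal : c <= al by rewrite ler_pdivrMr // ler_peMr // ler1n.
  rewrite nrmZ ger0_norm // mulrC; apply: ler_pM => //; first exact: nrm_ge0.
  by have := nrmD (star v1) j; rewrite nrmZi !nrm_star; lra.
- by have := nrmD v1 v2; rewrite /z; lra.
set S1 := \sum_(i < _) _ in h1; set S2 := \sum_(i < _) _ in h2.
have -> : \sum_(i < m) star (s i) * (y * z - z * y) * s i = c%:C *: S1 + 'i *: (c%:C *: S2).
  rewrite (big_ord_add n n (fun i => star (s i) * (y * z - z * y) * s i)) yzE.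
  congr (_ + _).
    rewrite scaler_sumr; apply: eq_bigr => -[i hi] _ /=.
    have h : v2 * s i = 0 by rewrite -vH2 -mulrA H2s1 ?mulr0.
    have h' : j * s i = 0 by rewrite -jH2 -mulrA H2s1 ?mulr0.
    by cstar with (h, h').
  rewrite !scaler_sumr; apply: eq_bigr => -[i hi] _ /=; rewrite -/(s2 i).
  have h : v1 * s2 i = 0 by rewrite -vH1 -mulrA H1s2 ?mulr0.
  have h' : star v1 * s2 i = 0 by rewrite -sv1H1 -mulrA H1s2 ?mulr0.
  rewrite [LHS](_ : _ = c%:C *: (star (s2 i) * (j * v2 - v2 * j) * s2 i)); last by cstar with (h, h').
  by rewrite jvE -scalerAr -scalerAl !scalerA mulrC.
have -> : d - (c%:C *: S1 + 'i *: (c%:C *: S2)) =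
   c%:C *: (c'%:C *: d1 - S1) + 'i *: (c%:C *: (c'%:C *: d2 - S2)).
  by rewrite {1}dE -{1}(cc' d1 d1al) -{1}(cc' d2 d2al) !scalerBr opprD addrACA.
apply: le_trans (nrmD _ _) _; rewrite nrmZi.
have := nrmZ_le c0 h1; have := nrmZ_le c0 h2.
rewrite (_ : 22 / K%:R * nrm d = 22 * c); last by rewrite /c mulrAC mulrA.
lra.
Qed.

End Stage.


(** * One reduction step, from the corner of [e] to that of [e'] *)

Section Stage.
Context {R : realType} {A : unitalCStarAlgType R}.
Implicit Types (x y z h k m e q t u v c d : A).

(** The copy 0 of [e] is cut into three blocks by the cover; the shift by 2 makes index 3 the copy
    1. *)
Definition block (p s : nat -> A) (i : nat) : A :=
  if (i < 3)%N then s 0%N * p i * star (s 0%N) else s (i - 2)%N * star (s (i - 2)%N).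

(** The data of [pieces n e' e] as families indexed by natural numbers. *)
Definition cover (n : nat) e e' (p w : nat -> A) :=
  [/\ forall j, (j < n)%N -> [/\ projection (p j), star (w j) * w j = p j & e' * w j = w j],
      forall i j, (i < n)%N -> (j < n)%N -> i != j -> p i * p j = 0 & \sum_(j < n) p j = e].

Lemma nrm_isometry e x : projection e -> star x * x = e -> nrm x <= 1.
Proof.
by move=> pe xe; apply: nrm_le_of_sqr => //; rewrite xe expr1n; exact: nrm_projection.
Qed.

Lemma nrm_sum_le (n : nat) (F : nat -> A) (b : R) :
  (forall i, (i < n)%N -> nrm (F i) <= b) -> nrm (\sum_(i < n) F i) <= n%:R * b.
Proof.
move=> h; apply: le_trans (nrm_sum _ _ _) _; apply: le_trans (_ : \sum_(i < n) b <= _).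
  by apply: ler_sum => i _; exact: h.
by rewrite sumr_const card_ord mulr_natl.
Qed.

Section Cover.
Variables (n : nat) (e e' : A) (p w : nat -> A).
Hypothesis cov : cover n e e' p w.

Lemma cover_src j : (j < n)%N -> w j * p j = w j.
Proof. by move=> hj; case: cov => /(_ j hj)[pj wj _] _ _; apply: partial_isometry_src. Qed.

Lemma cover_row i : (i < n)%N -> (\sum_(j < n) w j) * p i = w i.
Proof.
move=> hi; rewrite mulr_suml (bigD1 (Ordinal hi)) //= cover_src // big1 ?addr0 //.
move=> j /eqP ji; rewrite -cover_src // -mulrA; case: cov => _ -> //; first by rewrite mulr0.
by apply/eqP => ij; apply: ji; apply: val_inj.
Qed.

Lemma cover_le i : (i < n)%N -> e * p i = p i.
Proof.
move=> hi; case: cov => pj po <-; rewrite mulr_suml (bigD1 (Ordinal hi)) //= big1 ?addr0.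
  by have [[_ ->] _ _] := pj i hi.
move=> j /eqP ji; apply: po => //.
by apply/eqP => ij; apply: ji; apply: val_inj.
Qed.

End Cover.

(* A trace-zero [d] in the corner of [e] is replaced, modulo a commutator and an element whose
   diagonal blocks vanish, by a much smaller trace-zero [d'] in the corner of [e']. *)
Lemma stage (compA : strict_comparison_of_projections A) (rr0 : real_rank_zero A)
  (simpleA : simple_cstar A) e e' (s p w : nat -> A) t (K : nat) d :
  let m := ((K + 9) + (K + 9))%N in
  (0 < K)%N -> projection e -> e != 0 -> projection e' -> copies m.+1 e s ->
  star t * t = e' -> (forall i, (i < m.+1)%N -> star t * s i = 0) ->
  cover 3 e e' p w -> e * d * e = d ->
  (forall tau, is_tracial_state tau -> tau d = 0) ->
  exists y z d', [/\ e' * d' * e' = d' /\ (forall tau, is_tracial_state tau -> tau d' = 0),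
    nrm d' <= 66 / K%:R * nrm d, nrm y <= (68 + 8 * m%:R) * nrm d /\ nrm z <= 68 + 8 * m%:R,
    [/\ range_sum m.+1 s * y = y, y * (range_sum m.+1 s + t * star t) = y,
        (range_sum m.+1 s + t * star t) * z = z & z * range_sum m.+1 s = z] &
    let x := s 0%N * d * star (s 0%N) - t * d' * star t - (y * z - z * y) in
    (forall i, (i < 3 + m)%N -> block p s i * x * block p s i = 0) /\ star t * x * t = 0].
Proof.
move=> m K0 pe e0 pe' ss tt ts cov ede td.
have [es eE] := pe.
pose b := s 0%N; pose r i := s (1 + i)%N.
have rs : copies m e r by apply: (@copies_sub _ _ m m.+1 1 e s ss).
have bb : star b * b = e by rewrite ss.
have rr i : (i < m)%N -> star (r i) * r i = e by move=> hi; rewrite rs // eqxx.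
have re i : (i < m)%N -> r i * e = r i by exact: copies_src.
have be : b * e = b by apply: partial_isometry_src.
have te : t * e' = t by apply: partial_isometry_src.
have br i : (i < m)%N -> star b * r i = 0 by move=> hi; rewrite ss.
have rb i : (i < m)%N -> star (r i) * b = 0 by move=> hi; rewrite ss.
have tb : star t * b = 0 by exact: ts.
have bt : star b * t = 0 by rewrite -[RHS]star0 -tb; cstar.
have tr i : (i < m)%N -> star t * r i = 0 by move=> hi; exact: ts.
have rt i : (i < m)%N -> star (r i) * t = 0 by move=> hi; rewrite -[RHS]star0 -(tr i hi); cstar.
have [yH [zH [[Hy yH_] [Hz zH_] ny nz hd]]] := spread compA rr0 simpleA K0 pe e0 rs ede td.
set H := range_sum _ r in Hy yH_ Hz zH_.
have TE : range_sum m.+1 s = b * star b + H by rewrite /range_sum big_ord_recl.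
have Hs : star H = H by exact: star_range.
have Hb : H * b = 0 by apply: range_col0.
have bH : star b * H = 0 by rewrite -[RHS]star0 -Hb; cstar with Hs.
have Ht : H * t = 0 by apply: range_col0.
have tH : star t * H = 0 by rewrite -[RHS]star0 -Ht; cstar with Hs.
have yb : yH * b = 0 by rewrite -yH_ -mulrA Hb mulr0.
have yt : yH * t = 0 by rewrite -yH_ -mulrA Ht mulr0.
have zb : zH * b = 0 by rewrite -zH_ -mulrA Hb mulr0.
have zt : zH * t = 0 by rewrite -zH_ -mulrA Ht mulr0.
have by_ : star b * yH = 0 by rewrite -Hy mulrA bH mul0r.
have bz : star b * zH = 0 by rewrite -Hz mulrA bH mul0r.
have ty : star t * yH = 0 by rewrite -Hy mulrA tH mul0r.
have tz : star t * zH = 0 by rewrite -Hz mulrA tH mul0r.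
set g := yH * zH - zH * yH in hd.
(* The diagonal entries of the commutator [g] from [spread]; their sum [del] approximates [d], with
   difference [d1]. *)
pose dl i := star (r i) * g * r i.
pose del := \sum_(i < m) dl i.
have dle i : (i < m)%N -> dl i * e = dl i by move=> hi; rewrite /dl -mulrA re.
have edl i : (i < m)%N -> e * dl i = dl i.
  by move=> hi; rewrite /dl !mulrA (_ : e * star (r i) = star (r i)) // -{2}re // starMr es.
pose S := \sum_(i < m) r i; pose U := \sum_(i < m) dl i * star (r i).
have bS : star b * S = 0 by rewrite mulr_sumr big1 // => i _; exact: br.
have tS : star t * S = 0 by rewrite mulr_sumr big1 // => i _; exact: tr.
have Ub : U * b = 0 by rewrite mulr_suml big1 // => i _; rewrite -mulrA rb ?mulr0.
have Ut : U * t = 0 by rewrite mulr_suml big1 // => i _; rewrite -mulrA rt ?mulr0.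
have rS i : (i < m)%N -> star (r i) * S = e.
  move=> hi; rewrite mulr_sumr (bigD1 (Ordinal hi)) //= rr // big1 ?addr0 //.
  move=> j /eqP ji; rewrite rs //; case: eqP => // ij.
  by case: ji; apply: val_inj.
have Ur i : (i < m)%N -> U * r i = dl i.
  move=> hi; rewrite mulr_suml (bigD1 (Ordinal hi)) //= -mulrA rr // dle // big1 ?addr0 //.
  move=> j /eqP ji; rewrite -mulrA rs //; case: eqP => // ij; last by rewrite mulr0.
  by case: ji; apply: val_inj.
have US : U * S = del by rewrite mulr_sumr; apply: eq_bigr => i _; rewrite Ur.
have HS : H * S = S by rewrite mulr_sumr; apply: eq_bigr => i _; apply: (range_col pe rs).
have rH i : (i < m)%N -> star (r i) * H = star (r i).
  by move=> hi; have := congr1 star (range_col pe rs hi); rewrite starMr Hs.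
have UH : U * H = U.
  by rewrite mulr_suml; apply: eq_bigr => i _; rewrite -mulrA rH.
have eU : e * U = U.
  by rewrite mulr_sumr; apply: eq_bigr => i _; rewrite mulrA edl.
have edel : e * del = del by rewrite mulr_sumr; apply: eq_bigr => i _; exact: edl.
have dele : del * e = del by rewrite mulr_suml; apply: eq_bigr => i _; exact: dle.
have bbe : e * star b = star b by rewrite -[in RHS]be; cstar with es.
have ed : e * d = d by rewrite -ede; cstar with eE.
have de : d * e = d by rewrite -ede; cstar with eE.
pose d1 := d - del.
pose W := \sum_(j < 3) w j; pose V := \sum_(j < 3) p j * d1 * star (w j).
pose d' := \sum_(j < 3) w j * d1 * star (w j).
have [cov1 cov2 cov3] := cov.
have Wp j : (j < 3)%N -> W * p j = w j by exact: cover_row cov _.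
have wp j : (j < 3)%N -> w j * p j = w j by exact: cover_src cov _.
have ep j : (j < 3)%N -> e * p j = p j by exact: cover_le cov _.
have pw j : (j < 3)%N -> p j * star (w j) = star (w j).
  by move=> hj; have [[ps _] _ _] := cov1 j hj; rewrite -{2}wp // starMr ps.
have pj_e j : (j < 3)%N -> p j * e = p j.
  by move=> hj; apply: projection_le_comm => //; [case: (cov1 j hj) | exact: ep].
have we j : (j < 3)%N -> w j * e = w j by move=> hj; rewrite -wp // -mulrA pj_e.
have e'w j : (j < 3)%N -> e' * w j = w j by move=> hj; case: (cov1 j hj).
have we' j : (j < 3)%N -> star (w j) * e' = star (w j).
  by move=> hj; case: pe' => e's _; rewrite -[in RHS]e'w // starMr e's.
have WV : W * V = d'.
  by rewrite mulr_sumr; apply: eq_bigr => j _; rewrite !mulrA Wp.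
have pV j : (j < 3)%N -> p j * V = p j * d1 * star (w j).
  move=> hj; rewrite mulr_sumr (bigD1 (Ordinal hj)) //= big1 ?addr0.
    by have [[_ pE] _ _] := cov1 j hj; rewrite !mulrA pE.
  move=> i /eqP ij; rewrite !mulrA cov2 ?mul0r //.
  by apply/eqP => ji; apply: ij; apply: val_inj.
have pVWp j : (j < 3)%N -> p j * V * W * p j = p j * d1 * p j.
  by move=> hj; rewrite -mulrA Wp // pV // -mulrA; have [_ -> _] := cov1 j hj.
have e'W : e' * W = W by rewrite mulr_sumr; apply: eq_bigr => j _; exact: e'w.
have We : W * e = W by rewrite mulr_suml; apply: eq_bigr => j _; exact: we.
have eV : e * V = V by rewrite mulr_sumr; apply: eq_bigr => j _; rewrite !mulrA ep.
have Ve' : V * e' = V by rewrite mulr_suml; apply: eq_bigr => j _; rewrite -mulrA we'.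
have e'd' : e' * d' = d' by rewrite -WV mulrA e'W.
have d'e' : d' * e' = d' by rewrite -WV -mulrA Ve'.
(* The pair [b * U], [S * star b] cancels the diagonal entries [dl i] of [g] and turns the element
   [d] at [b] into [d1]. The pair [b * V * star t], [t * W * star b] puts -d' at [t] and V W at [b],
   and V W has the same diagonal blocks as [d1] under the [p j]. *)
pose y := yH + b * U + b * V * star t; pose z := zH + S * star b + t * W * star b.
exists y, z, d'.
have nd1 : nrm d1 <= 22 / K%:R * nrm d by exact: hd.
have nw j : (j < 3)%N -> nrm (w j) <= 1.
  by move=> hj; have [pj wj _] := cov1 j hj; exact: nrm_isometry pj wj.
have np j : (j < 3)%N -> nrm (p j) <= 1 by move=> hj; have [pj _ _] := cov1 j hj; exact: nrm_projection.
have nr i : (i < m)%N -> nrm (r i) <= 1 by move=> hi; exact: nrm_isometry pe (rr i hi).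
have nb : nrm b <= 1 by exact: nrm_isometry pe bb.
have nt : nrm t <= 1 by exact: nrm_isometry pe' tt.
split.
- split; first by rewrite e'd' d'e'.
  (* As the [p j] add up to [e], the trace of d' is that of d - del, and [del] has the trace of the
     commutator [g]. *)
  move=> tau tst; rewrite /d' linear_sum /= (eq_bigr (fun j : 'I_3 => tau (d1 * p j))).
    rewrite -linear_sum /= -mulr_sumr cov3 /d1 mulrBl de dele linearB /= td // sub0r.
    rewrite /del linear_sum /= (eq_bigr (fun i : 'I_m => tau (g * (r i * star (r i))))).
      rewrite -linear_sum /= -mulr_sumr -/(range_sum m r) -/H /g.
      rewrite mulrBl -!mulrA zH_ yH_ linearB /= (tracial_stateC tst yH) subrr oppr0 //.
    move=> i _; rewrite /dl (tracial_stateC tst (star (r i) * g)) mulrA.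
    by rewrite (tracial_stateC tst (r i * star (r i))).
  move=> j _; rewrite (tracial_stateC tst (w j * d1)) mulrA (tracial_stateC tst _ d1).
  by have [_ -> _] := cov1 j (ltn_ord j).
- rewrite (_ : 66 / K%:R * nrm d = 3%:R * (22 / K%:R * nrm d)); last by ring.
  apply: (@nrm_sum_le 3 (fun j => w j * d1 * star (w j))) => j hj.
  have nws : nrm (star (w j)) <= 1 by rewrite nrm_star nw.
  by have := nrmM_le (nrmM_le (nw j hj) nd1) nws; rewrite mul1r mulr1.
- have K1 : 1 <= K%:R :> R by rewrite ler1n.
  have al0 := nrm_ge0 d; have m0 : 0 <= m%:R :> R by exact: ler0n.
  have ng : nrm g <= 8 * nrm d.
    have := nrmB (yH * zH) (zH * yH); have := nrmM_le ny nz; have := nrmM_le nz ny.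
    by rewrite -/g; lra.
  have nU : nrm U <= m%:R * (8 * nrm d).
    apply: (@nrm_sum_le m (fun i => dl i * star (r i))) => i hi.
    have nrs : nrm (star (r i)) <= 1 by rewrite nrm_star nr.
    have := nrmM_le (nrmM_le (nrmM_le nrs ng) (nr i hi)) nrs.
    by rewrite mul1r !mulr1.
  have nd1' : nrm d1 <= 22 * nrm d.
    by apply: le_trans nd1 _; apply: ler_wpM2r => //; rewrite ler_pdivrMr ?ltr0n // ler_peMr.
  have nV : nrm V <= 3%:R * (22 * nrm d).
    apply: (@nrm_sum_le 3 (fun j => p j * d1 * star (w j))) => j hj.
    have nws : nrm (star (w j)) <= 1 by rewrite nrm_star nw.
    by have := nrmM_le (nrmM_le (np j hj) nd1') nws; rewrite mul1r mulr1.
  have nS : nrm S <= m%:R * 1 by apply: (@nrm_sum_le m r).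
  have nW : nrm W <= 3%:R * 1 by apply: (@nrm_sum_le 3 w).
  have nbs : nrm (star b) <= 1 by rewrite nrm_star.
  have nts : nrm (star t) <= 1 by rewrite nrm_star.
  (* For [y] the three summands give 2 + 8m + 66, where 8 comes from [g] and 66 is 3 times 22; for
     [z] the sum 2 + m + 3 stays below the same constant. *)
  split.
    have := nrmD (yH + b * U) (b * V * star t); have := nrmD yH (b * U).
    have := nrmM_le nb nU; have := nrmM_le (nrmM_le nb nV) nts.
    by rewrite -/y; lra.
  have := nrmD (zH + S * star b) (t * W * star b); have := nrmD zH (S * star b).
  have := nrmM_le nS nbs; have := nrmM_le (nrmM_le nt nW) nbs.
  by rewrite -/z; lra.
- rewrite TE; split.
  + by rewrite /y; cstar with (Hy, bb, Hb, by_, bH, eU, eV).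
  + by rewrite /y; cstar with (yH_, yb, yt, Ub, Ut, UH, tt, Ve', tb, tH).
  + by rewrite /z; cstar with (Hz, bz, tz, HS, bS, tS, tt, bt, e'W, Ht).
  + by rewrite /z; cstar with (zH_, zb, bb, bH, bbe).
- have xb : star b * (b * d * star b - t * d' * star t - (y * z - z * y)) * b = d1 - V * W.
    rewrite /y /z /d1.
    cstar with (bb, bt, tb, ed, de, by_, bz, zb, yb, bS, Ut, Ub, tS, tt, US, eU, dele, edel, eV, We, Ve', be).
  have xr i : (i < m)%N ->
      star (r i) * (b * d * star b - t * d' * star t - (y * z - z * y)) * r i = 0.
    move=> hi; have bri := br i hi; have rbi := rb i hi; have tri := tr i hi.
    have rti := rt i hi; have rSi := rS i hi; have Uri := Ur i hi; have edi := edl i hi.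
    rewrite (_ : _ * r i = dl i - star (r i) * g * r i); first by rewrite subrr.
    rewrite /y /z /g.
    cstar with (bri, rbi, tri, rti, rSi, Uri, edi, by_, zb, bb).
  split.
    move=> i him; rewrite /block; case: ifP => hi.
      rewrite -/b (_ : _ * (b * p i * star b) = b * (p i * (star b *
        (b * d * star b - t * d' * star t - (y * z - z * y)) * b) * p i) * star b);
        last by rewrite !mulrA.
      by rewrite xb mulrBr mulrBl (mulrA _ V) pVWp // subrr mulr0 mul0r.
    have i2 : (i - 2)%N = (1 + (i - 3))%N.
      by rewrite add1n -subSn ?subSS // leqNgt hi.
    rewrite i2 -/(r _); set r' := r _.
    rewrite (_ : _ * (r' * star r') = r' * (star r' *
        (b * d * star b - t * d' * star t - (y * z - z * y)) * r') * star r');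
      last by rewrite !mulrA.
    by rewrite xr ?mulr0 ?mul0r // ltn_subLR // leqNgt hi.
  rewrite -/b /y /z -WV.
  cstar with (tb, ty, tz, tS, tt, bb, bt, yt, zt, Ut, Ve', e'W, eV, by_).
Qed.

End Stage.


(** * Summation along a tower *)

Section ZeroDiagonal.
Context {R : realType} {A : unitalCStarAlgType R}.
Implicit Types (x y z h k m e q t u v c d : A).

Lemma sum_delta (I : finType) (F : I -> A) i : (forall j, j != i -> F j = 0) -> \sum_j F j = F i.
Proof. by move=> h; rewrite (bigD1 i) //= big1 ?addr0. Qed.

(** The equation is solved entrywise: the entry (i, j) of [b] is that of [x] divided by l i - l j.
    The gap [del] controls the norm, which is needed to sum infinitely many such [b]. *)
Lemma zero_diagonal_commutator (I : finType) (g : I -> A) (l : I -> R) (del : R) x :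
  (forall i, projection (g i)) -> (forall i j, i != j -> g i * g j = 0) ->
  (\sum_i g i) * x = x -> x * (\sum_i g i) = x -> (forall i, g i * x * g i = 0) ->
  0 < del -> (forall i j, i != j -> del <= `|l i - l j|) ->
  exists b, [/\ (\sum_i g i) * b = b, b * (\sum_i g i) = b,
    (\sum_i (l i)%:C *: g i) * b - b * (\sum_i (l i)%:C *: g i) = x &
    nrm b <= #|I|%:R * (#|I|%:R * (del^-1 * nrm x))].
Proof.
move=> pg og Gx xG gx del0 hl.
have gg i : g i * g i = g i by case: (pg i).
have Gg i : (\sum_j g j) * g i = g i by rewrite mulr_suml (sum_delta (i := i)) // => j; exact: og.
have gG i : g i * (\sum_j g j) = g i.
  by rewrite mulr_sumr (sum_delta (i := i)) // => j ji; rewrite og // eq_sym.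
have Lg i : (\sum_j (l j)%:C *: g j) * g i = (l i)%:C *: g i.
  rewrite mulr_suml (sum_delta (i := i)) -?scalerAl ?gg // => j ji.
  by rewrite -scalerAl og // scaler0.
have gL i : g i * (\sum_j (l j)%:C *: g j) = (l i)%:C *: g i.
  rewrite mulr_sumr (sum_delta (i := i)) -?scalerAr ?gg // => j ji.
  by rewrite -scalerAr og ?scaler0 // eq_sym.
(* For i = j this is 0^-1 = 0, and it multiplies an entry that is zero anyway. *)
pose c i j := (l i - l j)^-1.
exists (\sum_i \sum_j (c i j)%:C *: (g i * x * g j)); split.
- rewrite mulr_sumr; apply: eq_bigr => i _; rewrite mulr_sumr; apply: eq_bigr => j _.
  by rewrite -scalerAr !mulrA Gg.
- rewrite mulr_suml; apply: eq_bigr => i _; rewrite mulr_suml; apply: eq_bigr => j _.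
  by rewrite -scalerAl -!mulrA gG.
- move: Lg gL; move: (\sum_i (l i)%:C *: g i) => L Lg gL.
  rewrite mulr_sumr mulr_suml -sumrB -[RHS]Gx -[x in RHS]xG mulr_suml; apply: eq_bigr => i _.
  rewrite !mulr_sumr mulr_suml -sumrB; apply: eq_bigr => j _.
  rewrite -scalerAr -scalerAl !mulrA Lg -!mulrA gL !mulrA -!scalerAl -scalerAr !scaleCA -scaleCN scaleCD.
  have [->|ij] := eqVneq i j; first by rewrite gx scaler0.
  rewrite (_ : _ + _ = 1) ?scaleC1 // /c -mulrN -mulrDr mulVf //.
  by rewrite -normr_gt0; apply: lt_le_trans (hl _ _ ij).
have ng i : nrm (g i) <= 1 by exact: nrm_projection.
apply: le_trans (nrm_sum _ _ _) _.
have term i j : nrm ((c i j)%:C *: (g i * x * g j)) <= del^-1 * nrm x.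
  have h : nrm (g i * x * g j) <= nrm x.
    by have := nrmM_le (nrmM_le (ng i) (lexx (nrm x))) (ng j); rewrite mul1r mulr1.
  have [->|ij] := eqVneq i j.
    by rewrite gx scaler0 nrm0 mulr_ge0 ?nrm_ge0 // invr_ge0 ltW.
  rewrite nrmZ; apply: ler_pM => //; first exact: nrm_ge0.
  by rewrite normfV lef_pV2 ?hl ?posrE // normr_gt0 -normr_gt0; apply: lt_le_trans (hl _ _ ij).
have E (a : R) : \sum_(i : I) a = #|I|%:R * a by rewrite sumr_const mulr_natl.
rewrite -!E; apply: ler_sum => i _; apply: le_trans (nrm_sum _ _ _) _.
by apply: ler_sum => j _; exact: term.
Qed.

Lemma series_tends (F : nat -> A) (C r : R) : 0 <= r < 1 -> (forall n, nrm (F n) <= C * r ^+ n) ->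
  exists l, tends (fun N => \sum_(n < N) F n) l.
Proof.
move=> /andP[r0 r1] hF.
have d0 : 0 < 1 - r by lra.
have C0 : 0 <= C by have := hF 0%N; rewrite expr0 mulr1; apply: le_trans; exact: nrm_ge0.
apply: (@monotone_tends _ _ _ (fun n => C * ((1 - r ^+ n) / (1 - r))) (C / (1 - r))) => n.
  rewrite big_ord_recr /= addrAC subrr add0r; apply: le_trans (hF n) _.
  by rewrite -mulrBr exprS (_ : _ - _ = r ^+ n) //; field; rewrite lt0r_neq0.
rewrite mulrA; apply: ler_wpM2r; first by rewrite invr_ge0 ltW.
by rewrite ler_piMr // gerBl exprn_ge0.
Qed.

Lemma series_terms (F : nat -> A) l : tends (fun N => \sum_(n < N) F n) l -> tends F 0.
Proof.
move=> h; rewrite -(subrr l); apply: tends_ext (tendsB (tends_shift h) h) => n /=.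
by rewrite big_ord_recr /= addrAC subrr add0r.
Qed.

Lemma tends_mull (F : nat -> A) l q : (forall n, q * F n = F n) -> tends F l -> q * l = l.
Proof.
move=> h Fl; apply: tends_unique (tendsM (tends_cst q) Fl) _.
by apply: tends_ext Fl => n; rewrite h.
Qed.

Lemma tends_mulr (F : nat -> A) l q : (forall n, F n * q = F n) -> tends F l -> l * q = l.
Proof.
move=> h Fl; apply: tends_unique (tendsM Fl (tends_cst q)) _.
by apply: tends_ext Fl => n; rewrite h.
Qed.

End ZeroDiagonal.


(** * Telescoping the commutators; the diagonal blocks of one level *)

Section Tower.
Context {R : realType} {A : unitalCStarAlgType R}.
Implicit Types (q u v : A).

Definition psum (F : nat -> A) (N : nat) : A := \sum_(n < N) F n.

Lemma psumS (F : nat -> A) N : psum F N.+1 = psum F N + F N.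
Proof. by rewrite /psum big_ord_recr. Qed.

(* Only neighbouring indices interact, so that both commutators reduce to sums along the diagonal
   and the [c n] telescope. *)
Lemma tridiagonal_sum (T c y z L b o : nat -> A) (Y Z Lam B : A) :
  (forall n k, n != k -> T n * T k = 0) ->
  (forall n, T n * y n = y n /\ y n * (T n + T n.+1) = y n) ->
  (forall n, (T n + T n.+1) * z n = z n /\ z n * T n = z n) ->
  (forall n, T n * L n = L n /\ L n * T n = L n) ->
  (forall n, (T n + T n.+1) * b n = b n /\ b n * (T n + T n.+1) = b n) ->
  (forall n, (L n + L n.+1) * b n - b n * (L n + L n.+1) = o n) ->
  (forall n, o n = c n - c n.+1 - (y n * z n - z n * y n) - (y n.+1 * z n + y n * z n.+1)) ->
  tends c 0 -> tends (psum y) Y -> tends (psum z) Z -> tends (psum L) Lam -> tends (psum b) B ->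
  c 0%N = (Y * Z - Z * Y) + (Lam * B - B * Lam).
Proof.
move=> TT hy hz hL hb hLb ho c0 yY zZ LL bB.
have T2 (u v : A) n k k' : u * T n = u -> (T k + T k') * v = v -> n != k -> n != k' -> u * v = 0.
  by move=> ud vd nk nk'; rewrite -ud -vd -mulrA (mulrA (T n)) mulrDr !TT // addr0 mul0r mulr0.
have T2' (u v : A) n k k' : T n * u = u -> v * (T k + T k') = v -> k != n -> k' != n -> v * u = 0.
  by move=> ud vd nk nk'; rewrite -ud -vd -mulrA (mulrA (_ + _)) mulrDl !TT // addr0 mul0r mulr0.
have zy n k : n != k -> z n * y k = 0.
  move=> nk; have [_ h1] := hz n; have [h2 _] := hy k.
  by rewrite -h1 -h2 -mulrA (mulrA (T n)) TT // mul0r mulr0.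
have yz n k : n != k -> n != k.+1 -> n.+1 != k -> y n * z k = 0.
  move=> h1 h2 h3; have [_ e1] := hy n; have [e2 _] := hz k.
  have t4 : T n.+1 * T k.+1 = 0 by apply: TT; rewrite eqSS.
  have t1 := TT _ _ h1; have t2 := TT _ _ h2; have t3 := TT _ _ h3.
  rewrite -e1 -e2 (_ : _ * _ = y n * ((T n + T n.+1) * (T k + T k.+1)) * z k); last by cstar.
  by rewrite (_ : (T n + _) * _ = 0) ?mulr0 ?mul0r //; cstar with (t1, t2, t3, t4).
have Zy N : psum z N * y N = 0.
  by rewrite /psum mulr_suml big1 // => i _; apply: zy; rewrite neq_ltn ltn_ord.
have zY N : z N * psum y N = 0.
  by rewrite /psum mulr_sumr big1 // => i _; apply: zy; rewrite neq_ltn ltn_ord orbT.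
have yZ N : y N.+1 * psum z N.+1 = y N.+1 * z N.
  rewrite psumS mulrDr /psum mulr_sumr big1 ?add0r // => -[i hi] _ /=.
  by apply: yz; rewrite gtn_eqF // ?ltnS ltnW // ltnS ltnW.
have Yz N : psum y N.+1 * z N.+1 = y N * z N.+1.
  rewrite psumS mulrDl /psum mulr_suml big1 ?add0r // => -[i hi] _ /=.
  by apply: yz; rewrite ltn_eqF // ?ltnS ltnW // ltnS ltnW.
(* The boundary term: the sum of the [o n] up to N already contains the products of level N with
   level N - 1, whereas the partial sums of [y] and [z] stop before N. *)
pose E N := y N * psum z N + psum y N * z N.
have main N : c 0%N - c N = (psum y N * psum z N - psum z N * psum y N) + psum o N + E N.
  elim: N => [|N IH].
    by rewrite /E /psum !big_ord0 subrr !mulr0 mul0r subrr !addr0.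
  have -> : c 0%N - c N.+1 = (c 0%N - c N) + (c N - c N.+1) by cstar.
  have -> : c N - c N.+1 = o N + (y N * z N - z N * y N) + (y N.+1 * z N + y N * z N.+1).
    by rewrite ho; cstar.
  rewrite IH /E yZ Yz !(psumS _ N); cstar with (Zy N, zY N).
have E0 : tends E 0.
  suff : tends E (0 * Z + Y * 0) by rewrite mul0r mulr0 addr0.
  by apply: tendsD; apply: tendsM => //; [exact: series_terms yY | exact: series_terms zZ].
(* The partial sum of [L] is one term longer because [b n] meets both [L n] and [L n.+1]. *)
have Lb N : psum L N.+1 * psum b N - psum b N * psum L N.+1 = psum o N.
  have [P PE] : exists P, P = psum L N.+1 by exists (psum L N.+1).
  rewrite -PE /psum mulr_sumr mulr_suml -sumrB; apply: eq_bigr => -[n hn] _ /=.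
  rewrite -hLb; have [b1 b2] := hb n.
  have Lk k : k != n -> k != n.+1 -> L k * b n = 0 /\ b n * L k = 0.
    move=> k1 k2; have [l1 l2] := hL k; split; first exact: T2 l2 b1 k1 k2.
    by apply: T2' l1 b2 _ _; rewrite eq_sym.
  have n1 : (n < N.+1)%N by rewrite ltnS ltnW.
  have n2 : (n.+1 < N.+1)%N by rewrite ltnS.
  have two (F : nat -> A) : (forall k, k != n -> k != n.+1 -> F k = 0) ->
      \sum_(i < N.+1) F i = F n + F n.+1.
    move=> hF; rewrite (bigD1 (Ordinal n1)) // (bigD1 (Ordinal n2)) /=; last first.
      by rewrite -val_eqE /= neq_ltn ltnSn orbT.
    by rewrite big1 ?addr0 // => i /andP[i1 i2]; apply: hF.
  rewrite PE /psum mulr_suml mulr_sumr (two (fun k => L k * b n)); last first.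
    by move=> k k1 k2; case: (Lk k k1 k2).
  rewrite (two (fun k => b n * L k)); first by cstar.
  by move=> k k1 k2; case: (Lk k k1 k2).
have oS : tends (psum o) (Lam * B - B * Lam).
  apply: tends_ext Lb _; apply: tendsB; apply: tendsM => //; exact: tends_shift.
apply: (@tends_unique _ _ (fun N => c 0%N - c N)).
  by rewrite -{2}[c 0%N]subr0; apply: tendsB c0; exact: tends_cst.
rewrite -[X in tends _ X]addr0; apply: tends_ext (fun N => esym (main N)) _.
by apply: tendsD => //; apply: tendsD oS; apply: tendsB; apply: tendsM.
Qed.

Section Blocks.
Variables (m : nat) (e e' : A) (s p w : nat -> A).
Hypotheses (pe : projection e) (ss : copies m.+1 e s) (cov : cover 3 e e' p w).

Lemma block_sum : \sum_(i < 3 + m) block p s i = range_sum m.+1 s.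
Proof.
rewrite (big_ord_add 3 m (block p s)) /range_sum [RHS]big_ord_recl; congr (_ + _).
  rewrite (eq_bigr (fun i : 'I_3 => s 0%N * p i * star (s 0%N))); last first.
    by move=> i _; rewrite /block ltn_ord.
  rewrite -mulr_suml -mulr_sumr; case: cov => _ _ ->.
  by rewrite (copies_src pe ss).
Qed.

Lemma block_index i : (i < 3 + m)%N -> (i < 3)%N = false -> (0 < i - 2 < m.+1)%N.
Proof.
move=> h /negbT; rewrite -leqNgt => h3; rewrite subn_gt0 h3 ltn_subLR.
  by rewrite addnS -addSn.
exact: ltnW.
Qed.

Lemma block_projection i : (i < 3 + m)%N -> projection (block p s i).
Proof.
move=> hi; rewrite /block; case: ifP => h3.
  have [[ps pE] _ _] := (let: And3 h _ _ := cov in h) i h3.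
  have ep := cover_le cov h3.
  have sse : star (s 0%N) * s 0%N = e by rewrite ss.
  have pe' : p i * e = p i by apply: projection_le_comm.
  by split; [rewrite /selfadjoint; cstar with ps | cstar with (sse, ep, pE)].
have /andP[_ h] := block_index hi h3.
by apply: (partial_isometry_range pe); rewrite ss // eqxx.
Qed.

Lemma block_orth i j : (i < 3 + m)%N -> (j < 3 + m)%N -> i != j -> block p s i * block p s j = 0.
Proof.
move=> hi hj ij; rewrite /block.
have z k l : (k < m.+1)%N -> (l < m.+1)%N -> k != l -> star (s k) * s l = 0.
  by move=> hk hl kl; rewrite ss // (negPf kl).
case: ifP => hi3; case: ifP => hj3.
- have sse : star (s 0%N) * s 0%N = e by rewrite ss.
  have ep := cover_le cov hj3.
  have pp : p i * p j = 0 by case: cov => _ h _; exact: h.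
  by cstar with (sse, ep, pp).
- have /andP[h0 h] := block_index hj hj3.
  have h1 := z 0%N _ isT h (negbT (ltn_eqF h0)); cstar with h1.
- have /andP[h0 h] := block_index hi hi3.
  have h1 := z _ 0%N h isT (negbT (gtn_eqF h0)); cstar with h1.
- have /andP[h0 h] := block_index hi hi3; have /andP[h0' h'] := block_index hj hj3.
  have h2 : (i - 2)%N != (j - 2)%N.
    apply: contra ij => /eqP E; apply/eqP.
    rewrite -(subnK (_ : 2 <= i)%N) ?E ?subnK //; apply: ltnW; first by rewrite ltnNge -ltnS hj3.
    by rewrite ltnNge -ltnS hi3.
  have h1 := z _ _ h h' h2; cstar with h1.
Qed.

End Blocks.
End Tower.


(** * Two commutators for an element at the bottom of a tower *)

Section TowerCommutators.
Context {R : realType} {A : unitalCStarAlgType R}.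
Implicit Types (d q u v x : A).

Record tower (m : nat) (q : A) (e : nat -> A) (s p w : nat -> nat -> A) : Prop := Tower {
  tower_proj : forall n, projection (e n);
  tower_neq0 : forall n, e n != 0;
  tower_copies : forall n, copies m.+1 (e n) (s n);
  tower_orth : forall n k i j, n != k -> (i < m.+1)%N -> (j < m.+1)%N -> star (s n i) * s k j = 0;
  tower_cover : forall n, cover 3 (e n) (e n.+1) (p n) (w n);
  tower_below : forall n i, (i < m.+1)%N -> q * s n i = s n i
}.

Lemma natr_dist_ge1 (i j : nat) : i != j -> 1 <= `|i%:R - j%:R| :> R.
Proof.
rewrite neq_ltn => /orP[] h.
  rewrite distrC ger0_norm ?subr_ge0 ?ler_nat ?(ltnW h) //.
  by rewrite -natrB ?(ltnW h) // ler1n subn_gt0.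
by rewrite ger0_norm ?subr_ge0 ?ler_nat ?(ltnW h) // -natrB ?(ltnW h) // ler1n subn_gt0.
Qed.

(* [stage] is iterated along the tower: [D n] decays like [16^-n]. The [z n] are scaled by [2^-n] (and
   the [y n] by [2^n]) so that both series converge; the zero-diagonal errors are commutators with
   diagonal elements whose spectral gaps in block [n] are of order [4^-n]. *)
Lemma tower_commutators (compA : strict_comparison_of_projections A) (rr0 : real_rank_zero A)
  (simpleA : simple_cstar A) (K : nat) q e s p w d : let m := ((K + 9) + (K + 9))%N in
  (66 * 16 <= K)%N -> star q = q -> tower m q e s p w -> e 0%N * d * e 0%N = d ->
  (forall tau, is_tracial_state tau -> tau d = 0) ->
  exists Y Z Lam B, [/\ q * Y = Y /\ Y * q = Y, q * Z = Z /\ Z * q = Z, q * Lam = Lam /\ Lam * q = Lam,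
    q * B = B /\ B * q = B &
    s 0%N 0%N * d * star (s 0%N 0%N) = (Y * Z - Z * Y) + (Lam * B - B * Lam)].
Proof.
move=> m hK qs [pe e0 ss so cov qS] ede td.
have K0 : (0 < K)%N by apply: leq_trans hK.
have KR : 66 / K%:R <= 16^-1 :> R.
  by rewrite ler_pdivrMr ?ltr0n // ler_pdivlMl // -natrM ler_nat mulnC.
pose C : R := 68 + 8 * m%:R.
have C1 : 1 <= C by have := ler0n R m; rewrite /C; lra.
pose T n := range_sum m.+1 (s n).
pose t n := s n.+1 0%N.
pose P n d := e n * d * e n = d /\ forall tau, is_tracial_state tau -> tau d = 0.
pose X n d y z d' := s n 0%N * d * star (s n 0%N) - t n * d' * star (t n) - (y * z - z * y).
pose Q n d (f : A * A * A) := let: (y, z, d') := f in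
  [/\ P n.+1 d', nrm d' <= 16^-1 * nrm d,
    nrm y <= C * 2 ^+ n * nrm d /\ nrm z <= C * (2^-1) ^+ n,
    [/\ T n * y = y, y * (T n + t n * star (t n)) = y, (T n + t n * star (t n)) * z = z & z * T n = z] &
    (forall i, (i < 3 + m)%N -> block (p n) (s n) i * X n d y z d' * block (p n) (s n) i = 0) /\
    star (t n) * X n d y z d' * t n = 0].
have st n i : (i < m.+1)%N -> star (t n) * s n i = 0.
  by move=> hi; apply: so => //; rewrite gtn_eqF.
have tt n : star (t n) * t n = e n.+1 by rewrite /t ss.
have step n d0 : P n d0 -> exists f, Q n d0 f.
  move=> [h1 h2].
  have [y [z [d' [hd' nd [ny nz] [s1 s2 s3 s4] hx]]]] :=
    stage compA rr0 simpleA K0 (pe n) (e0 n) (pe n.+1) (ss n) (tt n) (st n) (cov n) h1 h2.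
  have r0 : 0 < 2 ^+ n :> R by rewrite exprn_gt0.
  have E : ((2 ^+ n)%:C *: y) * (((2^-1) ^+ n)%:C *: z) - (((2^-1) ^+ n)%:C *: z) * ((2 ^+ n)%:C *: y)
     = y * z - z * y.
    rewrite -!scalerAl -!scalerAr !scaleCA exprVn mulfV ?mulVf ?scaleC1 //; exact: lt0r_neq0.
  exists ((2 ^+ n)%:C *: y, ((2^-1) ^+ n)%:C *: z, d'); split=> //.
  - by apply: le_trans nd _; apply: ler_wpM2r => //; exact: nrm_ge0.
  - split; rewrite nrmZ ger0_norm ?exprn_ge0 ?invr_ge0 //.
      by rewrite [C * _]mulrC -mulrA ler_wpM2l // ltW.
    by rewrite [X in _ <= X]mulrC ler_wpM2l // exprn_ge0 // invr_ge0.
  - by split; rewrite -?scalerAl -?scalerAr ?s1 ?s2 ?s3 ?s4.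
  - by rewrite /X E.
(* The step is made total, with a dummy value outside [P], so that the recursion defining [D] needs
   no proofs. *)
have /boolp.choice[F HF] : forall nd : nat * A, exists f, P nd.1 nd.2 -> Q nd.1 nd.2 f.
  move=> [n d0]; have [h|h] := pselect (P n d0).
    by have [f hf] := step n d0 h; exists f.
  by exists (0, 0, 0) => /h.
pose D := fix D n := if n is n'.+1 then (F (n', D n')).2 else d.
have PD n : P n (D n).
  elim: n => [|n IH] //=; have := HF (n, D n) IH; rewrite /Q /=.
  by case: (F _) => [[y z] d'] [].
pose y n := (F (n, D n)).1.1; pose z n := (F (n, D n)).1.2.
have hQ n : Q n (D n) (y n, z n, D n.+1).
  by have := HF (n, D n) (PD n); rewrite /y /z /=; case: (F _) => [[]].
pose al := nrm d.
have al0 : 0 <= al by exact: nrm_ge0.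
have nD n : nrm (D n) <= al * (16^-1) ^+ n.
  elim: n => [|n IH]; first by rewrite expr0 mulr1.
  have [_ h _ _ _] := hQ n; apply: le_trans h _.
  by rewrite exprS mulrCA ler_wpM2l // invr_ge0.
have ny n : nrm (y n) <= C * al * (8^-1) ^+ n.
  have [_ _ [h _] _ _] := hQ n; apply: le_trans h _.
  rewrite -!mulrA ler_wpM2l //; first by lra.
  have -> : (8^-1 : R) = 2 * 16^-1 by field.
  by rewrite exprMn mulrCA ler_wpM2l // exprn_ge0.
have nz n : nrm (z n) <= C * (2^-1) ^+ n by have [_ _ [_ h] _ _] := hQ n.
have TT n k : n != k -> T n * T k = 0.
  move=> nk; apply: range_col0 => i hi; apply: range_row0 => j hj; exact: so.
have Ts n : star (T n) = T n by exact: star_range.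
have TE n : T n * T n = T n by case: (range_projection (pe n) (ss n)).
have tT n : T n.+1 * t n = t n by apply: (range_col (pe n.+1) (ss n.+1)).
have tT' n : star (t n) * T n.+1 = star (t n).
  by rewrite -[in RHS]tT starMr Ts.
have nk1 n : n != n.+1 by rewrite ltn_eqF.
have nk2 n : n.+1 != n by rewrite gtn_eqF.
have supp n : [/\ T n * y n = y n, y n * (T n + T n.+1) = y n, (T n + T n.+1) * z n = z n &
    z n * T n = z n].
  have [_ _ _ [h1 h2 h3 h4] _] := hQ n; split=> //.
    have a := tT' n; have b : T n * T n.+1 = 0 := TT _ _ (nk1 n).
    have c : star (t n) * T n = 0 by rewrite -tT' -mulrA TT ?mulr0.
    by rewrite -h2 -mulrA (_ : (_ + _) * (_ + _) = T n + t n * star (t n)) //; cstar with (a, b, c, TE n).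
  have a := tT n; have b : T n.+1 * T n = 0 := TT _ _ (nk2 n).
  have c : T n * t n = 0 by rewrite -tT mulrA TT ?mul0r.
  by rewrite -h3 mulrA (_ : (_ + _) * (_ + _) = T n + t n * star (t n)) //; cstar with (a, b, c, TE n).
pose c n := s n 0%N * D n * star (s n 0%N).
(* The last bracket is what the full product of the sums adds between neighbouring levels.
   [y n.+1 * z n] maps level n to n + 1 and [y n * z n.+1] maps back, so neither has a diagonal
   block. *)
pose o n := c n - c n.+1 - (y n * z n - z n * y n) - (y n.+1 * z n + y n * z n.+1).
pose Q' := (3 + m)%N; pose bl n i := block (p n) (s n) i.
have bsum n : \sum_(i < Q') bl n i = T n by exact: block_sum (pe n) (ss n) (cov n).
have bpr n i : (i < Q')%N -> projection (bl n i) by move=> hi; apply: (block_projection (pe n) (ss n) (cov n)).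
have bor n i j : (i < Q')%N -> (j < Q')%N -> i != j -> bl n i * bl n j = 0.
  by move=> hi hj ij; apply: (block_orth (ss n) (cov n)).
have Tb n i : (i < Q')%N -> T n * bl n i = bl n i.
  move=> hi; rewrite -bsum mulr_suml (sum_delta (i := Ordinal hi)) /=.
    by case: (bpr n i hi).
  by move=> j ji; apply: bor.
have bT n i : (i < Q')%N -> bl n i * T n = bl n i.
  move=> hi; have := congr1 star (Tb n i hi); rewrite starMr Ts.
  by case: (bpr n i hi) => ->.
have nc n : nrm (c n) <= nrm (D n).
  have n1 : nrm (s n 0%N) <= 1 by apply: nrm_isometry (pe n) _; rewrite ss.
  have n2 : nrm (star (s n 0%N)) <= 1 by rewrite nrm_star.
  by have := nrmM_le (nrmM_le n1 (lexx (nrm (D n)))) n2; rewrite mul1r mulr1.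
have cT n : T n * c n = c n /\ c n * T n = c n.
  have h := range_col (pe n) (ss n) (isT : (0 < m.+1)%N).
  have h' : star (s n 0%N) * T n = star (s n 0%N) by rewrite -[in RHS]h starMr Ts.
  by rewrite /c -!mulrA h' !mulrA h.
(* In level n + 1 the expression lives on the single copy [t n], where [stage] makes it vanish. So
   all blocks of that level are zero, not only those that [stage] mentions. *)
have TXT n : T n.+1 * (c n - c n.+1 - (y n * z n - z n * y n)) * T n.+1 = 0.
  have [_ _ _ _ [_ hx]] := hQ n; have [s1 s2 s3 s4] := supp n.
  have [_ _ _ [_ h2 h3 _] _] := hQ n.
  have [c1 c2] := cT n; have [c3 c4] := cT n.+1.
  have a1 := TT _ _ (nk1 n); have a2 := TT _ _ (nk2 n); have a3 := tT n; have a4 := tT' n.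
  have b1 : T n.+1 * c n = 0 by rewrite -c1 mulrA a2 mul0r.
  have b2 : T n.+1 * y n = 0 by rewrite -s1 mulrA a2 mul0r.
  have b3 : y n * T n.+1 = y n * (t n * star (t n)) by rewrite -{1}h2; cstar with (a1, a4).
  have b4 : T n.+1 * z n = t n * star (t n) * z n by rewrite -{1}h3; cstar with (a2, a3).
  have b5 : c n.+1 = t n * D n.+1 * star (t n) by [].
  have d1 : star (t n) * c n = 0 by rewrite -a4 -mulrA b1 mulr0.
  have d2 : star (t n) * y n = 0 by rewrite -a4 -mulrA b2 mulr0.
  have e1 : star (t n) * (t n * D n.+1 * star (t n)) * t n = star (t n) * z n * y n * t n.
    apply/eqP; rewrite -subr_eq0 -oppr_eq0; apply/eqP; rewrite -[RHS]hx /X -/(c n) -b5 b5.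
    by cstar with (d1, d2).
  transitivity (t n * (star (t n) * z n * y n * t n - star (t n) * (t n * D n.+1 * star (t n)) * t n) * star (t n)); last first.
    by rewrite e1 subrr mulr0 mul0r.
  have b6 : star (t n) * t n * D n.+1 = D n.+1 by rewrite tt; have [h _] := PD n.+1; rewrite -h; cstar with (proj2 (pe n.+1)).
  have b7 : D n.+1 * star (t n) * t n = D n.+1.
    by rewrite -mulrA tt; have [h _] := PD n.+1; rewrite -h; cstar with (proj2 (pe n.+1)).
  rewrite b5; cstar with (b1, b2, b3, b4, a3, a4, b6, b7).
pose gg n (i : 'I_Q' + 'I_Q') := match i with inl i => bl n i | inr i => bl n.+1 i end.
have gsum n : \sum_i gg n i = T n + T n.+1 by rewrite big_sumType /= !bsum.
pose rho : R := 4^-1.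
have rho_gt0 n : 0 < rho ^+ n by rewrite exprn_gt0 // invr_gt0.
(* The eigenvalues of [L n] lie between 4^-n and 2 4^-n, those of [L n.+1] between 4^-n/4 and
   4^-n/2. These ranges are disjoint, so the same [L n] separates blocks both within its level and
   from the neighbouring levels. *)
pose lam i : R := 1 + i%:R / Q'%:R.
have Q0 : 0 < Q'%:R :> R by rewrite ltr0n.
have lam12 i : (i < Q')%N -> 1 <= lam i <= 2.
  move=> hi; rewrite /lam lerDl divr_ge0 ?ler0n //= (_ : (2 : R) = 1 + 1) // lerD2l.
  by rewrite ler_pdivrMr // mul1r ler_nat ltnW.
pose ll n (i : 'I_Q' + 'I_Q') := match i with inl i => rho ^+ n * lam i | inr i => rho ^+ n.+1 * lam i end.
pose del n := rho ^+ n.+1 / Q'%:R.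
have del0 n : 0 < del n by rewrite divr_gt0.
have rhoS n : rho ^+ n.+1 = rho ^+ n / 4 by rewrite exprS mulrC.
have same n (i j : 'I_Q') : i != j -> rho ^+ n / Q'%:R <= `|rho ^+ n * lam i - rho ^+ n * lam j|.
  move=> ij; rewrite -mulrBr normrM (ger0_norm (ltW (rho_gt0 n))) ler_wpM2l ?(ltW (rho_gt0 n)) //.
  have iq : 0 <= Q'%:R^-1 :> R by rewrite invr_ge0 ltW.
  rewrite /lam opprD addrACA subrr add0r -mulrBl normrM (ger0_norm iq) ler_peMl //.
  exact: natr_dist_ge1.
have del_le n : del n <= rho ^+ n / Q'%:R.
  by rewrite /del rhoS ler_wpM2r ?invr_ge0 ?(ltW Q0) //; have := rho_gt0 n; lra.
have cross n (i j : 'I_Q') : del n <= rho ^+ n * lam i - rho ^+ n.+1 * lam j.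
  have /andP[l1 _] := lam12 i (ltn_ord i); have /andP[_ l2] := lam12 j (ltn_ord j).
  have h1 : rho ^+ n <= rho ^+ n * lam i by rewrite ler_peMr // ltW.
  have h2 : rho ^+ n.+1 * lam j <= rho ^+ n.+1 * 2 by rewrite ler_wpM2l // ltW.
  have h3 : del n <= rho ^+ n.+1 by rewrite ler_pdivrMr // ler_peMr ?(ltW (rho_gt0 _)) // ler1n.
  by have := rho_gt0 n; move: h2 h3; rewrite rhoS; lra.
have lld n i j : i != j -> del n <= `|ll n i - ll n j|.
  case: i j => i [] j ij /=.
  - by apply: le_trans (del_le n) (same _ _ _ _).
  - by apply: le_trans (cross n i j) (ler_norm _).
  - by rewrite distrC; apply: le_trans (cross n j i) (ler_norm _).
  - exact: same.
have oG n : (T n + T n.+1) * o n = o n /\ o n * (T n + T n.+1) = o n.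
  have [s1 s2 s3 s4] := supp n; have [s5 s6 s7 s8] := supp n.+1.
  have [c1 c2] := cT n; have [c3 c4] := cT n.+1.
  have a1 := TT _ _ (nk1 n); have a2 := TT _ _ (nk2 n).
  have L1 x : T n * x = x -> T n.+1 * x = 0 by move=> h; rewrite -h mulrA a2 mul0r.
  have L2 x : T n.+1 * x = x -> T n * x = 0 by move=> h; rewrite -h mulrA a1 mul0r.
  have R1 x : x * T n = x -> x * T n.+1 = 0 by move=> h; rewrite -h -mulrA a1 mulr0.
  have R2 x : x * T n.+1 = x -> x * T n = 0 by move=> h; rewrite -h -mulrA a2 mulr0.
  have k1 := L1 _ c1; have k2 := L2 _ c3; have k3 := L1 _ s1; have k4 := L2 _ s5.
  have q1 := R1 _ c2; have q2 := R2 _ c4; have q3 := R1 _ s4; have q4 := R2 _ s8.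
  have zr : T n * z n = z n - T n.+1 * z n by rewrite -{2}s3; cstar.
  have yr : y n * T n = y n - y n * T n.+1 by rewrite -{2}s2; cstar.
  split; rewrite /o.
    cstar with (c1, c3, s1, s5, k1, k2, k3, k4, zr).
  cstar with (c2, c4, s4, s8, q1, q2, q3, q4, yr).
have odiag n i : gg n i * o n * gg n i = 0.
  have [s1 s2 s3 s4] := supp n; have [s5 s6 s7 s8] := supp n.+1.
  have a1 := TT _ _ (nk1 n); have a2 := TT _ _ (nk2 n).
  case: i => i /=; have hi := ltn_ord i.
    have [_ _ _ _ [hx _]] := hQ n.
    have h1 := bT n i hi; have h2 := Tb n i hi.
    have z1 : bl n i * y n.+1 = 0 by rewrite -h1 -s5 mulrA -(mulrA (bl n i)) a1 mulr0 mul0r.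
    have z2 : z n.+1 * bl n i = 0 by rewrite -s8 -h2 mulrA -(mulrA (z _)) a2 mulr0 mul0r.
    rewrite (_ : _ * bl n i = bl n i * X n (D n) (y n) (z n) (D n.+1) * bl n i); first exact: hx.
    by rewrite /o /X -/(c n) -/(c n.+1); cstar with (z1, z2).
  have h1 := bT n.+1 i hi; have h2 := Tb n.+1 i hi.
  have z1 : z n * bl n.+1 i = 0 by rewrite -s4 -h2 mulrA -(mulrA (z _)) a1 mulr0 mul0r.
  have z2 : bl n.+1 i * y n = 0 by rewrite -h1 -s1 mulrA -(mulrA (bl _ _)) a2 mulr0 mul0r.
  rewrite (_ : _ * bl n.+1 i = bl n.+1 i * (T n.+1 * (c n - c n.+1 - (y n * z n - z n * y n)) * T n.+1) * bl n.+1 i).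
    by rewrite TXT mulr0 mul0r.
  rewrite /o; cstar with (z1, z2, h1, h2).
have no n : nrm (o n) <= 6 * C ^+ 2 * al * (16^-1) ^+ n.
  have [_ h1 [h2 h3] _ _] := hQ n; have [_ _ [h4 h5] _ _] := hQ n.+1.
  set x := nrm (D n) in h1 h2; have x0 : 0 <= x by exact: nrm_ge0.
  have u0 : 0 < 2 ^+ n :> R by rewrite exprn_gt0.
  have uv : 2 ^+ n * (2^-1) ^+ n = 1 :> R by rewrite -exprMn mulfV ?expr1n ?pnatr_eq0.
  have CC : 1 <= C ^+ 2 by rewrite exprn_ege1.
  have e1 (u v a k : R) : u * v = 1 -> C * (k * u) * a * (C * v) = C ^+ 2 * (k * a).
    by move=> h; rewrite -[RHS]mulr1 -h; ring.
  have e2 (u v a k : R) : u * v = 1 -> C * u * a * (C * (k * v)) = C ^+ 2 * (k * a).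
    by move=> h; rewrite -[RHS]mulr1 -h; ring.
  have p1 : nrm (y n * z n) <= C ^+ 2 * x.
    by have := nrmM_le h2 h3; rewrite -(mul1r (2 ^+ n)) e1 // mul1r.
  have p2 : nrm (z n * y n) <= C ^+ 2 * x.
    by have := nrmM_le h3 h2; rewrite mulrC -(mul1r (2 ^+ n)) e1 // mul1r.
  have p3 : nrm (y n.+1 * z n) <= C ^+ 2 * (2 * nrm (D n.+1)).
    by have := nrmM_le h4 h3; rewrite exprS e1.
  have p4 : nrm (y n * z n.+1) <= C ^+ 2 * (2^-1 * x).
    by have := nrmM_le h2 h5; rewrite exprS e2.
  have p5 : C ^+ 2 * (2 * nrm (D n.+1)) <= C ^+ 2 * (8^-1 * x).
    by rewrite ler_wpM2l //; lra.
  have p6 : x <= C ^+ 2 * x by rewrite ler_peMl.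
  have p7 : nrm (o n) <= 6 * (C ^+ 2 * x).
    have := nrmB (c n - c n.+1 - (y n * z n - z n * y n)) (y n.+1 * z n + y n * z n.+1).
    have := nrmB (c n - c n.+1) (y n * z n - z n * y n); have := nrmB (c n) (c n.+1).
    have := nrmB (y n * z n) (z n * y n); have := nrmD (y n.+1 * z n) (y n * z n.+1).
    have := nc n; have := nc n.+1; rewrite -/x -/(o n); lra.
  apply: le_trans p7 _; rewrite -(mulrA 6) -(mulrA 6) ler_pM2l // -mulrA.
  exact: ler_wpM2l (le_trans ler01 CC) _ _ (nD n).
pose L n := (rho ^+ n)%:C *: \sum_(i < Q') (lam i)%:C *: bl n i.
have /boolp.choice[b hb] : forall n, exists b, [/\ (T n + T n.+1) * b = b, b * (T n + T n.+1) = b,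
    (L n + L n.+1) * b - b * (L n + L n.+1) = o n &
    nrm b <= #|{: 'I_Q' + 'I_Q'}|%:R * (#|{: 'I_Q' + 'I_Q'}|%:R * ((del n)^-1 * nrm (o n)))].
  move=> n; have LE : \sum_i (ll n i)%:C *: gg n i = L n + L n.+1.
    by rewrite big_sumType /= /L !scaler_sumr; congr (_ + _); apply: eq_bigr => i _; rewrite scaleCA.
  rewrite -LE -gsum; apply: zero_diagonal_commutator => //.
  - by case=> i; exact: bpr.
  - case=> i [] j ij /=; [exact: bor | | | exact: bor].
      by rewrite -(bT n i) // -(Tb n.+1 j) // mulrA -(mulrA (bl _ _)) TT // mulr0 mul0r.
    by rewrite -(bT n.+1 i) // -(Tb n j) // mulrA -(mulrA (bl _ _)) TT // mulr0 mul0r.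
  - by rewrite gsum; case: (oG n).
  - by rewrite gsum; case: (oG n).
  - exact: lld.
have hL n : T n * L n = L n /\ L n * T n = L n.
  rewrite /L -scalerAr -scalerAl mulr_sumr mulr_suml; split; congr (_ *: _); apply: eq_bigr => i _.
    by rewrite -scalerAr Tb.
  by rewrite -scalerAl bT.
have geo (r : R) : r = 2^-1 \/ r = 4^-1 \/ r = 8^-1 \/ r = 16^-1 -> 0 <= r < 1.
  by move=> [|[|[|]]] ->; apply/andP; split; lra.
have [Y yY] := series_tends (geo 8^-1 (or_intror (or_intror (or_introl erefl)))) ny.
have [Z zZ] := series_tends (geo 2^-1 (or_introl erefl)) nz.
have nL n : nrm (L n) <= Q'%:R * 2 * (4^-1) ^+ n.
  rewrite /L nrmZ ger0_norm ?(ltW (rho_gt0 n)) // mulrC ler_wpM2r ?(ltW (rho_gt0 n)) //.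
  apply: (@nrm_sum_le _ _ Q' (fun i => (lam i)%:C *: bl n i)) => i hi.
  have /andP[l1 l2] := lam12 i hi; have := nrm_projection (bpr n i hi).
  by rewrite nrmZ ger0_norm; have := nrm_ge0 (bl n i); nra.
have [Lam LL] := series_tends (geo 4^-1 (or_intror (or_introl erefl))) nL.
set NI := #|_|%:R in hb.
have nb n : nrm (b n) <= NI * (NI * (Q'%:R * 4 * (6 * C ^+ 2 * al))) * (4^-1) ^+ n.
  have [_ _ _ h] := hb n; apply: le_trans h _; rewrite -!mulrA ler_wpM2l ?ler0n // ler_wpM2l ?ler0n //.
  apply: le_trans (ler_wpM2l _ (no n)) _; first by rewrite invr_ge0 ltW.
  rewrite /del rhoS /rho (_ : (16^-1 : R) = 4^-1 * 4^-1); last by field.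
  rewrite exprMn le_eqVlt; apply/orP; left; apply/eqP.
  have r0 : (4^-1 : R) ^+ n != 0 by rewrite lt0r_neq0.
  by field; rewrite r0 lt0r_neq0.
have [B bB] := series_tends (geo 4^-1 (or_intror (or_introl erefl))) nb.
have c0 : tends c 0.
  have [|l hl] := @series_tends _ _ c al 16^-1 (geo _ (or_intror (or_intror (or_intror erefl)))).
    by move=> n; apply: le_trans (nc n) (nD n).
  exact: series_terms hl.
have qT n : q * T n = T n /\ T n * q = T n.
  have h : q * T n = T n by rewrite /T /range_sum mulr_sumr; apply: eq_bigr => i _; rewrite mulrA qS.
  by split=> //; rewrite -[RHS]Ts -[in RHS]h starMr Ts qs.
have qsum (u : nat -> A) : (forall n, q * u n = u n) -> forall N, q * psum u N = psum u N.
  by move=> h N; rewrite /psum mulr_sumr; apply: eq_bigr => i _.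
have sumq (u : nat -> A) : (forall n, u n * q = u n) -> forall N, psum u N * q = psum u N.
  by move=> h N; rewrite /psum mulr_suml; apply: eq_bigr => i _.
have hq (u : nat -> A) U : (forall n, q * u n = u n /\ u n * q = u n) -> tends (psum u) U ->
    q * U = U /\ U * q = U.
  move=> h uU; split; [apply: tends_mull uU | apply: tends_mulr uU].
    by apply: qsum => n; case: (h n).
  by apply: sumq => n; case: (h n).
have TTq n : (T n + T n.+1) * q = T n + T n.+1 /\ q * (T n + T n.+1) = T n + T n.+1.
  have [h1 h2] := qT n; have [h3 h4] := qT n.+1.
  by rewrite mulrDl mulrDr h1 h2 h3 h4.
exists Y, Z, Lam, B; split.
- apply: hq yY => n; have [h1 h2 _ _] := supp n; have [q1 _] := qT n; have [q2 _] := TTq n.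
  by split; [rewrite -h1 mulrA q1 | rewrite -h2 -mulrA q2].
- apply: hq zZ => n; have [_ _ h1 h2] := supp n; have [_ q1] := qT n; have [_ q2] := TTq n.
  by split; [rewrite -h1 mulrA q2 | rewrite -h2 -mulrA q1].
- apply: hq LL => n; have [h1 h2] := hL n; have [q1 q2] := qT n.
  by split; [rewrite -h1 mulrA q1 | rewrite -h2 -mulrA q2].
- apply: hq bB => n; have [h1 h2 _ _] := hb n; have [q1 q2] := TTq n.
  by split; [rewrite -h1 mulrA q2 | rewrite -h2 -mulrA q1].
apply: (tridiagonal_sum (T := T) (c := c) (y := y) (z := z) (L := L) (b := b) (o := o)) => //.
- by move=> n; have [h1 h2 _ _] := supp n.
- by move=> n; have [_ _ h1 h2] := supp n.
- by move=> n; have [h1 h2 _ _] := hb n.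
- by move=> n; have [_ _ h _] := hb n.
Qed.

End TowerCommutators.


(** * Construction of a tower by repeated halving *)

Section TowerExistence.
Context {R : realType} {A : unitalCStarAlgType R}.
Implicit Types (q u v x e f t : A).

Lemma pieces_cover n e t : pieces n e t -> exists p w, cover n t e p w.
Proof.
elim: n t => [|n IH] t /=.
  by move=> ->; exists (fun=> 0), (fun=> 0); split=> //; rewrite big_ord0.
move=> [p0 [t' [pp0 pt' p0t [w0 [w0p ew0]] ->]]].
have [p [w cov]] := IH _ pt'.
have pt := pieces_projection pt'.
have [c1 c2 c3] := cov.
have p0p i : (i < n)%N -> p0 * p i = 0.
  by move=> hi; rewrite -(cover_le cov hi) mulrA p0t mul0r.
exists (fun i => if i is i'.+1 then p i' else p0), (fun i => if i is i'.+1 then w i' else w0); split.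
- by case=> [|i] hi; [split | exact: c1].
- case=> [|i] [|j] hi hj ij //; first exact: p0p.
    by apply: projection_orthC => //; [case: (c1 i hi) | exact: p0p].
  exact: c2.
- by rewrite big_ord_recl /=; congr (_ + _); rewrite -c3.
Qed.

(* Halving repeatedly gives [1 = E 0 >= E 1 >= ...] and orthogonal copies of the [E n.+1], [n >= 0];
   as traces are halved each time, the copy of [E n.+2] has room for [m + 1] copies of
   [e n = E (n + 2 + (m + 1))]. *)
Lemma exists_tower (compA : strict_comparison_of_projections A) (rr0 : real_rank_zero A)
  (simpleA : simple_cstar A) (m : nat) :
  (forall e, projection e -> e != 0 -> exists p, strictly_between p e) ->
  exists (q v : A) (e : nat -> A) (s p w : nat -> nat -> A), [/\ projection q, star v * v = q, q * v = 0 & tower m q e s p w].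
Proof.
move=> split_proj; have [[tau0 tr0] _] := compA.
have /boolp.choice[F HF] : forall E, exists fv : A * A, projection E -> E != 0 ->
    [/\ projection fv.1, fv.1 != 0, star fv.2 * fv.2 = fv.1, fv.1 * (fv.2 * star fv.2) = 0 &
      E * fv.1 = fv.1 /\ E * fv.2 = fv.2 /\ pieces 3 fv.1 E].
  move=> E; have [[pE E0]|h] := pselect (projection E /\ E != 0); last first.
    by exists (0, 0) => pE E0; case: h.
  have [p hp] := split_proj E pE E0.
  have hE := halvable_of_strictly_between tr0 simpleA rr0 pE hp.
  have [f [v [pf vf fv [ef ev] pc]]] := halvable_halves pE hE.
  exists (f, v) => _ _ /=; split=> //.
  apply/eqP => f0; have := trR_projection_gt0 tr0 simpleA pE E0.
  by have := trR_pieces tr0 pf pc; rewrite f0 trR0 mulr0; lra.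
pose E := fix E n := if n is n'.+1 then (F (E n')).1 else 1.
pose V n := (F (E n)).2.
have p1 : projection (1 : A) by split; rewrite /selfadjoint ?star1 ?mulr1.
have EP n : projection (E n) /\ E n != 0.
  elim: n => [|n [IH1 IH2]]; first by split=> //; exact: oner_neq0.
  by have [h1 h2 _ _ _] := HF (E n) IH1 IH2.
have H n : [/\ star (V n) * V n = E n.+1, E n.+1 * V n = 0, E n * E n.+1 = E n.+1,
    E n * V n = V n & pieces 3 (E n.+1) (E n)].
  have [h1 h2] := EP n; have [h3 _ h4 h5 [h6 [h7 h8]]] := HF (E n) h1 h2.
  split=> //; have vv : V n * star (V n) * V n = V n.
    by rewrite -mulrA /V h4 (partial_isometry_src h3 h4).
  by rewrite -vv mulrA [X in X * _ = _]h5 mul0r.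
have EE n k : E n * E (n + k)%N = E (n + k)%N.
  elim: k => [|k IH]; first by rewrite addn0; case: (EP n) => -[].
  by have [_ _ h _ _] := H (n + k)%N; rewrite addnS -h mulrA IH.
have half tau n : is_tracial_state tau -> 2 * trR tau (E n.+1) <= trR tau (E n).
  move=> tr; have [h1 h2 h3 h4 _] := H n.
  have pV := partial_isometry_range (proj1 (EP n.+1)) h1.
  have ps : projection (E n.+1 + V n * star (V n)).
    by apply: projectionD pV _; [case: (EP n.+1) | rewrite mulrA h2 mul0r].
  have := trR_projection_le tr ps (proj1 (EP n)).
  rewrite trRD -(trR_mvn tr h1 erefl) mulrDr h3 mulrA h4 => /(_ erefl); lra.
have halfs tau n k : is_tracial_state tau -> 2 ^+ k * trR tau (E (n + k)%N) <= trR tau (E n).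
  move=> tr; elim: k => [|k IH]; first by rewrite expr0 mul1r addn0.
  apply: le_trans IH; rewrite exprSr -mulrA addnS ler_pM2l ?exprn_gt0 //; exact: half.
(* m + 1 halvings leave a trace smaller by the factor 2^(m+1), which exceeds m + 1; this is the
   strict inequality that [fit] requires. *)
pose e n := E (n.+2 + m.+1)%N.
have /boolp.choice[s hs] : forall n, exists s : nat -> A,
    (forall i, (i < m.+1)%N -> (V n.+1 * star (V n.+1)) * s i = s i) /\ copies m.+1 (e n) s.
  move=> n; have [h1 _ _ _ _] := H n.+1.
  apply: fit => //; first by case: (EP (n.+2 + m.+1)%N).
    by apply: partial_isometry_range h1; case: (EP n.+2).
  move=> tau tr; rewrite -(trR_mvn tr h1 erefl); apply: lt_le_trans (halfs tau n.+2 m.+1 tr).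
  rewrite ltr_pM2r; first by rewrite -natrX ltr_nat ltn_expl.
  by have [? ?] := EP (n.+2 + m.+1)%N; apply: trR_projection_gt0.
have /boolp.choice[pw hpw] : forall n, exists pw : (nat -> A) * (nat -> A), cover 3 (e n) (e n.+1) pw.1 pw.2.
  move=> n; have [_ _ _ _ h] := H (n.+2 + m.+1)%N.
  by have [p [w hc]] := pieces_cover h; exists (p, w).
have [v0 qv0 _ _ _] := H 0%N.
(* The range of [V 0] is left out of the tower: it is the copy of q = E 1 in the complement of q. *)
exists (E 1%N), (V 0%N), e, s, (fun n => (pw n).1), (fun n => (pw n).2); split=> //.
  by case: (EP 1%N).
have VV a b : (a < b)%N -> star (V a) * V b = 0.
  move=> ab; have [h1 h2 _ _ _] := H a; have [_ _ _ h4 _] := H b.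
  have ea : E a.+1 * V b = V b by have := EE a.+1 (b - a.+1)%N; rewrite subnKC // => h; rewrite -h4 mulrA h.
  rewrite -ea mulrA (_ : star (V a) * E a.+1 = 0) ?mul0r //.
  by rewrite -[RHS]star0 -h2 starMr; case: (EP a.+1) => -[->].
split=> //.
- by move=> n; case: (EP (n.+2 + m.+1)%N).
- by move=> n; case: (EP (n.+2 + m.+1)%N).
- by move=> n; case: (hs n).
- have orth n k i j : (n < k)%N -> (i < m.+1)%N -> (j < m.+1)%N -> star (s n i) * s k j = 0.
    move=> nk hi hj; have [h1 _] := hs n; have [h2 _] := hs k.
    rewrite -(h1 i hi) -(h2 j hj).
    have h := VV n.+1 k.+1 nk; cstar with h.
  move=> n k i j; rewrite neq_ltn => /orP[] nk hi hj; first exact: orth.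
  by rewrite -[LHS]starK starMr starK orth // star0.
- move=> n i hi; have [h1 _] := hs n; rewrite -(h1 i hi).
  have [_ _ _ h4 _] := H n.+1; have h := EE 1%N n; rewrite add1n in h.
  by rewrite -h4 !mulrA h.
Qed.

End TowerExistence.


(** * Algebras without minimal projections *)

Section Nonminimal.
Context {R : realType} {A : unitalCStarAlgType R}.
Implicit Types (a q u v x f : A).

Lemma scalar_sub_invertible x (M : R) : nrm x < M -> exists r,
  [/\ r * (M%:C *: 1 - x) = 1, (M%:C *: 1 - x) * r = 1 & forall z, z * x = x * z -> z * r = r * z].
Proof.
move=> xM; have M0 : 0 < M by apply: le_lt_trans xM; exact: nrm_ge0.
pose x' := (M^-1)%:C *: x.
have [|y [y1 y2 yc]] := @neumann _ _ x'.
  by rewrite nrmZ ger0_norm ?invr_ge0 ?ltW // mulrC ltr_pdivrMr // mul1r.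
have E : M%:C *: 1 - x = M%:C *: (1 - x').
  by rewrite scalerBr /x' scaleCA mulfV ?lt0r_neq0 // scaleC1.
exists ((M^-1)%:C *: y); rewrite E -!scalerAl -!scalerAr !scaleCA mulVf ?mulfV ?lt0r_neq0 //.
rewrite !scaleC1; split=> // z zx; rewrite -scalerAl -scalerAr yc //.
by rewrite /x'; cstar with zx.
Qed.

(* The off-diagonal corners of [a - [y, z]] are removed by a Sylvester equation: the spectrum of
   [Lp] lies at distance from that of [Lq]. *)
Lemma corner_assembly (n : nat) (p q : A) (g : nat -> A) a x Lq Bq :
  projection q -> p = 1 - q ->
  (forall i, (i < n)%N -> projection (g i)) ->
  (forall i j, (i < n)%N -> (j < n)%N -> i != j -> g i * g j = 0) -> \sum_(i < n) g i = p ->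
  (forall i, (i < n)%N -> g i * (a - x) * g i = 0) ->
  q * Lq = Lq -> Lq * q = Lq -> q * Bq = Bq -> Bq * q = Bq ->
  q * (a - x) * q = Lq * Bq - Bq * Lq ->
  exists L B, a = x + (L * B - B * L).
Proof.
move=> [qs qE] pE gp go gs gx qL Lq_ qB Bq_ hq.
set d := a - x in gx hq.
have pp : p * p = p by rewrite pE; cstar with qE.
have ps : star p = p by rewrite pE; cstar with qs.
have pq : p * q = 0 by rewrite pE; cstar with qE.
have qp : q * p = 0 by rewrite pE; cstar with qE.
(* The eigenvalues M + i are 1 apart and exceed the norm of [Lq], so each M + i - Lq is
   invertible. *)
pose M := nrm Lq + 1.
pose l (i : 'I_n) : R := M + i%:R.
have gE i : (i < n)%N -> g i * g i = g i by move=> /gp[].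
have pg i : (i < n)%N -> p * g i = g i.
  move=> hi; rewrite -gs mulr_suml (sum_delta (i := Ordinal hi)) /= ?gE // => j ji.
  by apply: go.
have gpr i : (i < n)%N -> g i * p = g i.
  by move=> hi; have := congr1 star (pg i hi); rewrite starMr ps; case: (gp i hi) => ->.
have [|||||||Bp [pB Bp_ hB _]] := @zero_diagonal_commutator _ _ _ (fun i : 'I_n => g i) l 1 (p * d * p).
- by move=> i; exact: gp.
- by move=> i j ij; exact: go.
- by rewrite gs !mulrA pp.
- by rewrite gs -!mulrA pp.
- by move=> i; rewrite !mulrA gpr // -!mulrA pg // !mulrA gx.
- exact: ltr01.
- by move=> i j ij; rewrite /l opprD addrACA subrr add0r; exact: natr_dist_ge1.
rewrite gs in pB Bp_; set Lp := \sum_i _ in hB.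
have Lpg i : (i < n)%N -> Lp * g i = (M + i%:R)%:C *: g i.
  move=> hi; rewrite mulr_suml (sum_delta (i := Ordinal hi)) /= -?scalerAl ?gE // => j ji.
  by rewrite -scalerAl go // scaler0.
have gLp i : (i < n)%N -> g i * Lp = (M + i%:R)%:C *: g i.
  move=> hi; rewrite mulr_sumr (sum_delta (i := Ordinal hi)) /= -?scalerAr ?gE // => j ji.
  by rewrite -scalerAr go ?scaler0 // eq_sym.
have pLp : p * Lp = Lp.
  by rewrite mulr_sumr; apply: eq_bigr => i _; rewrite -scalerAr pg.
have Lpp : Lp * p = Lp.
  by rewrite mulr_suml; apply: eq_bigr => i _; rewrite -scalerAl gpr.
have /boolp.choice[r hr] : forall i : nat, exists r, [/\ r * ((M + i%:R)%:C *: 1 - Lq) = 1,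
    ((M + i%:R)%:C *: 1 - Lq) * r = 1 & forall z, z * Lq = Lq * z -> z * r = r * z].
  by move=> i; apply: scalar_sub_invertible; rewrite /M; have := ler0n R i; lra.
have qr i : q * r i = r i * q by have [_ _ h] := hr i; apply: h; rewrite qL Lq_.
(* The solutions of the two Sylvester equations, written row by row and column by column with the
   resolvents [r i] of [Lq]. *)
pose b := \sum_(i < n) g i * d * q * r i; pose b' := - \sum_(i < n) r i * q * d * g i.
have pb : p * b = b by rewrite mulr_sumr; apply: eq_bigr => i _; rewrite !mulrA pg.
have bq : b * q = b.
  by rewrite mulr_suml; apply: eq_bigr => i _; have h := qr i; cstar with (esym h, qE).
have qb' : q * b' = b'.
  by rewrite mulrN mulr_sumr; congr (- _); apply: eq_bigr => i _; have h := qr i; cstar with (h, qE).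
have b'p : b' * p = b'.
  by rewrite mulNr mulr_suml; congr (- _); apply: eq_bigr => i _; have h := gpr i (ltn_ord i); cstar with h.
have e1 : Lp * b - b * Lq = p * d * q.
  rewrite mulr_sumr [b * _]mulr_suml -sumrB -gs !mulr_suml; apply: eq_bigr => i _.
  have [h1 _ _] := hr i; have h2 := Lpg i (ltn_ord i).
  rewrite -[RHS]mulr1 -h1; cstar with h2.
have e2 : Lq * b' - b' * Lp = q * d * p.
  rewrite /b' mulrN mulNr opprK addrC mulr_suml mulr_sumr -sumrB -gs mulr_sumr.
  apply: eq_bigr => i _; have [_ h1 _] := hr i; have h2 := gLp i (ltn_ord i).
  rewrite (_ : q * d * g i = q * (1 * (q * d * g i))); last by cstar with qE.
  rewrite -h1; have h3 := qr i; cstar with (h2, h3, qL, qE).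
exists (Lp + Lq), (Bp + Bq + b + b').
have o1 u v : u * p = u -> q * v = v -> u * v = 0.
  by move=> h1 h2; rewrite -h1 -h2 mulrA -(mulrA u) pq mulr0 mul0r.
have o2 u v : u * q = u -> p * v = v -> u * v = 0.
  by move=> h1 h2; rewrite -h1 -h2 mulrA -(mulrA u) qp mulr0 mul0r.
have -> : (Lp + Lq) * (Bp + Bq + b + b') - (Bp + Bq + b + b') * (Lp + Lq) =
    (Lp * Bp - Bp * Lp) + (Lq * Bq - Bq * Lq) + (Lp * b - b * Lq) + (Lq * b' - b' * Lp).
  cstar with (o1 _ _ Lpp qB, o1 _ _ Lpp qb', o2 _ _ Lq_ pB, o2 _ _ Lq_ pb, o1 _ _ Bp_ qL,
    o2 _ _ Bq_ pLp, o2 _ _ bq pLp, o1 _ _ b'p qL).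
rewrite hB -hq e1 e2 pE (_ : _ + _ + _ + _ = d); first by rewrite /d; cstar.
by cstar.
Qed.

(* The tower lies in the corner of [q], whose complement contains a copy of [q]. The commutator
   [y, z] moves [a] into the corner of [e 0], where [tower_commutators] applies; what remains is
   treated by [corner_assembly]. *)
Lemma commutators_of_tower (compA : strict_comparison_of_projections A) (rr0 : real_rank_zero A)
  (simpleA : simple_cstar A) a :
  (forall e : A, projection e -> e != 0 -> exists p, strictly_between p e) ->
  (forall tau, is_tracial_state tau -> tau a = 0) ->
  exists y z L B, a = (y * z - z * y) + (L * B - B * L).
Proof.
move=> split_proj ta; have [[tau0 tr0] _] := compA.
pose K := (66 * 16)%N.
have [q [v [e [s [p [w [pq vq qv tw]]]]]]] :=
  exists_tower compA rr0 simpleA ((K + 9) + (K + 9)) split_proj.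
have [qs qE] := pq; have pr := projectionC pq.
set c := 1 - q in pr.
have vq' := partial_isometry_src pq vq.
have pe0 := tower_proj tw 0.
have [n pc] := pieces_exists tr0 simpleA rr0 pe0 (tower_neq0 tw 0) pr.
have [g [u cov]] := pieces_cover pc.
have [cov1 cov2 cov3] := cov.
pose t := s 0%N 0%N.
have te : star t * t = e 0%N by rewrite (tower_copies tw 0).
have qt : q * t = t by exact: (tower_below tw 0).
have te' := partial_isometry_src pe0 te.
have [e0s e0E] := pe0.
have eu i : (i < n)%N -> e 0%N * u i = u i by move=> hi; case: (cov1 i hi).
have ue i : (i < n)%N -> star (u i) * e 0%N = star (u i).
  by move=> hi; rewrite -[in RHS]eu // starMr e0s.
have cq : c * q = 0 by rewrite /c; cstar with qE.
have qc : q * c = 0 by rewrite /c; cstar with qE.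
have cE : c * c = c by case: pr.
have cs : star c = c by case: pr.
have cv : c * v = v by rewrite /c mulrBl mul1r qv subr0.
(* Subtracting the commutator of [q * a * star v] and [v] from [a] clears the corner of [q] and
   leaves [c0] in the complementary corner. *)
pose c0 := c * a * c + v * a * star v.
pose W := \sum_(i < n) u i; pose V := \sum_(i < n) g i * c0 * star (u i).
pose d := \sum_(i < n) u i * c0 * star (u i).
have WV : W * V = d.
  rewrite mulr_sumr; apply: eq_bigr => i _.
  by rewrite !mulrA (cover_row cov).
have gV i : (i < n)%N -> g i * V = g i * c0 * star (u i).
  move=> hi; rewrite mulr_sumr (sum_delta (i := Ordinal hi)) /=.
    by have [[_ gE] _ _] := cov1 i hi; rewrite !mulrA gE.
  by move=> j ji; rewrite !mulrA cov2 ?mul0r // eq_sym.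
have gVWg i : (i < n)%N -> g i * V * W * g i = g i * c0 * g i.
  by move=> hi; rewrite -mulrA (cover_row cov) // gV // -mulrA; have [_ -> _] := cov1 i hi.
have gc i : (i < n)%N -> g i * c = g i.
  by move=> hi; apply: projection_le_comm => //; [case: (cov1 i hi) | exact: (cover_le cov hi)].
have uc i : (i < n)%N -> u i * c = u i.
  by move=> hi; rewrite -(cover_src cov hi) -mulrA gc.
have eW : e 0%N * W = W by rewrite mulr_sumr; apply: eq_bigr => i _; exact: eu.
have Wc : W * c = W by rewrite mulr_suml; apply: eq_bigr => i _; exact: uc.
have cV : c * V = V by rewrite mulr_sumr; apply: eq_bigr => i _; rewrite !mulrA (cover_le cov).
have Ve : V * e 0%N = V by rewrite mulr_suml; apply: eq_bigr => i _; rewrite -mulrA ue.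
have ded : e 0%N * d * e 0%N = d by rewrite -WV mulrA eW -mulrA Ve.
have td tau : is_tracial_state tau -> tau d = 0.
  move=> tr; rewrite /d linear_sum /= (eq_bigr (fun i : 'I_n => tau (c0 * g i))); last first.
    move=> i _; rewrite (tracial_stateC tr (u i * c0)) mulrA (tracial_stateC tr _ c0).
    by have [_ -> _] := cov1 i (ltn_ord i).
  rewrite -linear_sum /= -mulr_sumr cov3 /c0 mulrDl linearD /=.
  rewrite (_ : v * a * star v * c = v * a * star v); last first.
    have h : star v * c = star v by rewrite -[in RHS]cv starMr cs.
    by rewrite -mulrA h.
  rewrite -[c * a * c * c]mulrA cE (tracial_stateC tr (c * a)) mulrA cE (tracial_stateC tr (v * a)) mulrA vq.
  by rewrite -linearD /= /c -mulrDl subrK mul1r ta.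
have [Y [Z [Lam [B [[qY Yq] [qZ Zq] [qL Lq] [qB Bq] main]]]]] :=
  tower_commutators compA rr0 simpleA (leqnn _) qs tw ded td.
rewrite -/t in main.
(* The pair [V * star t], [t * W] trades the diagonal blocks of [c0] for the element [d] on the copy
   [t] of [e 0], as in [stage]; [Y] and [Z] then treat [d]. *)
pose y := Y + q * a * star v + V * star t; pose z := Z + v + t * W.
have tq : star t * q = star t by rewrite -[in RHS]qt starMr qs.
have vsq : star v * q = 0 by rewrite -[RHS]star0 -qv starMr qs.
have qvs : q * star v = star v by rewrite -{2}vq' starMr qs.
have o1 f x : f * c = f -> q * x = x -> f * x = 0.
  by move=> h1 h2; rewrite -h1 -h2 mulrA -(mulrA f) cq mulr0 mul0r.
have o2 f x : f * q = f -> c * x = x -> f * x = 0.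
  by move=> h1 h2; rewrite -h1 -h2 mulrA -(mulrA f) qc mulr0 mul0r.
have hqq : q * (a - (y * z - z * y)) * q = Lam * B - B * Lam.
  have Wq : W * q = 0 by rewrite -Wc -mulrA cq mulr0.
  have qV : q * V = 0 by rewrite -cV mulrA qc mul0r.
  have Yv : Y * v = 0 by exact: o2.
  have svZ : star v * Z = 0 by rewrite -qZ mulrA vsq mul0r.
  have ZV : Z * V = 0 by exact: o2.
  have WY : W * Y = 0 by exact: o1.
  have -> : q * (a - (y * z - z * y)) * q = t * d * star t - (Y * Z - Z * Y).
    rewrite /y /z -WV.
    cstar with (qY, Yq, qZ, Zq, qv, vq, vq', qt, tq, vsq, Wq, qV, Yv, svZ, ZV, WY, qE).
  by rewrite main; cstar.
have hgg i : (i < n)%N -> g i * (a - (y * z - z * y)) * g i = 0.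
  move=> hi.
  have gi := gc i hi; have cg := cover_le cov hi; rewrite -/c in cg.
  have gq : g i * q = 0 by rewrite -gi -mulrA cq mulr0.
  have qg : q * g i = 0 by rewrite -cg mulrA qc mul0r.
  have gY : g i * Y = 0 by exact: o1.
  have gZ : g i * Z = 0 by exact: o1.
  have Yg : Y * g i = 0 by exact: o2.
  have Zg : Z * g i = 0 by exact: o2.
  have gt : g i * t = 0 by exact: o1.
  have tg : star t * g i = 0 by exact: o2.
  have vg : v * g i = 0 by exact: o2.
  have st : star t * Z * g i = 0 by rewrite -mulrA Zg mulr0.
  have vY : v * Y * g i = 0 by rewrite -mulrA Yg mulr0.
  rewrite (_ : _ * g i = g i * c0 * g i - g i * V * W * g i); first by rewrite gVWg // subrr.
  rewrite /c0 /y /z.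
  cstar with (gq, qg, gY, gZ, Yg, Zg, gt, tg, vg, te, Ve, gi, cg, vq').
have [L [B' hB]] := corner_assembly pq erefl (fun i hi => let: And3 h _ _ := cov1 i hi in h) cov2 cov3 hgg qL Lq qB Bq hqq.
by exists y, z, L, B'.
Qed.

End Nonminimal.


(** * Algebras with a minimal projection; self-commutators *)

Section Minimal.
Context {R : realType} {A : unitalCStarAlgType R}.
Implicit Types (a e p u v x y z : A).

(* By [symmetries_approx], the multiples of [x] stay at bounded distance from the real multiples
   of [e]. *)
Lemma minimal_corner_real (tau : {scalar A}) (tr : is_tracial_state tau)
  (simpleA : simple_cstar A) (rr0 : real_rank_zero A) e x :
  projection e -> e != 0 -> (forall p, ~ strictly_between p e) ->
  star x = x -> e * x = x -> exists l : R, x = l%:C *: e.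
Proof.
move=> pe e0 min xs ex; have Te := trR_projection_gt0 tr simpleA pe e0.
set T := trR tau in Te; pose l := T x / T e; exists l.
have [N hN] : exists N : nat, nrm x <= N%:R.
  exists (Num.truncn (nrm x)).+1; apply/ltW; exact: truncnS_gt.
have min' p : projection p -> e * p = p -> p = 0 \/ p = e.
  move=> pp ep; have [->|p0] := eqVneq p 0; first by left.
  by have [->|pE] := eqVneq p e; [right | case: (min p)].
apply/eqP; rewrite -subr_eq0; apply/eqP/nrm_eq0/eqP; rewrite eq_le nrm_ge0 andbT leNgt; apply/negP => d0.
set d := nrm _ in d0.
(* 2 bounds the distance of K x from some real multiple m e; taking traces, the coefficient m
   differs from K l by at most 2/T(e). *)
pose C := 2 + 2 / T e.
have H (K : nat) : K%:R * d <= C.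
  have [|||P [hP hs]] := @symmetries_approx _ _ rr0 e ((K%:R : R)%:C *: x) (K * N) pe.
  - by cstar with xs.
  - by cstar with ex.
  - by rewrite nrmZ ger0_norm ?ler0n // natrM ler_wpM2l ?ler0n.
  (* By minimality each [P i] is 0 or [e], so each difference is -e or e. *)
  have [m hm] : exists m : R, \sum_(i < K * N) (P i - (e - P i)) = m%:C *: e.
    elim: (K * N)%N {hs} => [|k [m IH]]; first by exists 0; rewrite big_ord0 scale0r.
    rewrite big_ord_recr /= IH; case: (hP k) => pk ek; case: (min' _ pk ek) => ->.
      by exists (m - 1); rewrite -scaleCD scaleCN scaleC1; cstar.
    by exists (m + 1); rewrite -scaleCD scaleC1; cstar.
  rewrite hm in hs; have h1 := trR_le_nrm tr ((K%:R : R)%:C *: x - m%:C *: e).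
  have h2 : `|K%:R * l - m| * T e <= 2.
    rewrite -{1}[T e]gtr0_norm // -normrM; apply: le_trans hs; apply: le_trans h1.
    by rewrite trRB !trRZ /l -/T mulrBl -mulrA divfK ?lt0r_neq0.
  have -> : K%:R * d = nrm ((K%:R : R)%:C *: x - m%:C *: e + (m - K%:R * l)%:C *: e).
    by rewrite /d -[in LHS](ger0_norm (ler0n R K)) -nrmZ; congr nrm; rewrite -scaleCD scaleCN -(scaleCA K%:R); rewrite scalerBr addrA subrK.
  apply: le_trans (nrmD _ _) _; apply: lerD => //; rewrite nrmZ distrC.
  apply: (@le_trans _ _ `|K%:R * l - m|).
    by apply: ler_piMr => //; exact: nrm_projection.
  by rewrite ler_pdivlMr.
have := H (Num.truncn (C / d)).+1.
have := truncnS_gt (C / d); rewrite ltr_pdivrMr // => h1 h2.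
by have := lt_le_trans h1 h2; rewrite ltxx.
Qed.

Lemma minimal_corner (tau : {scalar A}) (tr : is_tracial_state tau)
  (simpleA : simple_cstar A) (rr0 : real_rank_zero A) e x :
  projection e -> e != 0 -> (forall p, ~ strictly_between p e) ->
  e * x = x -> x * e = x -> exists l : R[i], x = l *: e.
Proof.
move=> pe e0 min ex xe; have [es _] := pe.
have ex' : e * star x = star x by rewrite -[in RHS]xe starMr es.
have H := minimal_corner_real tr simpleA rr0 pe e0 min.
have [||l hl] := H (x + star x); [by cstar | by cstar with (ex, ex')|].
have [||m hm] := H ('i *: (x - star x)).
- by rewrite star_i -scalerN; congr (_ *: _); cstar.
- by rewrite -scalerAr; congr (_ *: _); cstar with (ex, ex').
exists ((2^-1 : R)%:C * (l%:C - 'i * m%:C)).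
rewrite -scalerA scalerBl -hl -scalerA -hm scale_ii opprK.
by rewrite -[LHS]scale_half; congr (_ *: _); cstar.
Qed.

(** As long as the complement of the copies is nonzero, it contains a nonzero projection equivalent
    to one below [e], which by minimality is [e] itself. The trace allows at most 1/T(e) copies. *)
Lemma minimal_copies (tau : {scalar A}) (tr : is_tracial_state tau)
  (simpleA : simple_cstar A) (rr0 : real_rank_zero A) e :
  projection e -> e != 0 -> (forall p, ~ strictly_between p e) ->
  exists n s, copies n e s /\ range_sum n s = 1.
Proof.
move=> pe e0 min; have Te := trR_projection_gt0 tr simpleA pe e0.
have [es eE] := pe.
have [//|none] := pselect (exists n s, copies n e s /\ range_sum n s = 1).
have H n : exists s, copies n e s.
  elim: n => [|n [s ss]]; first by exists (fun=> 0).
  have pr := projectionC (range_projection pe ss); set r := 1 - _ in pr.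
  have rs i : (i < n)%N -> star (s i) * r = 0.
    move=> hi; have := congr1 star (range_col pe ss hi).
    by rewrite starMr star_range /r mulrBr mulr1 => ->; rewrite subrr.
  have r0 : r != 0.
    rewrite subr_eq0 eq_sym; apply/eqP => h; apply: none; by exists n, s.
  have [k pc] := pieces_exists tr simpleA rr0 pe e0 pr.
  have [t [w [pt t0 wt ew rt]]] := pieces_nonzero pc r0.
  have pw := partial_isometry_range pt wt.
  have wE : w * star w = e.
    apply: contrapT => /eqP we; apply: (min (w * star w)); split=> //.
      by rewrite mulrA ew.
    apply/eqP => w0; have := trR_projection_gt0 tr simpleA pt t0.
    by rewrite (trR_mvn tr wt w0) trR0 ltxx.
  have rw : r * star w = star w.
    have := congr1 star (partial_isometry_src pt wt); rewrite starMr; case: pt => -> _ h.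
    by rewrite -h mulrA rt.
  exists (fun i => if (i < n)%N then s i else star w) => i j hi hj.
  have sw k' : (k' < n)%N -> star (s k') * star w = 0.
    by move=> hk; rewrite -rw mulrA rs // mul0r.
  case: ltnP => hin; case: ltnP => hjn.
  - exact: ss.
  - by rewrite sw // ltn_eqF // (leq_trans hin).
  - have := congr1 star (sw j hjn); rewrite starMr star0 (starK (s j)) => ->.
    by rewrite gtn_eqF // (leq_trans hjn).
  - by rewrite starK wE eqn_leq (leq_trans (hi : (i <= n)%N) hjn) (leq_trans (hj : (j <= n)%N) hin).
have [s ss] := H (Num.truncn (trR tau e)^-1).+1.
have := truncnS_gt (trR tau e)^-1; set n := _.+1 in ss *.
have := trR_projection_le1 tr (range_projection pe ss).
rewrite /range_sum trR_sum (eq_bigr (fun=> trR tau e)); last first.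
  by move=> i _; rewrite trRC // ss // eqxx.
rewrite sumr_const card_ord -[X in X <= _]mulr_natl -ler_pdivlMr // mul1r => h1 h2.
by have := lt_le_trans h2 h1; rewrite ltxx.
Qed.

(** The sum [D] of the diagonal entries [d i] is a multiple of [e] of trace zero, hence 0. Therefore
    z y = 0, while y z has the entries [d i] on its diagonal; removing this commutator from [a]
    leaves a zero diagonal. *)
Lemma commutators_of_minimal (tau : {scalar A}) (tr : is_tracial_state tau)
  (simpleA : simple_cstar A) (rr0 : real_rank_zero A) e a :
  projection e -> e != 0 -> (forall p, ~ strictly_between p e) -> tau a = 0 ->
  exists y z L B, a = (y * z - z * y) + (L * B - B * L).
Proof.
move=> pe e0 min ta; have [es eE] := pe.
have [n [s [ss s1]]] := minimal_copies tr simpleA rr0 pe e0 min.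
have n0 : (0 < n)%N.
  by case: n ss s1 => // _ /eqP; rewrite /range_sum big_ord0 eq_sym oner_eq0.
have se i : (i < n)%N -> s i * e = s i by exact: copies_src.
have es' i : (i < n)%N -> e * star (s i) = star (s i).
  by move=> hi; rewrite -[in RHS](se i hi) starMr es.
pose d i := star (s i) * a * s i; pose D := \sum_(i < n) d i.
have ed i : (i < n)%N -> e * d i = d i by move=> hi; rewrite /d !mulrA es'.
have de i : (i < n)%N -> d i * e = d i by move=> hi; rewrite /d -!mulrA se.
have D0 : D = 0.
  have [||l hl] := @minimal_corner tau tr simpleA rr0 e D pe e0 min.
  - by rewrite mulr_sumr; apply: eq_bigr => i _; exact: ed.
  - by rewrite mulr_suml; apply: eq_bigr => i _; exact: de.
  have : tau D = 0.
    rewrite linear_sum /= (eq_bigr (fun i : 'I_n => tau (a * (s i * star (s i))))); last first.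
      by move=> i _; rewrite /d -mulrA (tracial_stateC tr) -mulrA.
    by rewrite -linear_sum -mulr_sumr [X in a * X]s1 mulr1.
  rewrite hl linearZ /= (trace_selfadjoint_real tr es) => /eqP; rewrite mulf_eq0 => /orP[/eqP->|].
    by rewrite scale0r.
  have := trR_projection_gt0 tr simpleA pe e0; rewrite lt0r => /andP[h _].
  by rewrite eq_complex /= (negbTE h).
pose y := (\sum_(i < n) s i * d i) * star (s 0%N); pose z := s 0%N * \sum_(i < n) star (s i).
have sy i : (i < n)%N -> star (s i) * y = d i * star (s 0%N).
  move=> hi; rewrite mulrA mulr_sumr (sum_delta (i := Ordinal hi)) /=.
    by rewrite mulrA ss // eqxx ed.
  by move=> j ji; rewrite mulrA ss // eq_sym (negbTE (ji : (j : nat) != i)) mul0r.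
have zs i : (i < n)%N -> z * s i = s 0%N.
  move=> hi; rewrite -mulrA mulr_suml (sum_delta (i := Ordinal hi)) /=.
    by rewrite ss // eqxx se.
  by move=> j ji; rewrite ss // (negbTE (ji : (j : nat) != i)).
have zy : z * y = 0.
  rewrite -mulrA mulr_suml (eq_bigr (fun i : 'I_n => d i * star (s 0%N))).
    by rewrite -mulr_suml -/D D0 mul0r mulr0.
  by move=> i _; exact: sy.
have sE : star (s 0%N) * s 0%N = e by rewrite ss.
have [|||||||b [_ _ hb _]] := @zero_diagonal_commutator _ _ _ (fun i : 'I_n => s i * star (s i))
  (fun i => i%:R) 1 (a - (y * z - z * y)).
- by move=> i; apply: partial_isometry_range pe _; rewrite ss // eqxx.
- move=> i j ij; have h : star (s i) * s j = 0 by rewrite ss // (negbTE ij : (i == j :> nat) = false).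
  by rewrite mulrA -(mulrA (s i)) h mulr0 mul0r.
- by rewrite [X in X * _]s1 mul1r.
- by rewrite [X in _ * X]s1 mulr1.
- move=> i; rewrite zy subr0.
  have h1 := sy i (ltn_ord i); have h2 := zs i (ltn_ord i); have h3 := de i (ltn_ord i).
  rewrite (_ : _ * _ = s i * (d i - star (s i) * y * (z * s i)) * star (s i)); last first.
    by rewrite /d; cstar.
  by rewrite h1 h2 (_ : d i - _ = 0) ?mulr0 ?mul0r //; cstar with (sE, h3).
- exact: ltr01.
- by move=> i j ij; exact: natr_dist_ge1.
exists y, z, (\sum_(i < n) (i%:R)%:C *: (s i * star (s i))), b.
by rewrite hb addrC subrK.
Qed.

(* If [P] is skew-adjoint and [Q] selfadjoint, [P + Q] has self-commutator [2 [P, Q]]; take the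
   real and imaginary parts of [u] and [v] for [P] and [Q]. *)
Lemma commutator_real_part u v : exists x1 x2,
  (2^-1 : R)%:C *: (commutator u v + star (commutator u v)) =
  commutator x1 (star x1) + commutator x2 (star x2).
Proof.
(* The two self-commutators below add up to four times [u, w] plus its adjoint, and 4w is v/2. *)
pose w := (8^-1 : R)%:C *: v.
have -> : (2^-1 : R)%:C *: (commutator u v + star (commutator u v)) =
    commutator u ((2^-1 : R)%:C *: v) + star (commutator u ((2^-1 : R)%:C *: v)).
  by rewrite /commutator; cstar.
have -> : (2^-1 : R)%:C *: v = w + w + w + w.
  by rewrite /w !scaleCD; congr (_%:C *: _); lra.
exists ((w - star w) - (u + star u)), ((u - star u) + (w + star w)).
by rewrite /commutator; cstar.
Qed.

End Minimal.

Theorem theorem3p4 (R : realType) (A : unitalCStarAlgType R)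
    (simpleA : simple_cstar A)
    (separableA : separable_cstar A)
    (rr0A : real_rank_zero A)
    (sr1A : stable_rank_one A)
    (compA : strict_comparison_of_projections A)
    (a : A)
    (tau_a : forall tau, tracial_states A tau -> tau a = 0) :
  (exists y1 y2 y3 y4 : A, a = commutator y1 y2 + commutator y3 y4) /\
  (selfadjoint a ->
   exists x1 x2 x3 x4 : A,
     a = commutator x1 (star x1) + commutator x2 (star x2)
       + commutator x3 (star x3) + commutator x4 (star x4)).
Proof.
have [[tau0 tr0] _] := compA.
have [y1 [y2 [y3 [y4 aE]]]] : exists y1 y2 y3 y4 : A, a = commutator y1 y2 + commutator y3 y4.
  have [split_proj|] := pselect (forall e : A, projection e -> e != 0 -> exists p, strictly_between p e).
    exact (commutators_of_tower compA rr0A simpleA split_proj tau_a).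
  move=> /existsNP[e /not_implyP[pe /not_implyP[e0 /forallNP min]]].
  exact (commutators_of_minimal tr0 simpleA rr0A pe e0 min (tau_a _ tr0)).
split; first by exists y1, y2, y3, y4.
move=> sa; have [x1 [x2 h1]] := commutator_real_part y1 y2.
have [x3 [x4 h2]] := commutator_real_part y3 y4.
(* A selfadjoint [a] is half of a + a*, hence the sum of the real parts of its two commutators. *)
exists x1, x2, x3, x4; rewrite -addrA -h1 -h2 -scalerDr -[LHS]scale_half.
by congr (_ *: _); rewrite -{2}sa aE starD addrACA.
Qed.
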